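(* Let $\Omega\subset\mathbb R^N$ be an open domain, $a\in\Omega$, $T>0$, $\alpha>-1$ and $q\ge q_{\alpha,N}:=1+\frac{2(1+\alpha)}{N}$. Let $u\in C^1(Q_T^\Omega)\cap C\big((\Omega\times[0,T])\setminus\{(a,0)\}\big)$, where $Q_T^\Omega=\Omega\times(0,T)$, be a solution of $$\partial_tu-\Delta u+t^\alpha|u|^{q-1}u=0\quad\text{in }Q_T^\Omega$$ such that $u(x,0)=0$ for all $x\in\Omega\setminus\{a\}$. Then $u$ can be extended by continuity as a function in $C(\Omega\times[0,T])$.
   Context: Solutions of class $C^1$ are understood in the sense of distributions in $\Omega\times(0,T)$. *)

(* Defs.v *)
From HB Require Import structures.
From mathcomp Require Import all_boot all_order all_algebra.
From mathcomp Require Import all_classical all_reals all_analysis.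
Set Implicit Arguments.
Unset Strict Implicit.
Unset Printing Implicit Defensive.
Import Order.TTheory GRing.Theory Num.Theory.
Import numFieldNormedType.Exports.

Local Open Scope classical_set_scope.
Local Open Scope ring_scope.

Section Calculus.
Context {R : realType} {V : normedModType R}.

(* A is meant to be open, so that f may take arbitrary values outside A. *)
Definition C1_on (A : set V) (f : V -> R) : Prop :=
  forall z, A z ->
    differentiable f z /\ forall v : V, {for z, continuous ('D_v f)}.

(* Only mixed directional derivatives are listed: differentiability of all of
   them makes all of them continuous. *)
Definition smooth (f : V -> R) : Prop :=
  forall (vs : seq V) (z : V),
    differentiable (foldr (fun v (g : V -> R) => 'D_v g) f vs) z.

Definition support (f : V -> R) : set V := closure [set z | f z != 0].

(* C_c^oo(A), each test function being extended by zero to V. *)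
Definition test_function (A : set V) (phi : V -> R) : Prop :=
  [/\ smooth phi, compact (support phi) & support phi `<=` A].

End Calculus.

Section Heat.
Context {R : realType}.

(* Iterated Lebesgue integral over R^n, one coordinate at a time. It is only
   applied to continuous compactly supported functions, where by Fubini it is
   the integral against n-dimensional Lebesgue measure. *)
Fixpoint space_integral (n : nat) : ('rV[R]_n -> R) -> R :=
  match n return ('rV[R]_n -> R) -> R with
  | 0 => fun f => f 0
  | m.+1 => fun f =>
      \int[@lebesgue_measure R]_s
        space_integral (fun y : 'rV[R]_m =>
          f (row_mx (const_mx s : 'rV[R]_1) y))
  end.

Variable N : nat.
Notation spacetime := ('rV[R]_N * R)%type.

Definition spacetime_integral (F : spacetime -> R) : R :=
  \int[@lebesgue_measure R]_t space_integral (fun x => F (x, t)).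

Definition dt (f : spacetime -> R) : spacetime -> R := 'D_(0, 1) f.

Definition dx (i : 'I_N) (f : spacetime -> R) : spacetime -> R :=
  'D_(delta_mx 0 i, 0) f.

Definition laplacian (f : spacetime -> R) (z : spacetime) : R :=
  \sum_(i < N) dx i (dx i f) z.

Definition cylinder (Omega : set 'rV[R]_N) (T : R) : set spacetime :=
  Omega `*` `]0, T[.

(* u_t - Delta u + t^alpha |u|^(q-1) u = 0 in D'(Omega x (0,T)). The integrand
   vanishes off the support of phi, so u matters only on the cylinder. *)
Definition distributional_solution (Omega : set 'rV[R]_N) (T alpha q : R)
    (u : spacetime -> R) : Prop :=
  forall phi : spacetime -> R, test_function (cylinder Omega T) phi ->
    spacetime_integral (fun z =>
      - u z * dt phi z - u z * laplacian phi z
      + z.2 `^ alpha * `|u z| `^ (q - 1) * u z * phi z) = 0.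

End Heat.

Definition q_crit {R : realType} (alpha : R) (N : nat) : R :=
  1 + 2 * (1 + alpha) / N%:R.

(* Main.v *)
(* Write m = N/2 + k and rho = |x - a|^2 + t. By mollification, at a point where
   u - w has a maximum over a backward box, w_t - Delta w + t^alpha |u|^(q-1) u
   <= 0; so continuous weak solutions can be compared with two explicit
   supersolutions.
   First, eps + A t^k rho^m (rho - tau)^(- 2 m) is a supersolution that is
   infinite on the paraboloid rho = tau around the singularity, whence
   u <= eps + A' t^k rho^(- m) uniformly in tau: the universal bound by a
   self-similar profile of finite mass.
   Second, with theta = 1 + c ln (t / tau) and p = 1 / (q - 1), the function
   eps + K theta^(- p) E + A' theta^(- p - 1) t^k rho^(- m), E the heat kernel, is a
   supersolution for t > tau because q >= 1 + 2 (1 + alpha) / N makes the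
   absorption of E at least of order 1 / t near the parabola |x - a|^2 ~ t; it
   dominates u at t = tau and tends to eps as tau -> 0. Hence u <= eps near
   (a, 0), and the same holds for - u. *)
Require Import Defs.
From HB Require Import structures.
From mathcomp Require Import all_boot all_order all_algebra.
From mathcomp Require Import all_classical all_reals all_analysis.
From mathcomp Require Import ring lra.
Import Order.TTheory GRing.Theory Num.Theory.
Import numFieldNormedType.Exports.
Local Open Scope classical_set_scope.
Local Open Scope ring_scope.
Set Implicit Arguments.
Unset Strict Implicit.
Unset Printing Implicit Defensive.

(** * Iterated integrals of compactly supported functions *)

(** The mollifier is a tensor product of one-variable bumps, so that a partial derivative affects
    one factor, the mass follows from the iterated integral, and the natural neighbourhoods are
    boxes. The logarithm in theta reflects criticality: near the parabola the absorption rate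
    $t^\alpha E^{q-1}$ is at least of order $1/t$, which is not integrable at 0, so a point mass is
    eroded completely. The derivative of $\theta^{-p}E$ costs $(pc/t)\theta^{-p-1}E$, to be balanced
    against $t^\alpha\theta^{-pq}E^q$; equal powers of theta force $p(q-1)=1$. Far from the parabola
    the Gaussian is too small for this, while the heat operator multiplies $t^k\rho^{-m}$ by about
    $k/t$, so such a tail pays the same cost there. Being equal to the self-similar bound at
    $t=\tau$, it also dominates [u] initially with a constant independent of $\tau$. *)

Definition unif_cont {R : realType} {X : pseudoMetricType R} (f : X -> R) :=
  forall e : R, 0 < e -> exists2 d : R, 0 < d &
    forall x y, ball x d y -> `|f x - f y| < e.

Definition bdd_fun {R : realType} {X : Type} (f : X -> R) :=
  exists M : R, forall x, `|f x| <= M.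

Section UnifCont.
Context {R : realType} {X : pseudoMetricType R}.
Implicit Types f g : X -> R.

Let min_le_l (a b : R) : Num.min a b <= a. Proof. by rewrite ge_min lexx. Qed.
Let min_le_r (a b : R) : Num.min a b <= b. Proof. by rewrite ge_min lexx orbT. Qed.

Lemma unif_cont_continuous f : unif_cont f -> continuous f.
Proof.
move=> uf x; apply/cvgrPdist_lt => e e0.
have [d d0 dP] := uf e e0.
by near=> y; apply: dP; near: y; exact: near_ball.
Unshelve. all: by end_near. Qed.

Lemma unif_cont_cst (c : R) : unif_cont (fun _ : X => c).
Proof. by move=> e e0; exists 1 => // x y _; rewrite subrr normr0. Qed.

Lemma unif_contD f g : unif_cont f -> unif_cont g -> unif_cont (f \+ g).
Proof.
move=> uf ug e e0; have e2 : 0 < e / 2 by rewrite divr_gt0.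
have [d1 d10 h1] := uf _ e2; have [d2 d20 h2] := ug _ e2.
exists (Num.min d1 d2) => [|x y xy]; first by rewrite lt_min d10.
have := h1 x y (le_ball (min_le_l _ _) xy).
have := h2 x y (le_ball (min_le_r _ _) xy).
move=> H2 H1; rewrite /= opprD addrACA (splitr e).
by rewrite (le_lt_trans (ler_normD _ _))// ltrD.
Qed.

Lemma unif_contM f g : bdd_fun f -> bdd_fun g ->
  unif_cont f -> unif_cont g -> unif_cont (f \* g).
Proof.
move=> [M fM] [L gL] uf ug e e0.
pose C := `|M| + `|L| + 1.
have C0 : 0 < C by rewrite /C ltr_wpDl ?addr_ge0.
have e2 : 0 < e / 2 / C by rewrite !divr_gt0.
have [d1 d10 h1] := uf _ e2; have [d2 d20 h2] := ug _ e2.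
exists (Num.min d1 d2) => [|x y xy]; first by rewrite lt_min d10.
have := h1 x y (le_ball (min_le_l _ _) xy).
have := h2 x y (le_ball (min_le_r _ _) xy).
move=> H2 H1 /=.
have -> : f x * g x - f y * g y = (f x - f y) * g x + f y * (g x - g y) by ring.
rewrite (le_lt_trans (ler_normD _ _))// !normrM (splitr e).
have gC : `|g x| <= C.
  by rewrite (le_trans (gL x))// (le_trans (ler_norm L))// /C -addrA addrCA lerDl addr_ge0.
have fC : `|f y| <= C.
  by rewrite (le_trans (fM y))// (le_trans (ler_norm M))// /C -addrA lerDl addr_ge0.
apply: ltrD.
  rewrite (le_lt_trans (ler_wpM2l (normr_ge0 _) gC))//.
  by rewrite -ltr_pdivlMr.
rewrite mulrC (le_lt_trans (ler_wpM2l (normr_ge0 _) fC))//.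
by rewrite -ltr_pdivlMr.
Qed.

Lemma bdd_funM f g : bdd_fun f -> bdd_fun g -> bdd_fun (f \* g).
Proof.
move=> [M fM] [L gL]; exists (M * L) => x /=.
by rewrite normrM ler_pM.
Qed.

Lemma bdd_funD f g : bdd_fun f -> bdd_fun g -> bdd_fun (f \+ g).
Proof.
move=> [M fM] [L gL]; exists (M + L) => x /=.
by rewrite (le_trans (ler_normD _ _))// lerD.
Qed.

Lemma unif_contZ (c : R) f : unif_cont f -> unif_cont (fun x => c * f x).
Proof.
move=> uf e e0.
have C0 : 0 < `|c| + 1 by rewrite ltr_wpDl.
have [d d0 dP] := uf (e / (`|c| + 1)) (divr_gt0 e0 C0).
exists d => // x y /dP; rewrite ltr_pdivlMr// => h.
rewrite -mulrBr normrM (le_lt_trans _ h)// mulrC ler_wpM2l//.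
by rewrite lerDl.
Qed.

Lemma bdd_prod (I : Type) (r : seq I) (P : pred I) (F : I -> X -> R) :
  (forall i, bdd_fun (F i)) -> bdd_fun (fun x => \prod_(i <- r | P i) F i x).
Proof.
move=> bF; elim: r => [|i r IH].
  by exists 1 => x; rewrite big_nil normr1.
case Pi: (P i); last first.
  by have [M hM] := IH; exists M => x; rewrite big_cons Pi.
have [M hM] := bdd_funM (bF i) IH; exists M => x; rewrite big_cons Pi; exact: hM.
Qed.

Lemma unif_cont_prod (I : Type) (r : seq I) (P : pred I) (F : I -> X -> R) :
  (forall i, bdd_fun (F i)) -> (forall i, unif_cont (F i)) ->
  unif_cont (fun x => \prod_(i <- r | P i) F i x).
Proof.
move=> bF uF; elim: r => [|i r IH].
  by under eq_fun do rewrite big_nil; exact: unif_cont_cst.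
case Pi: (P i); under eq_fun do rewrite big_cons Pi; last exact: IH.
by apply: (@unif_contM (F i)) => //; exact: bdd_prod.
Qed.

End UnifCont.

Lemma unif_cont_comp {R : realType} {X Y : pseudoMetricType R} (g : X -> Y)
    (f : Y -> R) :
  (forall x d y, ball x d y -> ball (g x) d (g y)) ->
  unif_cont f -> unif_cont (f \o g).
Proof.
by move=> hg uf e e0; have [d d0 dP] := uf e e0; exists d => // x y /hg/dP.
Qed.

Lemma coord_ball {R : realType} n (i : 'I_n) (x : 'rV[R]_n) d y :
  ball x d y -> ball (x 0 i) d (y 0 i).
Proof. by move=> [_]; exact. Qed.

Section LineIntegral.
Context {R : realType}.
Notation mu := (@lebesgue_measure R).

(** Uniform continuity, rather than continuity, gives a modulus common to all slices, so that
    integrating out one variable stays in such a class; the common radius [B] keeps sums in it. *)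
Definition cc1 (B : R) (g : R -> R) :=
  unif_cont g /\ forall s, B < `|s| -> g s = 0.

Lemma cc1_restrict B g : cc1 B g -> g = g \_ `[- B, B].
Proof.
move=> [_ g0]; apply/funext => s; rewrite patchE.
case: ifPn => // /negP sB; apply: g0; rewrite ltNge ler_norml; apply/negP => h.
by apply: sB; rewrite inE /= in_itv.
Qed.

Lemma cc1_integrable B g : cc1 B g -> mu.-integrable setT (EFin \o g).
Proof.
move=> cg; have : mu.-integrable `[- B, B] (EFin \o g).
  apply: continuous_compact_integrable; first exact: segment_compact.
  by apply: continuous_subspaceT; apply: unif_cont_continuous; case: cg.
by rewrite integrable_mkcond//= restrict_EFin -(cc1_restrict cg).
Qed.

Lemma line_integralD B f g : cc1 B f -> cc1 B g ->
  \int[mu]_s (f s + g s) = \int[mu]_s f s + \int[mu]_s g s.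
Proof. by move=> cf cg; rewrite RintegralD//; apply: cc1_integrable; eauto. Qed.

Lemma line_integralZ B c f : cc1 B f ->
  \int[mu]_s (c * f s) = c * \int[mu]_s f s.
Proof. by move=> cf; rewrite RintegralZl//; apply: cc1_integrable; eauto. Qed.

Lemma line_integral_le B f g : cc1 B f -> cc1 B g -> (forall s, f s <= g s) ->
  \int[mu]_s f s <= \int[mu]_s g s.
Proof.
by move=> cf cg fg; apply: le_Rintegral => //; apply: cc1_integrable; eauto.
Qed.

Lemma line_integral_bound B M f : 0 <= B -> cc1 B f -> (forall s, `|f s| <= M) ->
  `|\int[mu]_s f s| <= 2 * B * M.
Proof.
move=> B0 cf fM.
have If := cc1_integrable cf.
have IfB : mu.-integrable `[- B, B] (EFin \o f) by apply: integrableS If.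
rewrite (cc1_restrict cf) -Rintegral_mkcond.
rewrite (le_trans (le_normr_Rintegral _ _))//.
apply: (@le_trans _ _ (\int[mu]_(s in `[- B, B]) M)).
  apply: le_Rintegral => //; first exact: integrable_norm.
  apply: continuous_compact_integrable; first exact: segment_compact.
  by apply: continuous_subspaceT => x; exact: cvg_cst.
have mB : mu `[- B, B] = (2 * B)%:E.
  rewrite lebesgue_measure_itv/= lte_fin; case: ltP => h /=.
    by rewrite opprK -EFinD -mulr2n mulr_natl.
  have -> : B = 0 by apply/eqP; rewrite eq_le B0 andbT; lra.
  by rewrite mulr0.
by rewrite Rintegral_cst//; rewrite [X in M * fine X]mB /= mulrC.
Qed.


Lemma line_integral_shift (f : R -> R) (c : R) : continuous f ->
  (forall s, 0 <= f s) -> \int[mu]_s f (s - c) = \int[mu]_s f s.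
Proof.
move=> cf f0; rewrite /Rintegral; congr fine.
have dF x : is_derive x (1 : R) (fun s : R => s - c) 1.
  by apply: is_derive_eq; rewrite subr0.
have dE : derive1 (fun s : R => s - c) = fun=> 1.
  by apply/funext => x; rewrite derive1E; apply: derive_val.
have H := @increasing_ge0_integration_by_substitutionT R (fun s => s - c) f.
rewrite H //.
- by apply: eq_integral => x _ /=; rewrite dE mulr1.
- by move=> x y; rewrite ltrD2r.
- by rewrite dE => x; exact: cvg_cst.
- by rewrite dE; exact: is_cvg_cst.
- by rewrite dE; exact: is_cvg_cst.
- exact: cvg_addrr_Ny.
- exact: cvg_addrr.
Qed.

End LineIntegral.

Section IteratedIntegral.
Context {R : realType}.
Notation mu := (@lebesgue_measure R).

Definition ccn n (B : R) (f : 'rV[R]_n -> R) :=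
  unif_cont f /\ forall (x : 'rV[R]_n) (i : 'I_n), B < `|x 0 i| -> f x = 0.

Definition cons_rv n (s : R) (y : 'rV[R]_n) : 'rV[R]_n.+1 :=
  row_mx (const_mx s : 'rV[R]_1) y.

Lemma cons_rv0 n s (y : 'rV[R]_n) : cons_rv s y 0 ord0 = s.
Proof.
have -> : ord0 = lshift n (ord0 : 'I_1) by apply: val_inj.
by apply: etrans (row_mxEl _ _ _ _) _; rewrite mxE.
Qed.

Lemma cons_rvS n s (y : 'rV[R]_n) i : cons_rv s y 0 (lift ord0 i) = y 0 i.
Proof.
have -> : lift ord0 i = rshift 1 i by apply: val_inj.
exact: row_mxEr.
Qed.

Lemma cons_rv_ball n (s s' d : R) (y y' : 'rV[R]_n) :
  ball s d s' -> ball y d y' -> ball (cons_rv s y) d (cons_rv s' y').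
Proof.
move=> ss' [d0 yy']; split=> // i j; rewrite ord1.
case: (unliftP ord0 j) => [k|] ->; rewrite ?cons_rv0 ?cons_rvS//.
Qed.

Lemma ccn_slice n B (f : 'rV[R]_n.+1 -> R) s :
  ccn B f -> ccn B (fun y => f (cons_rv s y)).
Proof.
move=> [uf f0]; split=> [e e0|x i xi].
  have [d d0 dP] := uf e e0; exists d => // x y xy; apply: dP.
  exact/cons_rv_ball/xy/ballxx.
by apply: (f0 _ (lift ord0 i)); rewrite cons_rvS.
Qed.

Lemma ccnD n B (f g : 'rV[R]_n -> R) : ccn B f -> ccn B g -> ccn B (f \+ g).
Proof.
move=> [uf f0] [ug g0]; split; first exact: unif_contD.
by move=> x i xB /=; rewrite (f0 x i)// (g0 x i)// addr0.
Qed.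

Lemma ccnZ n B c (f : 'rV[R]_n -> R) : ccn B f -> ccn B (fun x => c * f x).
Proof.
move=> [uf f0]; split; first exact: unif_contZ.
by move=> x i xB; rewrite (f0 x i)// mulr0.
Qed.

(** The four properties are carried together through the induction on [n]: linearity and the bound
    in dimension [n] make slice integrals uniformly continuous in the remaining variable, and
    integrability in dimension [n + 1] rests on that. *)
Definition good_integral n (B : R) := [/\
  (forall f g : 'rV[R]_n -> R, ccn B f -> ccn B g ->
     space_integral (f \+ g) = space_integral f + space_integral g),
  (forall c (f : 'rV[R]_n -> R), ccn B f ->
     space_integral (fun x => c * f x) = c * space_integral f),
  (forall f g : 'rV[R]_n -> R, ccn B f -> ccn B g -> (forall x, f x <= g x) ->
     space_integral f <= space_integral g) &
  (forall M (f : 'rV[R]_n -> R), ccn B f -> (forall x, `|f x| <= M) ->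
     `|space_integral f| <= (2 * B) ^+ n * M)].

Lemma good_integralB n B : good_integral n B ->
  forall M (f g : 'rV[R]_n -> R), ccn B f -> ccn B g ->
    (forall x, `|f x - g x| <= M) ->
    `|space_integral f - space_integral g| <= (2 * B) ^+ n * M.
Proof.
move=> [HD HZ _ Hb] M f g cf cg fgM.
have -> : space_integral f - space_integral g =
    space_integral (f \+ (fun x => -1 * g x)).
  by rewrite HD ?HZ ?mulN1r//; exact: ccnZ.
apply: Hb => [|x /=]; last by rewrite mulN1r.
by apply: ccnD => //; exact: ccnZ.
Qed.

Lemma space_integralS n (f : 'rV[R]_n.+1 -> R) :
  space_integral f = \int[mu]_s space_integral (fun y => f (cons_rv s y)).
Proof. by []. Qed.

Lemma cc1_integral n B (F : R -> 'rV[R]_n -> R) : 0 < B -> good_integral n B ->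
  (forall s, ccn B (F s)) ->
  (forall e, 0 < e -> exists2 d : R, 0 < d &
     forall s s', ball s d s' -> forall y, `|F s y - F s' y| < e) ->
  (forall s y, B < `|s| -> F s y = 0) ->
  cc1 B (fun s => space_integral (F s)).
Proof.
move=> B0 gI cF uF F0; split=> [e e0|s sB].
  pose C := (2 * B) ^+ n; have C0 : 0 < C by rewrite exprn_gt0// mulr_gt0.
  have e2 : 0 < e / 2 / C by rewrite !divr_gt0.
  have [d d0 dP] := uF _ e2.
  exists d => // s s' /dP ss'.
  rewrite (@le_lt_trans _ _ (C * (e / 2 / C)))//.
    by apply: good_integralB => // y; exact/ltW.
  by rewrite mulrC divfK ?gt_eqF// gtr_pMr// invf_lt1// ltr1n.
have [_ HZ _ _] := gI.
(* Homogeneity with factor 0 gives the integral of a vanishing function. *)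
have -> : F s = (fun x => 0 * F s x) by apply/funext => y; rewrite F0// mul0r.
by rewrite HZ// mul0r.
Qed.

Lemma cc1_slices n B (f : 'rV[R]_n.+1 -> R) : 0 < B -> good_integral n B ->
  ccn B f -> cc1 B (fun s => space_integral (fun y => f (cons_rv s y))).
Proof.
move=> B0 gI cf; have [uf f0] := cf.
apply: cc1_integral => // [s|e e0|s y sB]; first exact: ccn_slice.
  have [d d0 dP] := uf e e0; exists d => // s s' ss' y; apply: dP.
  exact/cons_rv_ball/ballxx.
by apply: (f0 _ ord0); rewrite cons_rv0.
Qed.

Lemma space_integral_good n B : 0 < B -> good_integral n B.
Proof.
move=> B0; elim: n => [|n IH].
  split=> //= M f cf fM; by rewrite expr0 mul1r.
have [HD HZ Hm Hb] := IH; split.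
- move=> f g cf cg; rewrite !space_integralS.
  rewrite -(@line_integralD _ B); [|exact: cc1_slices..].
  apply: eq_Rintegral => s _; rewrite -HD//; exact: ccn_slice.
- move=> c f cf; rewrite !space_integralS.
  rewrite -(@line_integralZ _ B); [|exact: cc1_slices..].
  apply: eq_Rintegral => s _; rewrite -HZ//; exact: ccn_slice.
- move=> f g cf cg fg; rewrite !space_integralS.
  apply: (@line_integral_le _ B); [exact: cc1_slices..|move=> s].
  by apply: Hm => //; exact: ccn_slice.
- move=> M f cf fM; rewrite space_integralS exprS -mulrA.
  apply: line_integral_bound; [exact: ltW|exact: cc1_slices|move=> s].
  by apply: Hb => //; exact: ccn_slice.
Qed.

Lemma ccn_prod n (c : 'I_n -> R -> R) B :
  (forall i, bdd_fun (c i)) -> (forall i, cc1 B (c i)) ->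
  ccn B (fun x : 'rV[R]_n => \prod_(i < n) c i (x 0 i)).
Proof.
move=> bc cc; split.
  apply: (@unif_cont_prod R _ _ _ _ (fun i (x : 'rV[R]_n) => c i (x 0 i))) => i.
    by have [M hM] := bc i; exists M.
  have [uc _] := cc i.
  by apply: (@unif_cont_comp R _ _ (fun x : 'rV[R]_n => x 0 i)) uc => *; exact: coord_ball.
move=> x i xB; rewrite (bigD1 i)//=; have [_ ->//] := cc i.
by rewrite mul0r.
Qed.

(** Fubini for tensor products, by peeling off the first coordinate; it evaluates the mass of the
    mollifier. *)
Lemma space_integral_prod n (c : 'I_n -> R -> R) B : 0 < B ->
  (forall i, bdd_fun (c i)) -> (forall i, cc1 B (c i)) ->
  space_integral (fun x : 'rV[R]_n => \prod_(i < n) c i (x 0 i)) =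
  \prod_(i < n) \int[mu]_s c i s.
Proof.
move=> B0; elim: n c => [|n IH] c bc cc; first by rewrite /= !big_ord0.
have [_ HZ _ _] := @space_integral_good n B B0.
rewrite space_integralS big_ord_recl.
rewrite -(IH (fun i => c (lift ord0 i)))//; pose f (y : 'rV[R]_n) := \prod_(i < n) c (lift ord0 i) (y 0 i).
have cf : ccn B f by apply: (@ccn_prod _ (fun i => c (lift ord0 i))).
rewrite -/f mulrC -(@line_integralZ _ B)//.
apply: eq_Rintegral => s _; rewrite mulrC -HZ//.
congr space_integral; apply/funext => y.
rewrite big_ord_recl cons_rv0; congr (_ * _).
by apply: eq_bigr => i _; rewrite cons_rvS.
Qed.

End IteratedIntegral.

Section SpacetimeIntegral.
Context {R : realType} {N : nat}.
Notation mu := (@lebesgue_measure R).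
Notation spacetime := ('rV[R]_N * R)%type.

Definition ccst (B : R) (F : spacetime -> R) := unif_cont F /\
  forall z : spacetime, B < `|z.2| \/ (exists i, B < `|z.1 0 i|) -> F z = 0.

Lemma ccstD B F G : ccst B F -> ccst B G -> ccst B (F \+ G).
Proof.
move=> [uf f0] [ug g0]; split; first exact: unif_contD.
by move=> z zB /=; rewrite f0// g0// addr0.
Qed.

Lemma ccstZ B c F : ccst B F -> ccst B (fun z => c * F z).
Proof.
move=> [uf f0]; split; first exact: unif_contZ.
by move=> z zB; rewrite f0// mulr0.
Qed.

Lemma ccst_slice B F t : ccst B F -> ccn B (fun x => F (x, t)).
Proof.
move=> [uf f0]; split=> [e e0|x i xi]; last by apply: f0; right; exists i.
have [d d0 dP] := uf e e0; exists d => // x y xy; apply: dP; split=> //.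
exact: ballxx.
Qed.

Lemma cc1_ccst B F : 0 < B -> ccst B F ->
  cc1 B (fun t => space_integral (fun x => F (x, t))).
Proof.
move=> B0 cF; have [uf f0] := cF.
apply: (@cc1_integral _ _ _ (fun t x => F (x, t))) => // [|t|e e0|t y tB].
- exact: space_integral_good.
- exact: ccst_slice.
- have [d d0 dP] := uf e e0; exists d => // s s' ss' y; apply: dP; split=> //.
  exact: ballxx.
- by apply: f0; left.
Qed.

Variables (B : R) (B0 : 0 < B).

Lemma spacetime_integralD F G : ccst B F -> ccst B G ->
  spacetime_integral (F \+ G) = spacetime_integral F + spacetime_integral G.
Proof.
move=> cF cG; have [HD _ _ _] := @space_integral_good R N B B0.
rewrite /spacetime_integral -(@line_integralD _ B); [|exact: cc1_ccst..].
by apply: eq_Rintegral => t _; rewrite -HD//; exact: ccst_slice.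
Qed.

Lemma spacetime_integralZ c F : ccst B F ->
  spacetime_integral (fun z => c * F z) = c * spacetime_integral F.
Proof.
move=> cF; have [_ HZ _ _] := @space_integral_good R N B B0.
rewrite /spacetime_integral -(@line_integralZ _ B); last exact: cc1_ccst.
by apply: eq_Rintegral => t _; rewrite -HZ//; exact: ccst_slice.
Qed.

Lemma spacetime_integral_le F G : ccst B F -> ccst B G ->
  (forall z, F z <= G z) -> spacetime_integral F <= spacetime_integral G.
Proof.
move=> cF cG FG; have [_ _ Hm _] := @space_integral_good R N B B0.
apply: (@line_integral_le _ B); [exact: cc1_ccst..|move=> t].
by apply: Hm => //; exact: ccst_slice.
Qed.

Lemma spacetime_integral_bound M F : ccst B F -> (forall z, `|F z| <= M) ->
  `|spacetime_integral F| <= (2 * B) ^+ N.+1 * M.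
Proof.
move=> cF FM; have [_ _ _ Hb] := @space_integral_good R N B B0.
rewrite exprS -mulrA.
apply: line_integral_bound; [exact: ltW|exact: cc1_ccst|move=> t].
by apply: Hb => //; exact: ccst_slice.
Qed.

Lemma spacetime_integralB F G : ccst B F -> ccst B G ->
  spacetime_integral (fun z => F z - G z) =
  spacetime_integral F - spacetime_integral G.
Proof.
move=> cF cG; rewrite -[- spacetime_integral G]mulN1r -spacetime_integralZ//.
rewrite -spacetime_integralD//; last exact: ccstZ.
by congr spacetime_integral; apply/funext => z /=; rewrite mulN1r.
Qed.

Lemma spacetime_integral_sum (I : finType) (F : I -> spacetime -> R) :
  (forall i, ccst B (F i)) ->
  ccst B (fun z => \sum_i F i z) /\
  spacetime_integral (fun z => \sum_i F i z) =
    \sum_i spacetime_integral (F i).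
Proof.
move=> cF; elim: (index_enum I) => [|i r [cr IH]].
  rewrite big_nil.
  have -> : (fun z : spacetime => \sum_(i <- [::]) F i z) = fun=> 0.
    by apply/funext => z; rewrite big_nil.
  have c0 : ccst B (fun=> 0) by split=> //; exact: unif_cont_cst.
  split=> //.
  have -> : (fun _ : spacetime => 0) = (fun z => 0 * (fun=> 0 : R) z) :> (_ -> R).
    by apply/funext => z; rewrite mul0r.
  by rewrite spacetime_integralZ// mul0r.
have -> : (fun z => \sum_(j <- i :: r) F j z) =
          F i \+ (fun z => \sum_(j <- r) F j z).
  by apply/funext => z; rewrite big_cons.
by split; [exact: ccstD|rewrite spacetime_integralD// big_cons IH].
Qed.

Lemma spacetime_integral_prod (c : 'I_N -> R -> R) (c0 : R -> R) :
  (forall i, bdd_fun (c i)) -> (forall i, cc1 B (c i)) -> cc1 B c0 ->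
  spacetime_integral (fun z => (\prod_(i < N) c i (z.1 0 i)) * c0 z.2) =
  (\prod_(i < N) \int[mu]_s c i s) * \int[mu]_s c0 s.
Proof.
move=> bc cc cc0; have [_ HZ _ _] := @space_integral_good R N B B0.
rewrite -(space_integral_prod B0)// -(@line_integralZ _ B)//.
pose f (x : 'rV[R]_N) := \prod_(i < N) c i (x 0 i).
have cf : ccn B f by apply: (@ccn_prod R N c).
apply: eq_Rintegral => t _ /=; rewrite -/f mulrC -HZ//.
by congr space_integral; apply/funext => x; rewrite mulrC.
Qed.

End SpacetimeIntegral.

(** * Smooth bump functions *)

Section DerivativeRules.
Context {R : realType}.
Implicit Types (f g : R -> R) (s df dg : R).

Lemma is_derive_expR_comp f s df :
  is_derive s (1 : R) f df -> is_derive s (1 : R) (fun x => expR (f x)) (expR (f s) * df).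
Proof.
move=> h; have := @is_derive1_comp R expR f s _ _ (is_derive_expR (f s)) h.
by [].
Qed.

Lemma is_derive_ln_comp f s df : 0 < f s ->
  is_derive s (1 : R) f df -> is_derive s (1 : R) (fun x => ln (f x)) ((f s)^-1 * df).
Proof.
move=> f0 h; have := @is_derive1_comp R (@ln R) f s _ _ (is_derive1_ln f0) h.
by [].
Qed.

Lemma is_derive_inv_comp f s df : f s != 0 ->
  is_derive s (1 : R) f df -> is_derive s (1 : R) (fun x => (f x)^-1) (- (f s)^-1 ^+ 2 * df).
Proof.
move=> f0 h; have := @is_deriveV R f s df 1 f0 h.
by rewrite exprVn.
Qed.

Lemma is_derive_exp_comp f s df n :
  is_derive s (1 : R) f df ->
  is_derive s (1 : R) (fun x => f x ^+ n) (n%:R * f s ^+ n.-1 * df).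
Proof.
move=> h; have := @is_deriveX R R f n s 1 df h.
suff -> : f ^+ n = (fun x => f x ^+ n) by [].
by apply/funext => x; elim: n => //= n IH; rewrite !exprS -IH.
Qed.

Lemma is_derive_mul_comp f g s df dg :
  is_derive s (1 : R) f df -> is_derive s (1 : R) g dg ->
  is_derive s (1 : R) (fun x => f x * g x) (f s * dg + g s * df).
Proof. by move=> h1 h2; exact: is_deriveM. Qed.

Lemma is_derive_add_comp f g s df dg :
  is_derive s (1 : R) f df -> is_derive s (1 : R) g dg ->
  is_derive s (1 : R) (fun x => f x + g x) (df + dg).
Proof. by move=> h1 h2; exact: is_deriveD. Qed.

Lemma is_derive_const (k s : R) : is_derive s (1 : R) (fun _ : R => k) 0.
Proof. exact: is_derive_cst. Qed.

Lemma is_derive_opp_comp f s df :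
  is_derive s (1 : R) f df -> is_derive s (1 : R) (fun x => - f x) (- df).
Proof. by move=> h; exact: is_deriveN. Qed.

Lemma is_derive_translate (a s : R) : is_derive s (1 : R) (fun x => a + x) 1.
Proof.
apply: (is_derive_eq (is_derive_add_comp (is_derive_cst a s 1) (is_derive_id s 1))).
by rewrite add0r.
Qed.

Lemma is_derive_cmul_comp (a : R) f s df :
  is_derive s (1 : R) f df -> is_derive s (1 : R) (fun x => a * f x) (a * df).
Proof. by move=> h; exact: is_deriveZ. Qed.

(** A quadratic remainder is what is at hand both for the flat exponential at 0 and for
    differentiation under the integral sign. *)
Lemma is_derive_quadratic f (C d : R) :
  (forall h, `|h| <= 1 -> `|f h - f 0 - h * d| <= C * h ^+ 2) ->
  is_derive (0 : R) (1 : R) f d.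
Proof.
move=> hf.
have lim : h^-1 *: (f (h *: (1 : R) + 0) - f 0) @[h --> (0:R)^'] --> d.
  apply/cvgrPdist_lt => e e0; near=> h.
  have h0 : h != 0 by near: h; exact: nbhs_dnbhs_neq.
  have h1 : `|h| <= 1 by near: h; exact: dnbhs0_le.
  rewrite addr0 /GRing.scale /= mulr1 distrC.
  have -> : h^-1 * (f h - f 0) - d = h^-1 * (f h - f 0 - h * d) by field.
  rewrite normrM normfV ltr_pdivrMl ?normr_gt0//.
  rewrite (le_lt_trans (hf h h1))//.
  rewrite (@le_lt_trans _ _ (`|h| * (`|h| * (`|C| + 1))))//.
    rewrite mulrA -expr2 real_normK ?num_real// mulrC ler_wpM2l ?sqr_ge0//.
    by rewrite (le_trans (ler_norm _))// lerDl.
  rewrite ltr_pM2l ?normr_gt0// -ltr_pdivlMr ?ltr_wpDl//.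
  by near: h; apply: dnbhs0_lt; rewrite divr_gt0// ltr_wpDl.
by apply: DeriveDef; [apply/cvg_ex; exists d|apply/cvg_lim].
Unshelve. all: by end_near. Qed.

End DerivativeRules.

Section FlatExponential.
Context {R : realType}.

(** The index [n] makes the family closed under differentiation, up to linear combinations. *)
Definition flat_exp (n : nat) (s : R) : R :=
  if 0 < s then s^-1 ^+ n * expR (- s^-1) else 0.

Lemma flat_exp_ge0 n s : 0 <= flat_exp n s.
Proof.
by rewrite /flat_exp; case: ltP => // s0; rewrite mulr_ge0 ?expR_ge0// exprn_ge0// invr_ge0 ltW.
Qed.

Lemma flat_exp_gt0 n s : 0 < s -> 0 < flat_exp n s.
Proof.
by move=> s0; rewrite /flat_exp s0 mulr_gt0 ?expR_gt0// exprn_gt0// invr_gt0.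
Qed.

Lemma flat_exp_le0 n s : s <= 0 -> flat_exp n s = 0.
Proof. by rewrite /flat_exp; case: ltP. Qed.

(** This is $x^n/n! \le e^x$ at $x = 1/s$. *)
Lemma flat_exp_le_fact n s : flat_exp n s <= n`!%:R.
Proof.
rewrite /flat_exp; case: ltP => // s0.
rewrite expRN ler_pdivrMr ?expR_gt0//.
have x0 : 0 <= s^-1 by rewrite invr_ge0 ltW.
case: n => [|n]; first by rewrite expr0 fact0 mul1r -[leLHS]expR0 ler_expR.
rewrite -ler_pdivrMl ?ltr0n ?fact_gt0// mulrC.
by rewrite (le_trans _ (expR_ge1Dxn n x0))// lerDr.
Qed.

Lemma flat_exp_sqr n s : flat_exp n s = s ^+ 2 * flat_exp n.+2 s.
Proof.
rewrite /flat_exp; case: ltP => s0; last by rewrite mulr0.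
rewrite mulrA; congr (_ * _); rewrite -[n.+2]/(2 + n)%N exprD mulrA -exprMn.
by rewrite divff ?gt_eqF// expr1n mul1r.
Qed.

Lemma is_derive_flat_exp n (s : R) :
  is_derive s (1 : R) (flat_exp n) (flat_exp n.+2 s - n%:R * flat_exp n.+1 s).
Proof.
have [s0|s0|s0] := ltgtP 0 s.
- have sn : s != 0 by rewrite gt_eqF.
  apply: (@near_eq_is_derive R R R (fun x : R => x^-1 ^+ n * expR (- x^-1))).
    near=> x; rewrite /flat_exp; have -> // : 0 < x.
    by near: x; exact: lt_nbhsr.
  have dV := @is_derive_inv_comp R (fun x => x) s 1 sn (is_derive_id _ _).
  have dE := is_derive_expR_comp (is_deriveN dV).
  have dX := is_derive_exp_comp n dV.
  apply: (is_derive_eq (is_derive_mul_comp dX dE)).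
  rewrite /flat_exp s0 /GRing.scale /=.
  clear dX; case: n => [|n]; first by rewrite !expr0 mulr0n !mul0r; field.
  by rewrite !exprS /=; set Y := _ ^+ n; set E := expR _; set m := n.+1%:R; ring.
- rewrite !flat_exp_le0 ?ltW// mulr0 subr0.
  apply: (@near_eq_is_derive R R R (cst 0)).
  near=> x; rewrite flat_exp_le0//; apply: ltW; near: x; exact: lt_nbhsl.
rewrite -s0 !flat_exp_le0// mulr0 subr0.
(* At 0, writing [flat_exp n h] as [h ^+ 2 * flat_exp n.+2 h] and bounding the last factor by a
   factorial leaves a quadratic remainder. *)
apply: (@is_derive_quadratic _ _ (n.+2)`!%:R) => h _.
rewrite mulr0 subr0 (flat_exp_le0 _ (lexx 0)) subr0 flat_exp_sqr normrM mulrC.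
rewrite normrX real_normK ?num_real// ler_wpM2r ?sqr_ge0//.
by rewrite ger0_norm ?flat_exp_ge0// flat_exp_le_fact.
Unshelve. all: by end_near. Qed.

End FlatExponential.

(** * A class of bounded smooth functions closed under derivation *)

Section SmoothClass.
Context {R : realType} {V : normedModType R}.

(** Just what the chain rule uses: since the directional derivatives of [l] are constants,
    differentiating [flat_exp n (l z)] does not leave [flat_smooth]. *)
Definition affine_fun (l : V -> R) := (forall z, differentiable l z) /\
  forall v, exists c, forall z, 'D_v l z = c.

(* A class of functions closed under directional derivatives, all of whose
   members are differentiable and bounded. *)
Inductive flat_smooth : (V -> R) -> Prop :=
| FlatCst c : flat_smooth (fun=> c)
| FlatExp n l : affine_fun l -> flat_smooth (fun z => flat_exp n (l z))
| FlatD f g : flat_smooth f -> flat_smooth g -> flat_smooth (fun z => f z + g z)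
| FlatM f g : flat_smooth f -> flat_smooth g -> flat_smooth (fun z => f z * g z).

Lemma flat_smooth_bdd f : flat_smooth f -> bdd_fun f.
Proof.
elim=> [c|n l _|{}f g _ + _|{}f g _ + _]; last 2 first.
- exact: bdd_funD.
- exact: bdd_funM.
- by exists `|c|.
- by exists n`!%:R => z; rewrite ger0_norm ?flat_exp_ge0// flat_exp_le_fact.
Qed.

Lemma flat_smooth_derive f : flat_smooth f ->
  (forall z, differentiable f z) /\ forall v, flat_smooth ('D_v f).
Proof.
elim=> [c|n l [dl cl]|{}f g _ [df Df] _ [dg Dg]|{}f g sf [df Df] sg [dg Dg]].
- split=> [z|v]; first exact: differentiable_cst.
  have -> : 'D_v (fun _ : V => c) = fun=> 0 by apply/funext => z; exact: derive_cst.
  exact: FlatCst.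
- have dE s : differentiable (flat_exp n) (s : R).
    by apply/derivable1_diffP; have [] := is_derive_flat_exp n s.
  split=> [z|v]; first exact: differentiable_comp.
  have [c lc] := cl v.
  have -> : 'D_v (fun z => flat_exp n (l z)) =
     (fun z => (flat_exp n.+2 (l z) + (fun=> - n%:R) z * flat_exp n.+1 (l z)) * (fun=> c) z).
    apply/funext => z; rewrite deriveE; last exact: differentiable_comp.
    rewrite (@diff_comp _ _ _ _ l (flat_exp n))// /comp deriv1E; last exact/derivable1_diffP.
    rewrite -deriveE// lc derive1E; have [_ ->] := is_derive_flat_exp n (l z).
    by rewrite /GRing.scale /= mulNr mulrC.
  apply: FlatM; last exact: FlatCst.
  apply: FlatD; first exact: FlatExp.
  by apply: FlatM; [exact: FlatCst|exact: FlatExp].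
- split=> [z|v]; first exact: differentiableD.
  have -> : 'D_v (fun z => f z + g z) = (fun z => 'D_v f z + 'D_v g z).
    by apply/funext => z; rewrite deriveD//; exact: diff_derivable.
  exact: FlatD.
- split=> [z|v]; first exact: differentiableM.
  have -> : 'D_v (fun z => f z * g z) = (fun z => f z * 'D_v g z + g z * 'D_v f z).
    by apply/funext => z; rewrite deriveM//; exact: diff_derivable.
  by apply: FlatD; exact: FlatM.
Qed.

Lemma flat_smooth_smooth f : flat_smooth f -> smooth f.
Proof.
move=> sf vs z; suff : flat_smooth (foldr (fun v (g : V -> R) => 'D_v g) f vs).
  by move=> /flat_smooth_derive[].
by elim: vs => //= v vs /flat_smooth_derive[_]; exact.
Qed.

Lemma flat_smooth_prod (I : Type) (r : seq I) (P : pred I) (F : I -> V -> R) :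
  (forall i, flat_smooth (F i)) ->
  flat_smooth (fun z => \prod_(i <- r | P i) F i z).
Proof.
move=> sF; elim: r => [|i r IH].
  by under eq_fun do rewrite big_nil; exact: FlatCst.
case Pi: (P i); under eq_fun do rewrite big_cons Pi; last exact: IH.
exact: FlatM.
Qed.

Lemma affine_funD (c : R) l : affine_fun l -> affine_fun (fun z => c + l z).
Proof.
move=> [dl cl]; split=> [z|v]; first exact: differentiableD.
have [k lk] := cl v; exists k => z; rewrite -(lk z).
rewrite deriveD//; last exact: diff_derivable.
by rewrite derive_cst add0r.
Qed.

Lemma affine_funN l : affine_fun l -> affine_fun (fun z => - l z).
Proof.
move=> [dl cl]; split=> [z|v]; first exact: differentiableN.
have [k lk] := cl v; exists (- k) => z; rewrite -(lk z).
by rewrite deriveN//; exact: diff_derivable.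
Qed.

Lemma affine_lin (l : {linear V -> R}) : continuous l -> affine_fun l.
Proof.
move=> cl; split=> [z|v]; first exact: linear_differentiable.
by exists (l v) => z; rewrite deriveE ?diff_lin//; exact: linear_differentiable.
Qed.

(** Both sides have the same difference quotients, so directional derivatives reduce to one-variable
    calculus along lines. *)
Lemma is_derive_line (f : V -> R) (z v : V) (t df : R) :
  is_derive t (1 : R) (fun h : R => f (h *: v + z)) df <->
  is_derive (t *: v + z) v f df.
Proof.
have E : (fun h : R => h^-1 *: (f ((h *: (1 : R) + t : R) *: v + z) - f (t *: v + z))) =
         (fun h : R => h^-1 *: (f (h *: v + (t *: v + z)) - f (t *: v + z))).
  apply/funext => h; have -> : h *: (1 : R) = h by exact: mulr1.
  by rewrite scalerDl addrA.
by split=> -[d1 d2]; apply: DeriveDef; move: d1 d2; rewrite /derivable /derive E.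
Qed.

Lemma is_derive_line0 (f : V -> R) (z v : V) (df : R) :
  is_derive 0 (1 : R) (fun h : R => f (h *: v + z)) df <-> is_derive z v f df.
Proof. by rewrite is_derive_line scale0r add0r. Qed.

End SmoothClass.

Section Bump.
Context {R : realType} (eps : R) (eps0 : 0 < eps).

Definition bump (s : R) := flat_exp 0 (eps + s) * flat_exp 0 (eps - s).
Definition bump1 := 'D_1 bump.
Definition bump2 := 'D_1 bump1.

Lemma flat_smooth_bump_comp (V : normedModType R) (l : V -> R) :
  affine_fun l -> flat_smooth (fun z => bump (l z)).
Proof.
move=> al; apply: FlatM; apply: FlatExp; apply: affine_funD => //.
exact: affine_funN.
Qed.

Lemma affine_id : affine_fun (fun s : R => s).
Proof.
split=> [z|v]; first by have [] := is_diff_id (z : R).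
by exists v => z; exact: derive_id.
Qed.

Lemma flat_smooth_bump : flat_smooth bump.
Proof. exact: flat_smooth_bump_comp affine_id. Qed.

Lemma flat_smooth_bump1 : flat_smooth bump1.
Proof. exact: (flat_smooth_derive flat_smooth_bump).2. Qed.

Lemma flat_smooth_bump2 : flat_smooth bump2.
Proof. exact: (flat_smooth_derive flat_smooth_bump1).2. Qed.

Lemma flat_smooth_is_derive (f : R -> R) (s : R) : flat_smooth f ->
  is_derive s (1 : R) f ('D_1 f s).
Proof.
move=> /flat_smooth_derive[df _].
by apply: DeriveDef => //; exact: diff_derivable.
Qed.

Lemma flat_smooth_MVT (f : R -> R) s t : flat_smooth f ->
  exists2 x, `|x - s| <= `|t - s| & f t - f s = 'D_1 f x * (t - s).
Proof.
move=> sf.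
have cf (A : set R) : {within A, continuous f}.
  apply: continuous_subspaceT => x; apply: differentiable_continuous.
  by have [] := flat_smooth_derive sf.
have df (x : R) : is_derive x (1 : R) f ('D_1 f x) by exact: flat_smooth_is_derive.
have [st|ts|->] := ltgtP s t.
- have [x] := MVT st (fun x _ => df x) (cf _).
  rewrite in_itv/= => /andP[sx xt] ->; exists x => //.
  by rewrite !ger0_norm ?subr_ge0 ?lerB// ltW.
- have [x] := MVT ts (fun x _ => df x) (cf _).
  rewrite in_itv/= => /andP[tx xs] E; exists x.
    by rewrite !ler0_norm ?subr_le0 ?lerN2 ?lerB// ltW.
  by rewrite -opprB E -mulrN opprB.
- by exists t => //; rewrite !subrr mulr0.
Qed.

Lemma flat_smooth_Taylor1 (f : R -> R) : flat_smooth f ->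
  exists2 C, 0 <= C & forall s t, `|f t - f s| <= C * `|t - s|.
Proof.
move=> sf; have [_ /(_ 1) sf1] := flat_smooth_derive sf.
have [M hM] := flat_smooth_bdd sf1; exists M; first exact: le_trans (hM 0).
move=> s t; have [x _ ->] := flat_smooth_MVT s t sf.
by rewrite normrM ler_wpM2r.
Qed.

Lemma flat_smooth_unif_cont (f : R -> R) : flat_smooth f -> unif_cont f.
Proof.
move=> /flat_smooth_Taylor1[C C0 hC] e e0.
exists (e / (C + 1)); first by rewrite divr_gt0// ltr_wpDl.
move=> x y /=; rewrite /ball /= => xy; rewrite distrC.
rewrite (le_lt_trans (hC x y))// distrC.
rewrite (@le_lt_trans _ _ ((C + 1) * `|x - y|))//.
  by rewrite ler_wpM2r// lerDl.
by rewrite mulrC -ltr_pdivlMr// ltr_wpDl.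
Qed.

Lemma flat_smooth_Taylor2 (f : R -> R) : flat_smooth f ->
  exists2 C, 0 <= C &
    forall s k, `|f (s + k) - f s - k * 'D_1 f s| <= C * k ^+ 2.
Proof.
move=> sf; have [df /(_ 1) sf1] := flat_smooth_derive sf.
have [C C0 hC] := flat_smooth_Taylor1 sf1; exists C => // s k.
have [x xs E] := flat_smooth_MVT s (s + k) sf.
have {}xs : `|x - s| <= `|k| by move: xs; rewrite addrAC subrr add0r.
rewrite E addrAC subrr add0r mulrC -mulrBr normrM -[k ^+ 2]real_normK ?num_real//.
by rewrite mulrC expr2 mulrA ler_wpM2r// (le_trans (hC _ _))// ler_wpM2l.
Qed.

Lemma bump_ge0 s : 0 <= bump s.
Proof. by rewrite mulr_ge0 ?flat_exp_ge0. Qed.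

Lemma bump_out s : eps < `|s| -> bump s = 0.
Proof.
rewrite ltNge ler_norml negb_and -!ltNge /bump => /orP[] h.
  by rewrite flat_exp_le0 ?mul0r//; lra.
by rewrite [X in _ * X]flat_exp_le0 ?mulr0//; lra.
Qed.

Lemma derive_out (f : R -> R) : (forall s, eps < `|s| -> f s = 0) ->
  forall s, eps < `|s| -> 'D_1 f s = 0.
Proof.
move=> f0 s es; rewrite -(derive_cst (0 : R) s (1 : R)); apply: near_eq_derive.
near=> x; rewrite f0//; near: x.
exact: (cvgr_gt _ (@norm_continuous R R s)).
Unshelve. all: by end_near. Qed.

Lemma bump1_out s : eps < `|s| -> bump1 s = 0.
Proof. by apply: derive_out; exact: bump_out. Qed.

Lemma bump2_out s : eps < `|s| -> bump2 s = 0.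
Proof. by apply: derive_out; exact: bump1_out. Qed.

Lemma cc1_bump (f : R -> R) : flat_smooth f ->
  (forall s, eps < `|s| -> f s = 0) -> cc1 eps f.
Proof. by move=> sf f0; split => //; exact: flat_smooth_unif_cont. Qed.

Lemma bump_integral_gt0 : 0 < \int[@lebesgue_measure R]_s bump s.
Proof.
pose D := `[- (eps / 2), eps / 2]%classic : set R.
(* On the interval of half size both factors of [bump] are at least [flat_exp 0 (eps / 2)], by
   monotonicity. *)
pose c := flat_exp 0 (eps / 2) ^+ 2.
have e2 : 0 < eps / 2 by rewrite divr_gt0.
have c0 : 0 < c by rewrite exprn_gt0// flat_exp_gt0.
have Ib := cc1_integrable (cc1_bump flat_smooth_bump bump_out).
have mono s : eps / 2 <= s -> flat_exp 0 (eps / 2) <= flat_exp 0 s.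
  move=> es; have s0 : 0 < s by exact: lt_le_trans es.
  rewrite /flat_exp e2 s0 !expr0 !mul1r ler_expR lerN2 lef_pV2//.
have mD : measurable D by exact: measurable_itv.
have ID : (@lebesgue_measure R).-integrable D (EFin \o bump).
  by apply: integrableS Ib.
apply: (@lt_le_trans _ _ (\int[@lebesgue_measure R]_(s in D) c)).
  have muD : @lebesgue_measure R D = eps%:E.
    rewrite /D lebesgue_measure_itv/= lte_fin gtrN// -EFinD opprK.
    by congr (_%:E); lra.
  by rewrite Rintegral_cst//; rewrite [X in _ * fine X]muD mulr_gt0.
apply: (@le_trans _ _ (\int[@lebesgue_measure R]_(s in D) bump s)).
  apply: le_Rintegral => //.
    apply: continuous_compact_integrable; first exact: segment_compact.
    by apply: continuous_subspaceT => x; exact: cvg_cst.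
  move=> s; rewrite /D /= in_itv/= => /andP[h1 h2].
  by rewrite /c expr2 ler_pM ?flat_exp_ge0// mono//; lra.
rewrite Rintegral_mkcond; apply: le_Rintegral => //.
  rewrite integrable_mkcond// restrict_EFin in ID; exact: ID.
by move=> s _; rewrite patchE; case: ifP => // _; exact: bump_ge0.
Qed.

End Bump.

(** * Mollification *)

Section Mollifier.
Context {R : realType} {N : nat}.
Notation spacetime := ('rV[R]_N * R)%type.
Implicit Types (z y : spacetime) (c : R -> R) (j k : option 'I_N).

(* The last coordinate [None] is time. *)
Definition crd k z : R := if k is Some i then z.1 0 i else z.2.
Definition unit_dir k : spacetime :=
  if k is Some i then (delta_mx 0 i, 0) else (0, 1).

Lemma crd_line j k (h : R) z :
  crd j (h *: unit_dir k + z) = crd j z + (if j == k then h else 0).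
Proof.
case: j k => [j|] [k|] /=; rewrite ?mxE/= ?scaler0 ?add0r ?addr0//.
- rewrite (_ : (Some j == Some k) = (j == k)) //; case: eqP => _.
    by rewrite mulr1 addrC.
  by rewrite mulr0 add0r addr0.
- by rewrite mulr0 add0r.
- by rewrite /GRing.scale /= mulr1 addrC.
Qed.

Lemma crd_ball k z d y : ball z d y -> ball (crd k z) d (crd k y).
Proof. by case: k => [k|] [h1 h2] //=; exact: coord_ball. Qed.

Lemma crd_continuous k : continuous (crd k).
Proof.
apply: unif_cont_continuous => e e0; exists e => // x y xy.
exact: (crd_ball k xy).
Qed.

Lemma crd_affine k : affine_fun (crd k).
Proof.
have lk : linear (crd k : spacetime -> R).
  by move=> h x y; case: k => [i|] /=; rewrite ?mxE.
pose f : {linear spacetime -> R} :=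
  HB.pack (crd k : spacetime -> R) (GRing.isLinear.Build _ _ _ _ _ lk).
exact: (@affine_lin R _ f (@crd_continuous k)).
Qed.

Lemma big_option (F : option 'I_N -> R) :
  \prod_j F j = (\prod_i F (Some i)) * F None.
Proof.
rewrite (bigD1 None)//= mulrC; congr (_ * _).
rewrite (reindex_omap Some id) => [|[i|]]//=.
by apply: eq_bigl => i; rewrite eqxx.
Qed.

Variables (eps : R) (eps0 : 0 < eps).
Notation b := (bump eps).

Definition rho z y := \prod_j b (crd j y - crd j z).
(** A derivative of the tensor product along coordinate [k] only changes its [k]-th factor, so all
    derivatives that occur have this shape. *)
Definition rho_dir c k z y :=
  c (crd k y - crd k z) * \prod_(j | j != k) b (crd j y - crd j z).

Lemma rho_dirE k z y : rho_dir b k z y = rho z y.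
Proof. by rewrite /rho (bigD1 k). Qed.

Lemma flat_smooth_rho z : flat_smooth (rho z).
Proof.
apply: flat_smooth_prod => j; apply: flat_smooth_bump_comp.
have -> : (fun y => crd j y - crd j z) = (fun y => - crd j z + crd j y).
  by apply/funext => y; rewrite addrC.
exact/affine_funD/crd_affine.
Qed.

Lemma derive_rho_dir c k z : flat_smooth c ->
  'D_(unit_dir k) (rho_dir c k z) = rho_dir ('D_1 c) k z.
Proof.
move=> sc; apply/funext => y.
suff [_ ->] : is_derive y (unit_dir k) (rho_dir c k z) (rho_dir ('D_1 c) k z y) by [].
apply/is_derive_line0.
have E : (fun h : R => rho_dir c k z (h *: unit_dir k + y)) =
    (fun h : R => c ((crd k y - crd k z) + h) * \prod_(j | j != k) b (crd j y - crd j z)).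
  apply/funext => h; rewrite /rho_dir crd_line eqxx addrAC; congr (_ * _).
  by apply: eq_bigr => j /negbTE jk; rewrite crd_line jk addr0.
rewrite E /rho_dir; set a := crd k y - crd k z; set K := \prod_(_ | _) _.
have dc : is_derive (a + 0) (1 : R) c ('D_1 c a).
  by rewrite addr0; exact: flat_smooth_is_derive.
have da := is_derive_translate a 0.
have dca := @is_derive1_comp R c (fun h : R => a + h) 0 _ _ dc da.
apply: (is_derive_eq (is_derive_mul_comp dca (is_derive_cst K _ _))).
by rewrite mulr0 add0r mulr1 mulrC.
Qed.

Lemma dt_rho z y : dt (rho z) y = rho_dir (bump1 eps) None z y.
Proof.
have -> : rho z = rho_dir b None z by apply/funext => x; rewrite rho_dirE.
exact: (congr1 (@^~ y) (derive_rho_dir None z (flat_smooth_bump eps))).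
Qed.

Lemma laplacian_rho z y :
  laplacian (rho z) y = \sum_(i < N) rho_dir (bump2 eps) (Some i) z y.
Proof.
apply: eq_bigr => i _.
have -> : rho z = rho_dir b (Some i) z by apply/funext => x; rewrite rho_dirE.
have E1 : dx i (rho_dir b (Some i) z) = rho_dir (bump1 eps) (Some i) z.
  exact: (derive_rho_dir (Some i) z (flat_smooth_bump eps)).
rewrite E1.
exact: (congr1 (@^~ y) (derive_rho_dir (Some i) z (flat_smooth_bump1 eps))).
Qed.

Definition in_box (r : R) z y := forall j, `|crd j y - crd j z| <= r.

Lemma rho_dir_out c k z y : (forall s, eps < `|s| -> c s = 0) ->
  ~ in_box eps z y -> rho_dir c k z y = 0.
Proof.
move=> c0 /existsNP[j /negP]; rewrite -ltNge => h.
have [jk|jk] := eqVneq j k; first by rewrite /rho_dir -jk c0// mul0r.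
by rewrite /rho_dir (bigD1 j)//= bump_out// mul0r mulr0.
Qed.

Lemma rho_out z y : ~ in_box eps z y -> rho z y = 0.
Proof. by move=> h; rewrite -(rho_dirE None) rho_dir_out//; exact: bump_out. Qed.

Lemma rho_ge0 z y : 0 <= rho z y.
Proof. by apply: prodr_ge0 => j _; exact: bump_ge0. Qed.

Lemma crd_comp_unif_cont c k (a : R) : flat_smooth c ->
  unif_cont (fun y => c (crd k y - a)).
Proof.
move=> /flat_smooth_unif_cont uc.
apply: (@unif_cont_comp R _ _ (fun y => crd k y - a)) uc => x d y xy.
rewrite /ball /= opprB addrA subrK.
exact: crd_ball.
Qed.

Lemma rho_dir_unif_cont c k z : flat_smooth c -> unif_cont (rho_dir c k z).
Proof.
move=> sc; have sb := @flat_smooth_bump R eps.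
apply: (@unif_contM R _ (fun y => c (crd k y - crd k z))).
- by have [M hM] := flat_smooth_bdd sc; exists M.
- apply: (@bdd_prod R _ _ _ _ (fun j y => b (crd j y - crd j z))) => j.
  by have [M hM] := flat_smooth_bdd sb; exists M.
- exact: crd_comp_unif_cont.
- apply: (@unif_cont_prod R _ _ _ _ (fun j y => b (crd j y - crd j z))) => j.
    by have [M hM] := flat_smooth_bdd sb; exists M.
  exact: crd_comp_unif_cont.
Qed.

Lemma rho_dir_bdd c k z : flat_smooth c -> bdd_fun (rho_dir c k z).
Proof.
move=> sc; have sb := @flat_smooth_bump R eps.
apply: (@bdd_funM R _ (fun y => c (crd k y - crd k z))).
  by have [M hM] := flat_smooth_bdd sc; exists M.
apply: (@bdd_prod R _ _ _ _ (fun j y => b (crd j y - crd j z))) => j.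
by have [M hM] := flat_smooth_bdd sb; exists M.
Qed.

Lemma ccst_rho_dir (B : R) (G : spacetime -> R) c k z :
  bdd_fun G -> unif_cont G -> flat_smooth c ->
  (forall s, eps < `|s| -> c s = 0) ->
  (forall j, `|crd j z| + eps <= B) -> ccst B (fun y => G y * rho_dir c k z y).
Proof.
move=> bG uG sc c0 hB; split.
  by apply: (@unif_contM R _ G) => //; [exact: rho_dir_bdd|exact: rho_dir_unif_cont].
move=> y yB; rewrite rho_dir_out ?mulr0// => h.
have {yB} [j yB] : exists j, B < `|crd j y|.
  by case: yB => [?|[i ?]]; [exists None|exists (Some i)].
have := ler_normD (crd j y - crd j z) (crd j z); rewrite subrK => h1.
have := h j; have := hB j; lra.
Qed.

(** The extra 1 leaves room for moving the centre by at most 1, so that kernels with neighbouring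
    centres are integrated in one class [ccst B]. *)
Definition support_radius z := eps + 1 + \sum_j `|crd j z|.

Lemma support_radius_gt0 z : 0 < support_radius z.
Proof. by rewrite ltr_wpDr ?sumr_ge0// addr_gt0. Qed.

Lemma le_support_radius z j : `|crd j z| + 1 + eps <= support_radius z.
Proof.
have : `|crd j z| <= \sum_j `|crd j z| by rewrite (bigD1 j)//= lerDl sumr_ge0.
rewrite /support_radius; lra.
Qed.

(** The kernel is not normalized. Its mass factorizes into one-variable integrals, each independent
    of [z] by translation invariance. *)
Lemma rho_mass : exists2 m, 0 < m & forall z, spacetime_integral (rho z) = m.
Proof.
pose m := \int[@lebesgue_measure R]_s b s.
have m0 : 0 < m by exact: bump_integral_gt0.
exists ((\prod_(i < N) m) * m).
  by rewrite mulr_gt0//; apply: prodr_gt0.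
move=> z; pose B := support_radius z; have B0 : 0 < B := support_radius_gt0 z.
have cb j : cc1 B (fun s => b (s - crd j z)).
  split=> [|s sB].
    move=> e e0; have [d d0 dP] := flat_smooth_unif_cont (flat_smooth_bump eps) e0.
    exists d => // x y; rewrite /ball /= => xy; apply: dP.
    by rewrite /ball /= opprB addrA subrK.
  apply: bump_out.
  have := le_support_radius z j; move: sB; rewrite -/B.
  have := ler_normD (s - crd j z) (crd j z); rewrite subrK; lra.
have bb j : bdd_fun (fun s => b (s - crd j z)).
  by have [M hM] := flat_smooth_bdd (flat_smooth_bump eps); exists M.
have shift j : \int[@lebesgue_measure R]_s b (s - crd j z) = m.
  apply: line_integral_shift; last exact: bump_ge0.
  exact/unif_cont_continuous/flat_smooth_unif_cont/flat_smooth_bump.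
transitivity (spacetime_integral (fun y : spacetime =>
    (\prod_(i < N) b (y.1 0 i - crd (Some i) z)) * b (y.2 - crd None z))).
  by congr spacetime_integral; apply/funext => y; rewrite /rho big_option.
have -> := spacetime_integral_prod B0 (fun i => bb (Some i)) (fun i => cb (Some i)) (cb None).
by rewrite (shift None); congr (_ * _); apply: eq_bigr => i _; exact: shift.
Qed.

(** All derivatives fall on the kernel, whose Taylor remainder is quadratic uniformly in [y]. The
    minus sign appears because the kernel depends on [y - z] and is differentiated in its centre
    [z]. *)
Lemma is_derive_mollify (G : spacetime -> R) c k z :
  bdd_fun G -> unif_cont G -> flat_smooth c -> (forall s, eps < `|s| -> c s = 0) ->
  is_derive z (unit_dir k)
    (fun z => spacetime_integral (fun y => G y * rho_dir c k z y))
    (- spacetime_integral (fun y => G y * rho_dir ('D_1 c) k z y)).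
Proof.
move=> bG uG sc c0; apply/is_derive_line0.
pose B := support_radius z; have B0 : 0 < B := support_radius_gt0 z.
have crdB j : `|crd j z| + 1 + eps <= B := le_support_radius z j.
have sc1 : flat_smooth ('D_1 c) by exact: (flat_smooth_derive sc).2.
have [C C0 hC] := flat_smooth_Taylor2 sc.
have [M hM] := bG.
pose K y := \prod_(j | j != k) b (crd j y - crd j z).
have [L hL] : bdd_fun K.
  apply: (@bdd_prod R _ _ _ _ (fun j y => b (crd j y - crd j z))) => j.
  by have [M' hM'] := flat_smooth_bdd (flat_smooth_bump eps); exists M'.
apply: (@is_derive_quadratic _ _ ((2 * B) ^+ N.+1 * (M * (C * L)))) => h h1.
have cch : ccst B (fun y => G y * rho_dir c k (h *: unit_dir k + z) y).
  apply: ccst_rho_dir => // j; rewrite crd_line.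
  apply: le_trans (crdB j); rewrite lerD2r.
  by case: eqP => _; rewrite (le_trans (ler_normD _ _))// lerD// normr0.
have cc : ccst B (fun y => G y * rho_dir c k z y).
  by apply: ccst_rho_dir => // j; have := crdB j; lra.
have cc' : ccst B (fun y => G y * rho_dir ('D_1 c) k z y).
  apply: ccst_rho_dir => //; first exact: derive_out.
  by move=> j; have := crdB j; lra.
rewrite scale0r add0r mulrN opprK.
rewrite -(spacetime_integralZ B0)// -(spacetime_integralB B0)//.
have ccZ := ccstZ h cc'.
have ccN : ccst B (fun y => G y * rho_dir c k (h *: unit_dir k + z) y
    - G y * rho_dir c k z y).
  rewrite (_ : (fun y => _) = (fun y => G y * rho_dir c k (h *: unit_dir k + z) y) \+
      (fun y => -1 * (G y * rho_dir c k z y))); last first.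
    by apply/funext => y /=; rewrite mulN1r.
  by apply: ccstD => //; exact: ccstZ.
rewrite -(spacetime_integralD B0)// -mulrA.
apply: spacetime_integral_bound => //; first exact: ccstD.
move=> y /=; rewrite /rho_dir.
have -> : \prod_(j | j != k) b (crd j y - crd j (h *: unit_dir k + z)) = K y.
  by apply: eq_bigr => j /negbTE jk; rewrite crd_line jk addr0.
rewrite -/(K y) crd_line eqxx opprD addrA; set a := crd k y - crd k z.
have -> : G y * (c (a - h) * K y) - G y * (c a * K y) + h * (G y * ('D_1 c a * K y))
   = G y * ((c (a - h) - c a - (- h) * 'D_1 c a) * K y) by ring.
rewrite !normrM -!mulrA ler_pM//.
rewrite [leRHS](_ : _ = C * (- h) ^+ 2 * L); last by rewrite sqrrN; ring.
by rewrite ler_pM.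
Qed.

Lemma mollify_continuous (G : spacetime -> R) :
  bdd_fun G -> unif_cont G ->
  continuous (fun z => spacetime_integral (fun y => G y * rho z y)).
Proof.
move=> bG uG z.
pose rho0 w := \prod_j b (crd j w).
have rhoE x y : rho x y = rho0 (y - x).
  by apply: eq_bigr => -[i|] _ /=; rewrite ?mxE.
have u0 : unif_cont rho0.
  apply: (@unif_cont_prod R _ _ _ _ (fun j y => b (crd j y))) => j.
    by have [M hM] := flat_smooth_bdd (flat_smooth_bump eps); exists M.
  apply: (@unif_cont_comp R _ _ (crd j)) => [x d y|]; first exact: crd_ball.
  exact/flat_smooth_unif_cont/flat_smooth_bump.
have [M hM] := bG.
pose B := support_radius z; have B0 : 0 < B := support_radius_gt0 z.
have crdB j : `|crd j z| + 1 + eps <= B := le_support_radius z j.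
have cc x : ball z 1 x -> ccst B (fun y => G y * rho x y).
  move=> zx; rewrite (_ : (fun _ => _) = (fun y => G y * rho_dir b None x y)); last first.
    by apply/funext => y; rewrite rho_dirE.
  apply: ccst_rho_dir => //; [exact: flat_smooth_bump|exact: bump_out|move=> j].
  have := crdB j; have := crd_ball j zx; rewrite /ball /=.
  have := ler_normD (crd j x - crd j z) (crd j z); rewrite subrK.
  rewrite [`|crd j x - _|]distrC; lra.
apply/cvgrPdist_lt => e e0.
pose C := (2 * B) ^+ N.+1 * (`|M| + 1).
have C0 : 0 < C by rewrite mulr_gt0 ?ltr_wpDl// exprn_gt0// mulr_gt0.
have e2 : 0 < e / 2 / C by rewrite !divr_gt0.
have [d d0 dP] := u0 _ e2.
near=> x.
have zx1 : ball z 1 x by near: x; exact: (nbhsx_ballx (z : spacetime) 1 ltr01).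
have zxd : ball z d x by near: x; exact: (nbhsx_ballx (z : spacetime) d d0).
have ccz := cc z (ballxx _ ltr01); have ccx := cc x zx1.
rewrite -(spacetime_integralB B0)//.
have bound y : `|G y * rho z y - G y * rho x y| <= (`|M| + 1) * (e / 2 / C).
  rewrite -mulrBr normrM ler_pM//.
    by rewrite (le_trans (hM y))// (le_trans (ler_norm _))// lerDl.
  rewrite !rhoE; apply/ltW/dP; split => /=.
    split=> // i j; rewrite !mxE /ball /=.
    rewrite (_ : _ - _ = x.1 i j - z.1 i j); last by ring.
    by rewrite distrC; have [[_ h] _] := zxd; exact: h.
  rewrite /ball /= (_ : _ - _ = x.2 - z.2); last by ring.
  by rewrite distrC; have [_ h] := zxd; exact: h.
have ccB : ccst B (fun y => G y * rho z y - G y * rho x y).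
  rewrite (_ : (fun y => _) = (fun y => G y * rho z y) \+
      (fun y => -1 * (G y * rho x y))); last first.
    by apply/funext => y /=; rewrite mulN1r.
  by apply: ccstD => //; exact: ccstZ.
rewrite (le_lt_trans (spacetime_integral_bound B0 ccB bound))// mulrA -/C.
rewrite mulrC divfK ?gt_eqF//; lra.
Unshelve. all: by end_near. Qed.

End Mollifier.

(** The zero-order term is a separate function [F], so that the maximum principle concerns a linear
    equation with a source and the class is invariant under a change of sign. *)
Definition weak_heat {R : realType} {N : nat} (Omega : set 'rV[R]_N) (T : R)
    (U F : 'rV[R]_N * R -> R) :=
  forall phi, test_function (cylinder Omega T) phi ->
    spacetime_integral (fun z =>
      - U z * dt phi z - U z * laplacian phi z + F z * phi z) = 0.

(** * Boxes and extension of functions from a box *)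

Section Boxes.
Context {R : realType} {N : nat}.
Notation spacetime := ('rV[R]_N * R)%type.
Implicit Types (z y : spacetime) (k : option 'I_N).

Lemma compact_box (r : R) z : compact [set y | in_box r z y].
Proof.
have -> : [set y | in_box r z y] =
    [set x : 'rV[R]_N | forall i, `[z.1 0 i - r, z.1 0 i + r]%classic (x ord0 i)]
    `*` `[z.2 - r, z.2 + r]%classic.
  have itvE (c s : R) : `[c - r, c + r]%classic s = (`|s - c| <= r) :> Prop.
    by rewrite -[LHS]/(is_true (s \in `[c - r, c + r])) in_itv/= ler_distl.
  apply/seteqP; split=> y.
    move=> h; split=> [i|]; first by rewrite itvE; exact: (h (Some i)).
    by rewrite itvE; exact: (h None).
  move=> [h1 h2] [i|]; first by have := h1 i; rewrite itvE.
  by move: h2; rewrite itvE.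
apply: compact_setX; last exact: segment_compact.
apply: (@rV_compact R N (fun i => `[z.1 0 i - r, z.1 0 i + r]%classic)) => i.
exact: segment_compact.
Qed.

Lemma closed_box (r : R) z : closed [set y | in_box r z y].
Proof.
have -> : [set y | in_box r z y] = \bigcap_(j in [set: option 'I_N])
    ((fun y => `|crd j y - crd j z|) @^-1` [set s | s <= r]).
  by apply/seteqP; split=> y h; [move=> j _; exact: h|move=> j; exact: (h j)].
apply: closed_bigI => j _; apply: preimage_closed; last exact: closed_le.
move=> y _.
apply: (@continuous_comp _ _ _ (fun y => crd j y - crd j z) (fun s : R => `|s|)).
  by apply: cvgB; [exact: crd_continuous|exact: cvg_cst].
exact: norm_continuous.
Qed.

(** Projecting each coordinate does not increase sup-norm distances. Composition with it turns a
    function continuous on the box into a bounded, uniformly continuous one on the whole space,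
    unchanged on the box. *)
Definition clamp (r : R) z y : spacetime :=
  (\row_i Num.max (z.1 0 i - r) (Num.min (z.1 0 i + r) (y.1 0 i)),
   Num.max (z.2 - r) (Num.min (z.2 + r) y.2)).

Lemma crd_clamp r z y k :
  crd k (clamp r z y) = Num.max (crd k z - r) (Num.min (crd k z + r) (crd k y)).
Proof. by case: k => [i|] //=; rewrite mxE. Qed.

Lemma clamp_in_box r z y : 0 <= r -> in_box r z (clamp r z y).
Proof.
move=> r0 k; rewrite crd_clamp ler_distl le_max lexx /= ge_max ge_min lexx /=.
by rewrite andbT; lra.
Qed.

Lemma crd_inj y z : (forall k, crd k y = crd k z) -> y = z.
Proof.
case: y z => [y s] [z t] h; congr pair; last exact: (h None).
by apply/rowP => i; exact: (h (Some i)).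
Qed.

Lemma clamp_id r z y : in_box r z y -> clamp r z y = y.
Proof.
move=> h; apply: crd_inj => k; rewrite crd_clamp.
have := h k; rewrite ler_distl => /andP[h1 h2].
by rewrite min_r// max_r.
Qed.

Lemma ball_crd z d y : 0 < d -> (forall k, ball (crd k z) d (crd k y)) -> ball z d y.
Proof.
move=> d0 h; split; last exact: (h None).
by split=> // i j; rewrite ord1; exact: (h (Some j)).
Qed.

Lemma clamp_ball r z x d y : ball x d y -> ball (clamp r z x) d (clamp r z y).
Proof.
move=> xy; have d0 : 0 < d by have [[]] := xy.
apply: ball_crd => // k; have := crd_ball k xy.
rewrite !crd_clamp /ball /= !ltr_distl => /andP[h1 h2].
rewrite /Num.max /Num.min; repeat case: ifPn; rewrite -?leNgt => *; apply/andP; split; lra.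
Qed.

Lemma compact_unif_cont (K : set spacetime) (U : spacetime -> R) :
  compact K -> {within K, continuous U} ->
  forall e, 0 < e -> exists2 d : R, 0 < d &
    forall x y, K x -> K y -> ball x d y -> `|U x - U y| < e.
Proof.
move=> /compact_near_coveringP cK /subspace_continuousP cU e e0.
pose P (d : R) x := K x -> forall y, K y -> ball x d y -> `|U x - U y| < e.
have H x : K x -> \forall x' \near x & d \near 0^'+, P d x'.
  move=> Kx; have /cvgrPdist_lt/(_ (e / 2) (divr_gt0 e0 (ltr0Sn _ 1))) := cU x Kx.
  move=> /nbhs_ballP[r /= r0 hr]; have r2 : 0 < r / 2 by rewrite divr_gt0.
  near=> x' d => Kx' y Ky x'y.
  have xx' : ball x (r / 2) x' by near: x'; exact: (nbhsx_ballx (x : spacetime) _ r2).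
  have dr : d <= r / 2 by near: d; exact: nbhs_right_le.
  have xr : ball x r x' by apply: le_ball xx'; rewrite ler_pdivrMr// ler_peMr ?ler1n// ltW.
  have xy : ball x r y by rewrite [r]splitr; exact: ball_triangle xx' (le_ball dr x'y).
  have := hr _ xr Kx'; have := hr _ xy Ky => /= h1 h2.
  rewrite [e]splitr -(subrK (U x) (U x')) -addrA.
  by rewrite (le_lt_trans (ler_normD _ _))// ltrD// distrC.
have {}cK := cK R (0^'+) P (at_right_proper_filter (0 : R)) H.
have cKd : \forall d \near (0 : R)^'+, K `<=` P d /\ 0 < d.
  by apply: filterI => //; exact: nbhs_right_gt.
have := @filter_ex _ _ (at_right_proper_filter (0 : R)) _ cKd.
move=> [d [dP d0]].
by exists d => // x y Kx Ky xy; exact: dP xy.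
Unshelve. all: by end_near. Qed.

Lemma clamp_extend (U : spacetime -> R) r z : 0 <= r ->
  {within [set y | in_box r z y], continuous U} ->
  bdd_fun (U \o clamp r z) /\ unif_cont (U \o clamp r z).
Proof.
move=> r0 cU; have cK := @compact_box r z; split; last first.
  move=> e e0; have [d d0 dP] := compact_unif_cont cK cU e0.
  exists d => // x y xy; apply: dP; [exact: clamp_in_box..|exact: clamp_ball].
have K0 : [set y | in_box r z y] !=set0 by exists z => k; rewrite subrr normr0.
have cN : {within [set y | in_box r z y], continuous (fun y => `|U y|)}.
  move=> x; apply: (@continuous_comp _ _ _ (U : subspace _ -> R) (fun s : R => `|s|)).
    exact: cU.
  exact: norm_continuous.
have [c _ hc] := compact_EVT_max K0 cK cN.
by exists `|U c| => y /=; apply: hc; rewrite inE; exact: clamp_in_box.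
Qed.

End Boxes.

(** * First and second derivative tests *)

Section DerivativeTests.
Context {R : realType}.
Implicit Types (f : R -> R) (d r e : R).

Lemma is_derive_approx f d e : is_derive (0 : R) (1 : R) f d -> 0 < e ->
  exists2 r, 0 < r & forall h, `|h| < r -> `|f h - f 0 - h * d| <= e * `|h|.
Proof.
move=> [/cvg_ex[l hl] E] e0.
have {}hl : h^-1 *: (f (h *: (1 : R) + 0) - f 0) @[h --> (0:R)^'] --> d.
  by move: E; rewrite /derive (cvg_lim _ hl)// => <-.
move/cvgrPdist_lt : hl => /(_ e e0) /nbhs_ballP[r /= r0 hr].
exists r => // h hr0; have [->|h0] := eqVneq h 0.
  by rewrite subrr mul0r subr0 normr0 mulr0.
have := hr h; rewrite /ball /= sub0r normrN => /(_ hr0 h0).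
rewrite addr0 /GRing.scale /= mulr1 distrC => /ltW hh.
have -> : f h - f 0 - h * d = (h^-1 * (f h - f 0) - d) * h by field.
by rewrite normrM ler_wpM2r.
Qed.

(** Only [h <= 0] is tested, because a maximum over a backward box may lie on its final time. *)
Lemma derive_ge0_left f d r : 0 < r -> is_derive (0 : R) (1 : R) f d ->
  (forall h, - r < h -> h <= 0 -> f h <= f 0) -> 0 <= d.
Proof.
move=> r0 df fm; rewrite leNgt; apply/negP => d0.
have e0 : 0 < - d / 2 by rewrite divr_gt0// oppr_gt0.
have [s s0 hs] := is_derive_approx df e0.
pose h := - (Num.min r s / 2).
have m0 : 0 < Num.min r s by rewrite lt_min r0.
have m1 : Num.min r s <= r by rewrite ge_min lexx.
have m2 : Num.min r s <= s by rewrite ge_min lexx orbT.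
have h0 : h < 0 by rewrite /h; lra.
have fh : f h <= f 0 by apply: fm; [rewrite /h; lra|exact: ltW].
have : `|f h - f 0 - h * d| <= - d / 2 * `|h|.
  by apply: hs; rewrite ltr0_norm// /h; lra.
rewrite (ltr0_norm h0) ler_norml => /andP[+ _]; nra.
Qed.

(** If [d > 0], then [f1] is positive just to the right of 0, since [f1 0 >= 0] by the one-sided
    test, and the mean value theorem makes [f] exceed [f 0]. *)
Lemma second_derivative_test f (f1 : R -> R) d r : 0 < r ->
  (forall h, `|h| < r -> is_derive h (1 : R) f (f1 h)) ->
  is_derive (0 : R) (1 : R) f1 d ->
  (forall h, `|h| < r -> f h <= f 0) -> d <= 0.
Proof.
move=> r0 df df1 fm; rewrite leNgt; apply/negP => d0.
have f10 : 0 <= f1 0.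
  apply: (@derive_ge0_left f _ r) => //; first by apply: df; rewrite normr0.
  by move=> h h1 h2; apply: fm; rewrite ler0_norm// ltrNl.
have [s s0 hs] := is_derive_approx df1 (divr_gt0 d0 (ltr0Sn R 1)).
pose h := Num.min r s / 2.
have m0 : 0 < Num.min r s by rewrite lt_min r0.
have m1 : Num.min r s <= r by rewrite ge_min lexx.
have m2 : Num.min r s <= s by rewrite ge_min lexx orbT.
have h0 : 0 < h by rewrite /h; lra.
have dfi x : x \in `]0, h[ -> is_derive x (1 : R) f (f1 x).
  by rewrite in_itv/= => /andP[x0 xh]; apply: df; rewrite gtr0_norm// /h in xh *; lra.
have cf : {within `[0, h], continuous f}.
  rewrite continuous_subspace_in => x; rewrite inE/= in_itv/= => /andP[x0 xh].
  apply: continuous_subspaceT_for; first by rewrite /= in_itv/= x0.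
  apply/differentiable_continuous/derivable1_diffP.
  by have [] := df x _; rewrite ?ger0_norm// /h in xh *; lra.
have [x + E] := MVT h0 dfi cf; rewrite in_itv/= => /andP[x0 xh].
have : f h <= f 0 by apply: fm; rewrite gtr0_norm// /h; lra.
rewrite -subr_le0 E subr0 pmulr_lle0// leNgt => /negP; apply.
have : `|f1 x - f1 0 - x * d| <= d / 2 * `|x|.
  by apply: hs; rewrite gtr0_norm//; rewrite /h in xh; lra.
rewrite (gtr0_norm x0) ler_norml => /andP[+ _]; nra.
Qed.

End DerivativeTests.

Section Mollified.
Context {R : realType} {N : nat}.
Notation spacetime := ('rV[R]_N * R)%type.
Implicit Types (z y : spacetime) (k : option 'I_N).
Variables (eps : R) (eps0 : 0 < eps).

(** On the support of the kernel [G] lies between two constants at distance [eta] from [G z], and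
    constants integrate exactly. *)
Lemma mollify_close (G : spacetime -> R) z eta m : bdd_fun G -> unif_cont G ->
  (forall y, in_box eps z y -> `|G y - G z| <= eta) ->
  spacetime_integral (rho eps z) = m ->
  `|spacetime_integral (fun y => G y * rho eps z y) - G z * m| <= eta * m.
Proof.
move=> bG uG hG mE.
pose B := support_radius eps z; have B0 : 0 < B := support_radius_gt0 eps0 z.
have cc (H : spacetime -> R) : bdd_fun H -> unif_cont H ->
    ccst B (fun y => H y * rho eps z y).
  move=> bH uH; rewrite (_ : (fun _ => _) =
    (fun y => H y * rho_dir eps (bump eps) None z y)); last first.
    by apply/funext => y; rewrite rho_dirE.
  apply: ccst_rho_dir => //; [exact: flat_smooth_bump|exact: bump_out|move=> j].
  by have := le_support_radius eps z j; rewrite -/B; lra.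
have ccc a : ccst B (fun y => a * rho eps z y).
  by apply: (cc (fun=> a)); [exists (`|a|)|exact: unif_cont_cst].
have Ia a : spacetime_integral (fun y => a * rho eps z y) = a * m.
  rewrite (spacetime_integralZ B0) ?mE//.
  have := ccc 1; congr (ccst _ _); apply/funext => y; exact: mul1r.
have le y : (G z - eta) * rho eps z y <= G y * rho eps z y <= (G z + eta) * rho eps z y.
  have [yz|yz] := pselect (in_box eps z y); last by rewrite rho_out// !mulr0 lexx.
  by rewrite !ler_wpM2r ?rho_ge0//; have := hG y yz; rewrite ler_distl => /andP[].
have h1 : (G z - eta) * m <= spacetime_integral (fun y => G y * rho eps z y).
  by rewrite -Ia; apply: (spacetime_integral_le B0) => // [|y]; [exact: cc|case/andP: (le y)].
have h2 : spacetime_integral (fun y => G y * rho eps z y) <= (G z + eta) * m.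
  by rewrite -Ia; apply: (spacetime_integral_le B0) => // [|y]; [exact: cc|case/andP: (le y)].
rewrite ler_distl; apply/andP; split; lra.
Qed.

Lemma test_function_rho (Omega : set 'rV[R]_N) T z :
  (forall y, in_box eps z y -> cylinder Omega T y) ->
  test_function (cylinder Omega T) (rho eps z).
Proof.
move=> h.
have sub : Defs.support (rho eps z) `<=` [set y | in_box eps z y].
  rewrite /Defs.support closureE; apply: smallest_sub; first exact: closed_box.
  move=> y /= /eqP; apply: contra_notP => hy; exact: rho_out.
split.
- exact/flat_smooth_smooth/flat_smooth_rho.
- apply: (subclosed_compact _ (@compact_box R N eps z) sub).
  exact: closed_closure.
- by move=> y /sub/h.
Qed.

(** If [J] is the mollification of [U'], the first integral is minus its time derivative and the sum
    is its Laplacian at [z]. [U'] and [F'] are global extensions of [U] and [F] from the support of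
    the kernel. *)
Lemma mollified_equation (Omega : set 'rV[R]_N) T (U F U' F' : spacetime -> R) z :
  weak_heat Omega T U F ->
  (forall y, in_box eps z y -> [/\ cylinder Omega T y, U' y = U y & F' y = F y]) ->
  bdd_fun U' -> unif_cont U' -> bdd_fun F' -> unif_cont F' ->
  spacetime_integral (fun y => U' y * rho_dir eps (bump1 eps) None z y) +
  \sum_(i < N) spacetime_integral (fun y => U' y * rho_dir eps (bump2 eps) (Some i) z y)
  = spacetime_integral (fun y => F' y * rho eps z y).
Proof.
move=> wU hbox bU uU bF uF.
have tf : test_function (cylinder Omega T) (rho eps z).
  by apply: test_function_rho => y /hbox[].
pose B := support_radius eps z; have B0 : 0 < B := support_radius_gt0 eps0 z.
have cc (G : spacetime -> R) c k : bdd_fun G -> unif_cont G -> flat_smooth c ->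
    (forall s, eps < `|s| -> c s = 0) -> ccst B (fun y => G y * rho_dir eps c k z y).
  move=> bG uG sc c0; apply: ccst_rho_dir => // j.
  by have := le_support_radius eps z j; rewrite -/B; lra.
have ct := cc U' (bump1 eps) None bU uU (flat_smooth_bump1 eps) (@bump1_out _ _).
have cx i := cc U' (bump2 eps) (Some i) bU uU (flat_smooth_bump2 eps) (@bump2_out _ _).
have cF := cc F' (bump eps) None bF uF (flat_smooth_bump eps) (@bump_out _ _).
have [cS IS] := spacetime_integral_sum B0 cx.
have := wU _ tf.
have -> : (fun y => - U y * dt (rho eps z) y - U y * laplacian (rho eps z) y
     + F y * rho eps z y) =
   (fun y => (-1 * (U' y * rho_dir eps (bump1 eps) None z y)) +
   (-1 * (\sum_i U' y * rho_dir eps (bump2 eps) (Some i) z y)) +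
    F' y * rho_dir eps (bump eps) None z y).
  apply/funext => y; rewrite dt_rho laplacian_rho rho_dirE.
  have [/hbox[_ -> ->]|yz] := pselect (in_box eps z y).
    by rewrite -mulr_sumr !mulN1r mulNr.
  rewrite rho_out// rho_dir_out//; last exact: bump1_out.
  rewrite !big1 => [|i _|i _]; rewrite ?rho_dir_out ?mulr0 ?subr0 ?addr0//; exact: bump2_out.
rewrite (spacetime_integralD B0); last 2 first.
- by apply: ccstD; exact: ccstZ.
- exact: cF.
rewrite (spacetime_integralD B0); [|exact: ccstZ..].
rewrite !(spacetime_integralZ B0)// IS => h.
rewrite [RHS](_ : _ = spacetime_integral (fun y => F' y * rho_dir eps (bump eps) None z y)).
  by move: h; lra.
by congr spacetime_integral; apply/funext => y; rewrite rho_dirE.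
Qed.

End Mollified.

(** * Maximum principle for weak solutions *)

Section Touching.
Context {R : realType} {N : nat}.
Notation spacetime := ('rV[R]_N * R)%type.
Implicit Types (z y : spacetime) (k : option 'I_N).

(* [wt] and [wxx i] are the time derivative and the pure second space
   derivatives of [w] at [y], taken along coordinate lines. *)
Definition C12_at (w wt : spacetime -> R) (wxx : 'I_N -> spacetime -> R) y := [/\
  {for y, continuous w},
  is_derive (0 : R) (1 : R) (fun h : R => w (h *: unit_dir None + y)) (wt y) &
  forall i, exists g1 : R -> R, exists2 r : R, 0 < r &
    (forall h, `|h| < r ->
      is_derive h (1 : R) (fun h : R => w (h *: unit_dir (Some i) + y)) (g1 h)) /\
    is_derive (0 : R) (1 : R) g1 (wxx i y)].

Definition sqdist (a : 'rV[R]_N) y := \sum_(i < N) (y.1 0 i - a 0 i) ^+ 2.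

Lemma sqdist_ge0 a y : 0 <= sqdist a y.
Proof. by apply: sumr_ge0 => i _; exact: sqr_ge0. Qed.

Lemma sqdist_space (h : R) i a y :
  sqdist a (h *: unit_dir (Some i) + y) =
  sqdist a y + (2 * (y.1 0 i - a 0 i) * h + h ^+ 2).
Proof.
rewrite /sqdist (bigD1 i)//= [in RHS](bigD1 i)//= addrAC; congr (_ + _).
  by have := crd_line (Some i) (Some i) h y; rewrite /= eqxx => ->; ring.
apply: eq_bigr => j /negbTE ji.
have := crd_line (Some j) (Some i) h y; rewrite /= => ->.
by rewrite (_ : (Some j == Some i) = (j == i))// ji addr0.
Qed.

Lemma sqdist_time (h : R) a y : sqdist a (h *: unit_dir None + y) = sqdist a y.
Proof.
apply: eq_bigr => j _.
by have := crd_line (Some j) None h y; rewrite /= => ->; rewrite addr0.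
Qed.

Lemma sqdist_continuous a : continuous (sqdist a).
Proof.
move=> y; apply: (@cvg_big R 'I_N (@GRing.add R)); first by move=> x; exact: add_continuous.
move=> i _; rewrite expr2.
under [X in X @ _]eq_fun do rewrite expr2.
by apply: cvgM; (apply: cvgB; [exact: (@crd_continuous R N (Some i))|exact: cvg_cst]).
Qed.

Lemma sqdist_coord (a : 'rV[R]_N) y i : (y.1 0 i - a 0 i) ^+ 2 <= sqdist a y.
Proof. by rewrite /sqdist (bigD1 i)//= lerDl sumr_ge0// => *; exact: sqr_ge0. Qed.

(** The penalty that makes a maximum strict: among times up to that of [z] it is nonnegative and
    vanishes only at [z], and its Laplacian minus its time derivative is the constant $2N+1$. *)
Definition par_dist z y := sqdist z.1 y + (z.2 - y.2).

Lemma par_dist_space (h : R) i z y :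
  par_dist z (h *: unit_dir (Some i) + y) =
  par_dist z y + (2 * (y.1 0 i - z.1 0 i) * h + h ^+ 2).
Proof.
rewrite /par_dist sqdist_space.
by have := crd_line None (Some i) h y; rewrite /= => ->; rewrite addr0 addrAC.
Qed.

Lemma par_dist_time (h : R) z y :
  par_dist z (h *: unit_dir None + y) = par_dist z y - h.
Proof.
rewrite /par_dist sqdist_time -addrA; congr (_ + _).
by have := crd_line None None h y; rewrite /= => ->; ring.
Qed.

Lemma par_dist_continuous z : continuous (par_dist z).
Proof.
move=> y; apply: cvgD; first exact: sqdist_continuous.
by apply: cvgB; [exact: cvg_cst|exact: (@crd_continuous R N None)].
Qed.

(** The condition [d <= 1] is there for the time coordinate, which enters linearly: a gap [d] is
    then at least [d ^+ 2]. *)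
Lemma par_dist_ge z y (d : R) k : 0 < d -> d <= 1 -> y.2 <= z.2 ->
  d <= `|crd k y - crd k z| -> d ^+ 2 <= par_dist z y.
Proof.
move=> d0 d1 yz; rewrite /par_dist; case: k => [i|] /= h.
  rewrite -[leLHS]addr0 lerD ?subr_ge0// (le_trans _ (sqdist_coord z.1 y i))//.
  by rewrite -[leRHS]real_normK ?num_real// lerXn2r ?nnegrE// ltW.
have := sqdist_ge0 z.1 y; move: h; rewrite distrC ger0_norm ?subr_ge0//; nra.
Qed.

(** [q] is the penalty at the mollified maximum: it can only compensate the two mollification
    errors, since [U - w] is largest at the centre. *)
Lemma mollified_gap (m eta u0 u1 w0 w1 q J0 J1 : R) : 0 < m -> 0 < eta ->
  u0 * m - eta * m <= J0 -> J1 <= u1 * m + eta * m ->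
  J0 - m * w0 <= J1 - m * (w1 + q) -> u1 - w1 <= u0 - w0 -> q < 3 * eta.
Proof.
move=> m0 eta0 h1 h2 h3 /(ler_wpM2l (ltW m0)) h4; rewrite -(ltr_pM2l m0).
have : 0 < eta * m by rewrite mulr_gt0.
lra.
Qed.

Lemma mollified_contradiction (m c de n It S I1 F wt : R) : 0 < m -> 0 < c ->
  de * (2 * n + 1) = c -> 0 <= - It - m * (wt - de) ->
  I1 <= m * (S + 2 * de * n) -> F * m - c * m <= It + I1 ->
  3 * c < wt - S + F -> False.
Proof.
move=> m0 c0 ce h1 h2 h3; rewrite -subr_gt0 -(pmulr_rgt0 _ m0).
have : m * (de * (2 * n + 1)) = m * c by rewrite ce.
have : 0 < m * c by rewrite mulr_gt0.
lra.
Qed.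

(** By contradiction. Subtracting a multiple of [par_dist z0] makes the maximum at [z0] strict, so
    the mollified function still has one near [z0]; there the derivative tests for the mollification
    contradict its equation, because all errors are small compared with the assumed excess. *)
Theorem touching_from_above (Omega : set 'rV[R]_N) (T : R)
    (U F w wt : spacetime -> R) (wxx : 'I_N -> spacetime -> R) z0 (d0 : R) :
  0 < d0 -> weak_heat Omega T U F ->
  (forall y, in_box (2 * d0) z0 y ->
     [/\ cylinder Omega T y, {for y, continuous U} & {for y, continuous F}]) ->
  (forall y, in_box d0 z0 y -> y.2 <= z0.2 -> U y - w y <= U z0 - w z0) ->
  (forall y, in_box d0 z0 y -> C12_at w wt wxx y) ->
  {for z0, continuous (fun y => wt y - \sum_i wxx i y)} ->
  wt z0 - \sum_i wxx i z0 + F z0 <= 0.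
Proof.
move=> d00 wU cyl hmax hw cL; rewrite leNgt; apply/negP => s0.
(* Of the excess [4 * c], [3 * c] persists near [z0] by continuity; one [c] pays for mollifying [F]
   and one for the penalty, as [de * (2 * N + 1) = c]. *)
set s := _ + F z0 in s0; pose c := s / 4.
have c0 : 0 < c by rewrite divr_gt0.
pose n1 : R := (2 * N%:R + 1); have n10 : 0 < n1 by rewrite ltr_wpDl// mulr_ge0.
pose de := c / n1; have de0 : 0 < de by rewrite divr_gt0.
have z0in (r : R) : 0 <= r -> in_box r z0 z0 by move=> r0 k; rewrite subrr normr0.
have [_ _ cF0] := cyl z0 (z0in _ (mulr_ge0 (ler0n _ 2) (ltW d00))).
have [r r0 hr] : exists2 r : R, 0 < r & forall y, ball z0 r y ->
    3 * c < wt y - \sum_i wxx i y + F y.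
  have cLF : (fun y => wt y - \sum_i wxx i y + F y) y @[y --> z0] --> s by exact: cvgD.
  have /(cvgr_gt _ cLF) : 3 * c < s by rewrite /c; lra.
  by move=> /nbhs_ballP[r /= r0 hr]; exists r.
pose d1 := Num.min (Num.min d0 1) (r / 2).
have d10 : 0 < d1 by rewrite !lt_min d00 ltr01/= divr_gt0.
have d1d0 : d1 <= d0 by rewrite !ge_min lexx.
have d11 : d1 <= 1 by rewrite !ge_min lexx orbT.
have d1r : d1 <= r / 2 by rewrite ge_min lexx orbT.
have box1 y : in_box d1 z0 y -> 3 * c < wt y - \sum_i wxx i y + F y.
  move=> h; apply: hr; apply: ball_crd => // k; rewrite /ball /= distrC.
  by have := h k; lra.
have d2 : 0 <= 2 * d0 by lra.
have within G : (forall y, in_box (2 * d0) z0 y -> {for y, continuous G}) ->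
    {within [set y | in_box (2 * d0) z0 y], continuous (G : spacetime -> R)}.
  move=> h; rewrite continuous_subspace_in => y; rewrite inE => /= hy.
  exact/continuous_subspaceT_for/h.
have [bU uU] := clamp_extend d2 (within U (fun y hy => let: And3 _ h _ := cyl y hy in h)).
have [bF uF] := clamp_extend d2 (within F (fun y hy => let: And3 _ _ h := cyl y hy in h)).
set U' := U \o _ in bU uU; set F' := F \o _ in bF uF.
have U'E y : in_box (2 * d0) z0 y -> U' y = U y by move=> h; rewrite /U' /= clamp_id.
have F'E y : in_box (2 * d0) z0 y -> F' y = F y by move=> h; rewrite /F' /= clamp_id.
(* The penalty is at least [de * d1 ^+ 2] at distance [d1], which exceeds the two mollification
   errors. *)
pose eta := de * d1 ^+ 2 / 3.
have eta0 : 0 < eta by rewrite divr_gt0// mulr_gt0// exprn_gt0.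
have [eU eU0 hU] := uU _ eta0; have [eF eF0 hF] := uF _ c0.
pose eps := Num.min d0 (Num.min eU eF) / 2.
have m0 : 0 < Num.min d0 (Num.min eU eF) by rewrite !lt_min d00 eU0.
have eps0 : 0 < eps by rewrite divr_gt0.
have m1 : Num.min d0 (Num.min eU eF) <= d0 by rewrite ge_min lexx.
have m2 : Num.min d0 (Num.min eU eF) <= eU by rewrite !ge_min lexx !orbT.
have m3 : Num.min d0 (Num.min eU eF) <= eF by rewrite !ge_min lexx !orbT.
have epsd : eps <= d0 by rewrite /eps; lra.
have epsU : eps < eU by rewrite /eps; lra.
have epsF : eps < eF by rewrite /eps; lra.
have inball y z (e : R) : eps < e -> in_box eps z y -> ball y e z.
  move=> ee h; apply: ball_crd => [|k]; first exact: lt_trans ee.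
  by rewrite /ball /=; exact: le_lt_trans (h k) ee.
have [m mp mE] := @rho_mass R N eps eps0.
pose J z := spacetime_integral (fun y => U' y * rho eps z y).
have JU z : `|J z - U' z * m| <= eta * m.
  by apply: mollify_close => // y yz; apply/ltW/hU/inball.
pose H := [set y | in_box d1 z0 y] `&` [set y | crd None y <= z0.2].
have cH : compact H.
  apply: (subclosed_compact _ (@compact_box R N d1 z0)); last exact: subIsetl.
  apply: closedI; first exact: closed_box.
  apply: (@preimage_closed _ _ (crd None) [set t | t <= z0.2]); last exact: closed_le.
  by move=> y _; exact: crd_continuous.
have Hz0 : H z0 by split => //=; apply: z0in; exact: ltW.
pose phi y := J y - m * (w y + de * par_dist z0 y).
have cphi : {within H, continuous phi}.
  rewrite continuous_subspace_in => y; rewrite inE => -[hy hyt].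
  apply: continuous_subspaceT_for; first by split.
  have [wy _ _] := hw y (fun k => le_trans (hy k) d1d0).
  apply: cvgB; first exact: (mollify_continuous eps0 bU uU).
  apply: cvgM; first exact: cvg_cst.
  apply: cvgD; first exact: wy.
  by apply: cvgM; [exact: cvg_cst|exact: par_dist_continuous].
have [z1] := compact_EVT_max (ex_intro _ z0 Hz0) cH cphi.
rewrite inE => -[/= z1box z1t] z1max.
have {}z1max y : H y -> phi y <= phi z1 by move=> Hy; apply: z1max; rewrite inE.
have boxle (a b : R) y z : a <= b -> in_box a z y -> in_box b z y.
  by move=> ab h k; exact: le_trans (h k) ab.
have sub2 y : in_box d1 z0 y -> in_box (2 * d0) z0 y by apply: boxle; rewrite (le_trans d1d0)// ler_peMl ?ler1n// ltW.
have Q0 : par_dist z0 z0 = 0.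
  by rewrite /par_dist subrr addr0 /sqdist big1// => i _; rewrite subrr expr0n.
have Qz1 : de * par_dist z0 z1 < de * d1 ^+ 2.
  have e3 : de * d1 ^+ 2 = 3 * eta by rewrite /eta; field.
  have := z1max z0 Hz0; rewrite /phi Q0 mulr0 addr0 e3.
  have := JU z1; have := JU z0; rewrite !ler_distl => /andP[a1 _] /andP[_ a2].
  rewrite !U'E in a1 a2; [|exact: sub2|by apply: sub2; exact: Hz0.1].
  have hm := hmax z1 (boxle _ _ _ _ d1d0 z1box) z1t.
  by move=> a3; exact: mollified_gap mp eta0 a1 a2 a3 hm.
(* Lateral and bottom faces of the box are excluded by the penalty; the final time [z0.2] is not,
   whence the one-sided test in time. *)
have strict k : `|crd k z1 - crd k z0| < d1.
  rewrite ltNge; apply/negP => /(par_dist_ge d10 d11 z1t).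
  by rewrite leNgt -(ltr_pM2l de0) Qz1.
pose rk k := d1 - `|crd k z1 - crd k z0|.
have rk0 k : 0 < rk k by rewrite subr_gt0.
have line_box k (h : R) : `|h| < rk k -> in_box d1 z0 (h *: unit_dir k + z1).
  move=> hh j; rewrite crd_line; case: eqP => [->|_]; last by rewrite addr0.
  by rewrite addrAC (le_trans (ler_normD _ _))// -lerBrDl ltW.
have [_ wt1 wx1] := hw z1 (boxle _ _ _ _ d1d0 z1box).
have JE k : J = (fun z => spacetime_integral (fun y => U' y * rho_dir eps (bump eps) k z y)).
  apply/funext => z; congr spacetime_integral; apply/funext => y.
  by rewrite rho_dirE.
pose It := spacetime_integral (fun y => U' y * rho_dir eps (bump1 eps) None z1 y).
pose Ix i := spacetime_integral (fun y => U' y * rho_dir eps (bump2 eps) (Some i) z1 y).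
have time_test : 0 <= - It - m * (wt z1 - de).
  have dJ : is_derive (0 : R) (1 : R) (fun h : R => J (h *: unit_dir None + z1)) (- It).
    apply/is_derive_line0; rewrite (JE None).
    apply: (is_derive_mollify eps0 None z1 bU uU (flat_smooth_bump eps)).
    exact: bump_out.
  have dphi : is_derive (0 : R) (1 : R) (fun h : R => phi (h *: unit_dir None + z1))
      (- It + - m * (wt z1 + de * (- 1))).
    have -> : (fun h : R => phi (h *: unit_dir None + z1)) = (fun h : R =>
        J (h *: unit_dir None + z1) +
        - m * (w (h *: unit_dir None + z1) + de * (par_dist z0 z1 - h))).
      by apply/funext => h; rewrite /phi par_dist_time mulNr.
    have dQ : is_derive (0 : R) (1 : R) (fun h : R => par_dist z0 z1 - h) (- 1).
      apply: (is_derive_eq (is_derive_add_comp (is_derive_cst _ _ _) (is_deriveNid _ _))).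
      by rewrite add0r.
    exact: (is_derive_add_comp dJ (is_derive_cmul_comp (- m)
      (is_derive_add_comp wt1 (is_derive_cmul_comp de dQ)))).
  have := derive_ge0_left (rk0 None) dphi; rewrite mulrN1 mulNr; apply.
  move=> h h1 h2; rewrite scale0r add0r; apply: z1max; split.
    by apply: (line_box None); rewrite ler0_norm// ltrNl.
  have E : crd None (h *: unit_dir None + z1) <= z0.2.
    by rewrite crd_line eqxx -[leRHS]addr0 lerD.
  exact: E.
have space_test i : Ix i - m * (wxx i z1 + 2 * de) <= 0.
  have [g1 [r1 r10 [dg1 dg2]]] := wx1 i.
  pose K (h : R) := spacetime_integral
    (fun y => U' y * rho_dir eps (bump1 eps) (Some i) (h *: unit_dir (Some i) + z1) y).
  have dJ (h : R) : is_derive h (1 : R) (fun h : R => J (h *: unit_dir (Some i) + z1)) (- K h).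
    apply/is_derive_line; rewrite (JE (Some i)).
    apply: (is_derive_mollify eps0 (Some i) _ bU uU (flat_smooth_bump eps)).
    exact: bump_out.
  have dK : is_derive (0 : R) (1 : R) (fun h => - K h) (Ix i).
    have dK0 : is_derive (0 : R) (1 : R) K (- Ix i).
      pose K1 z := spacetime_integral
        (fun y => U' y * rho_dir eps (bump1 eps) (Some i) z y).
      apply: (is_derive_line0 K1 z1 (unit_dir (Some i)) (- Ix i)).2.
      apply: (is_derive_mollify eps0 (Some i) z1 bU uU (flat_smooth_bump1 eps)).
      exact: bump1_out.
    by apply: (is_derive_eq (is_derive_opp_comp dK0)); rewrite opprK.
  pose q := z1.1 0 i - z0.1 0 i.
  have dQ (h : R) : is_derive h (1 : R)
      (fun h : R => par_dist z0 (h *: unit_dir (Some i) + z1)) (2 * q + 2 * h).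
    under eq_fun do rewrite par_dist_space -/q.
    have d1' := is_derive_cmul_comp (2 * q) (is_derive_id h (1 : R)).
    have d2' := is_derive_exp_comp 2 (is_derive_id h (1 : R)).
    apply: (is_derive_eq (is_derive_add_comp (is_derive_cst _ _ _)
      (is_derive_add_comp d1' d2'))).
    by rewrite /=; ring.
  have dQ2 : is_derive (0 : R) (1 : R) (fun h => 2 * q + 2 * h) 2.
    apply: (is_derive_eq (is_derive_add_comp (is_derive_cst _ _ _)
      (is_derive_cmul_comp 2 (is_derive_id (0 : R) (1 : R))))).
    by rewrite add0r mulr1.
  pose r2 := Num.min r1 (rk (Some i)).
  have r20 : 0 < r2 by rewrite lt_min r10 rk0.
  have r21 : r2 <= r1 by rewrite ge_min lexx.
  have r22 : r2 <= rk (Some i) by rewrite ge_min lexx orbT.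
  have dphi1 (h : R) : `|h| < r2 ->
    is_derive h (1 : R) (fun h : R => phi (h *: unit_dir (Some i) + z1))
      (- K h + - m * (g1 h + de * (2 * q + 2 * h))).
    move=> hr2.
    have -> : (fun h : R => phi (h *: unit_dir (Some i) + z1)) = (fun h : R =>
        J (h *: unit_dir (Some i) + z1) + - m * (w (h *: unit_dir (Some i) + z1)
          + de * par_dist z0 (h *: unit_dir (Some i) + z1))).
      by apply/funext => x; rewrite /phi mulNr.
    exact: (is_derive_add_comp (dJ h) (is_derive_cmul_comp (- m)
      (is_derive_add_comp (dg1 h (lt_le_trans hr2 r21)) (is_derive_cmul_comp de (dQ h))))).
  have dphi2 : is_derive (0 : R) (1 : R)
      (fun h => - K h + - m * (g1 h + de * (2 * q + 2 * h)))
      (Ix i + - m * (wxx i z1 + de * 2)).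
    exact: (is_derive_add_comp dK (is_derive_cmul_comp (- m)
      (is_derive_add_comp dg2 (is_derive_cmul_comp de dQ2)))).
  have := second_derivative_test r20 dphi1 dphi2.
  rewrite mulNr [de * 2]mulrC; apply => h hr2.
  rewrite scale0r add0r; apply: z1max; split.
    by apply: (line_box (Some i)); exact: lt_le_trans r22.
  have E : crd None (h *: unit_dir (Some i) + z1) <= z0.2 by rewrite crd_line addr0.
  exact: E.
have box2 y : in_box eps z1 y -> in_box (2 * d0) z0 y.
  move=> h k; have -> : crd k y - crd k z0 = (crd k y - crd k z1) + (crd k z1 - crd k z0).
    by rewrite addrA subrK.
  rewrite (le_trans (ler_normD _ _))// mulr2n mulrDl mul1r lerD//.
    exact: le_trans (h k) epsd.
  exact: le_trans (z1box k) d1d0.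
have eqn : It + \sum_(i < N) Ix i = spacetime_integral (fun y => F' y * rho eps z1 y).
  apply: (mollified_equation eps0 wU _ bU uU bF uF) => y /box2 hy.
  by rewrite U'E// F'E//; have [] := cyl y hy.
have Fm : `|spacetime_integral (fun y => F' y * rho eps z1 y) - F' z1 * m| <= c * m.
  by apply: mollify_close => // y yz; apply/ltW/hF/inball.
have sumI : \sum_(i < N) Ix i <= m * (\sum_(i < N) wxx i z1 + 2 * de * N%:R).
  rewrite [leRHS](_ : _ = \sum_(i < N) m * (wxx i z1 + 2 * de)).
    by apply: ler_sum => i _; rewrite -subr_le0.
  by rewrite -mulr_sumr big_split/= sumr_const card_ord mulr_natr.
have final := box1 z1 z1box.
have n1c : de * (2 * N%:R + 1) = c by rewrite /de divfK// gt_eqF.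
move: Fm; rewrite -eqn F'E; last exact: sub2.
rewrite ler_distl => /andP[Fm _].
exact: mollified_contradiction mp c0 n1c time_test sumI Fm final.
Qed.

End Touching.

(** * Comparison with classical supersolutions *)

Section Comparison.
Context {R : realType} {N : nat}.
Notation spacetime := ('rV[R]_N * R)%type.
Implicit Types (z y : spacetime).

Lemma open_box (O : set spacetime) z : nbhs z O ->
  exists2 r : R, 0 < r & forall y, in_box r z y -> O y.
Proof.
move=> /nbhs_ballP[r /= r0 hr]; exists (r / 2); first by rewrite divr_gt0.
move=> y h; apply: hr; apply: ball_crd => // k; rewrite /ball /= distrC.
by rewrite (le_lt_trans (h k))// ltr_pdivrMr// ltr_pMr// ltr1n.
Qed.

(** [S] stops at time [T1], while the open set [O] goes beyond it, because mollifying at a maximum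
    at time [T1] uses later times. Boundary values enter through the requirement that points of [S]
    with [w < U] belong to [O]. *)
Lemma comparison (Omega : set 'rV[R]_N) (T T1 : R) (U F w wt : spacetime -> R)
    (wxx : 'I_N -> spacetime -> R) (S O : set spacetime) :
  weak_heat Omega T U F -> compact S ->
  {within S, continuous U} -> {within S, continuous w} ->
  (forall z, S z -> z.2 <= T1 /\ (w z < U z -> O z)) ->
  (forall z, O z -> [/\ nbhs z O, cylinder Omega T z,
     {for z, continuous U}, {for z, continuous F} & z.2 <= T1 -> S z]) ->
  (forall z, O z -> C12_at w wt wxx z /\
     {for z, continuous (fun y => wt y - \sum_i wxx i y)}) ->
  (forall z, O z -> w z < U z -> 0 < wt z - \sum_i wxx i z + F z) ->
  forall z, S z -> U z <= w z.
Proof.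
move=> wU cS cU cw SO OS Ow Op z Sz; rewrite leNgt; apply/negP => wz.
have cUw : {within S, continuous (fun y => U y - w y)}.
  move=> y; apply: cvgB; [exact: cU|exact: cw].
have [z0] := compact_EVT_max (ex_intro _ z Sz) cS cUw.
rewrite inE => Sz0 z0max.
have wz0 : w z0 < U z0.
  have := z0max z; rewrite inE => /(_ Sz); lra.
have [z0T /(_ wz0) Oz0] := SO z0 Sz0.
have [nO _ _ _ _] := OS z0 Oz0.
have [r r0 hr] := open_box nO.
have r2 : 0 < r / 2 by rewrite divr_gt0.
have sub y : in_box (r / 2) z0 y -> O y.
  by move=> h; apply: hr => k; rewrite (le_trans (h k))// ler_pdivrMr// ler_peMr ?ler1n// ltW.
have := Op z0 Oz0 wz0; rewrite ltNge => /negP; apply.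
apply: (@touching_from_above _ _ Omega T U F w wt wxx z0 (r / 2)) => //.
- move=> y; rewrite mulrC divfK// => /hr Oy.
  by have [_ ? ? ? _] := OS y Oy.
- move=> y /sub Oy yt; apply: z0max; rewrite inE.
  by have [_ _ _ _ ] := OS y Oy; apply; exact: le_trans z0T.
- by move=> y /sub Oy; have [] := Ow y Oy.
- by have [] := Ow z0 Oz0.
Qed.

Lemma C12_add (w1 wt1 w2 wt2 : spacetime -> R) (wxx1 wxx2 : 'I_N -> spacetime -> R) y :
  C12_at w1 wt1 wxx1 y -> C12_at w2 wt2 wxx2 y ->
  C12_at (fun y => w1 y + w2 y) (fun y => wt1 y + wt2 y) (fun i y => wxx1 i y + wxx2 i y) y.
Proof.
move=> [c1 t1 x1] [c2 t2 x2]; split.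
- exact: cvgD c1 c2.
- exact: is_derive_add_comp t1 t2.
move=> i; have [g1 [r1 r10 [d1 e1]]] := x1 i; have [g2 [r2 r20 [d2 e2]]] := x2 i.
exists (fun h => g1 h + g2 h), (Num.min r1 r2); first by rewrite lt_min r10.
split; last exact: is_derive_add_comp.
move=> h; rewrite lt_min => /andP[h1 h2].
exact: is_derive_add_comp (d1 h h1) (d2 h h2).
Qed.

Lemma C12_cst (c : R) y : C12_at (fun=> c) (fun=> 0) (fun _ => fun=> 0) y.
Proof.
split; [exact: cvg_cst|exact: is_derive_cst|move=> i].
by exists (fun=> 0), 1 => //; split=> [h _|]; exact: is_derive_cst.
Qed.

End Comparison.

(** * Barriers *)

Section RadialExponential.
Context {R : realType} {N : nat}.
Notation spacetime := ('rV[R]_N * R)%type.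
Implicit Types (z y : spacetime).
Variables (a : 'rV[R]_N) (L Lt Lr Lrr : R -> R -> R).

Definition radial (f : R -> R -> R) : spacetime -> R := fun y => f (sqdist a y) y.2.

Definition exp_t y := expR (radial L y) * radial Lt y.
Definition exp_xx (i : 'I_N) y := expR (radial L y) *
  (((radial Lr y) ^+ 2 + radial Lrr y) * (2 * (y.1 0 i - a 0 i)) ^+ 2
   + 2 * radial Lr y).

(** The heat operator of [expR L] divided by [expR L], for [L] a function of $r=|x-a|^2$ and $t$:
    $|\nabla L|^2 = 4rL_r^2$ and $\Delta L = 4rL_{rr}+2NL_r$. *)
Definition heat_exponent (r t : R) :=
  Lt r t - 4 * r * (Lr r t ^+ 2 + Lrr r t) - 2 * N%:R * Lr r t.

Lemma exp_operator y : exp_t y - \sum_i exp_xx i y =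
  expR (radial L y) * radial heat_exponent y.
Proof.
rewrite /exp_t /exp_xx -mulr_sumr -mulrBr; congr (_ * _).
rewrite big_split/= -mulr_sumr sumr_const card_ord.
rewrite (eq_bigr (fun i => 4 * (y.1 0 i - a 0 i) ^+ 2)); last by move=> i _; ring.
rewrite -mulr_sumr -/(sqdist a y) /radial /heat_exponent -mulr_natl; ring.
Qed.

Lemma C12_exp y :
  {for y, continuous (radial L)} ->
  is_derive y.2 (1 : R) (L (sqdist a y)) (Lt (sqdist a y) y.2) ->
  (\forall r \near sqdist a y, is_derive r (1 : R) (fun r => L r y.2) (Lr r y.2)) ->
  is_derive (sqdist a y) (1 : R) (fun r => Lr r y.2) (Lrr (sqdist a y) y.2) ->
  C12_at (fun y => expR (radial L y)) exp_t exp_xx y.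
Proof.
move=> cL dt dr drr; split.
- by apply: (@continuous_comp _ _ _ (radial L) (@expR R)); [exact: cL|exact: continuous_expR].
- have E : (fun h : R => expR (radial L (h *: unit_dir None + y))) =
      (fun h : R => expR (L (sqdist a y) (y.2 + h))).
    apply/funext => h; rewrite /radial sqdist_time.
    by have := crd_line None None h y; rewrite /= => ->.
  rewrite E.
  have dt' : is_derive (y.2 + 0) (1 : R) (L (sqdist a y)) (Lt (sqdist a y) y.2).
    by rewrite addr0.
  have := is_derive_expR_comp (@is_derive1_comp R (L (sqdist a y)) _ 0 _ _ dt'
    (is_derive_translate y.2 0)).
  by rewrite /= addr0 mulr1; exact.
move=> i; pose b := y.1 0 i - a 0 i.
pose s (h : R) := sqdist a y + (2 * b * h + h ^+ 2).
have s0 : s 0 = sqdist a y by rewrite /s mulr0 expr0n !addr0.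
have ds (h : R) : is_derive h (1 : R) s (2 * b + 2 * h).
  apply: (is_derive_eq (is_derive_add_comp (is_derive_cst _ _ _) (is_derive_add_comp
    (is_derive_cmul_comp (2 * b) (is_derive_id h 1)) (is_derive_exp_comp 2 (is_derive_id h 1))))).
  by rewrite /=; ring.
have E : (fun h : R => expR (radial L (h *: unit_dir (Some i) + y))) =
    (fun h : R => expR (L (s h) y.2)).
  apply/funext => h; rewrite /radial sqdist_space.
  by have := crd_line None (Some i) h y; rewrite /= => ->; rewrite addr0.
rewrite E.
have cs : {for 0, continuous s}.
  by apply/differentiable_continuous/derivable1_diffP; have [] := ds 0.
have drs : \forall r \near s 0, is_derive r (1 : R) (fun r => L r y.2) (Lr r y.2).
  by rewrite s0.
have /nbhs_ballP[r /= r0 hr] := cs _ drs.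
exists (fun h => expR (L (s h) y.2) * (Lr (s h) y.2 * (2 * b + 2 * h))), r => //.
have dL h : `|h| < r -> is_derive h (1 : R) (fun h => L (s h) y.2) (Lr (s h) y.2 * (2 * b + 2 * h)).
  move=> hr0; have := hr h; rewrite /ball /= sub0r normrN => /(_ hr0) d1.
  exact: (@is_derive1_comp R (fun r => L r y.2) s h _ _ d1 (ds h)).
split=> [h /dL|]; first exact: is_derive_expR_comp.
have d0 := dL 0; rewrite normr0 in d0; have {}d0 := d0 r0.
have drr' : is_derive (s 0) (1 : R) (fun r => Lr r y.2) (Lrr (sqdist a y) y.2).
  by rewrite s0.
have d2 := @is_derive1_comp R (fun r => Lr r y.2) s 0 _ _ drr' (ds 0).
have d3 : is_derive (0 : R) (1 : R) (fun h : R => 2 * b + 2 * h) 2.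
  apply: (is_derive_eq (is_derive_add_comp (is_derive_cst _ _ _)
    (is_derive_cmul_comp 2 (is_derive_id (0 : R) 1)))).
  by rewrite add0r mulr1.
apply: (is_derive_eq (is_derive_mul_comp (is_derive_expR_comp d0)
  (is_derive_mul_comp d2 d3))).
rewrite /= s0 /exp_xx /radial -/b; ring.
Qed.

End RadialExponential.

Section Ansatz.
Context {R : realType}.
Variables (C p1 p2 p3 p4 p5 tau c l : R).

Definition theta (t : R) : R := 1 + c * (ln t - l).
(* Logarithms of all the barriers, in the variables r = |x - a|^2 and t: the
   [p3] term is singular on r + t = tau, [p1 = - N/2] with [p4 = - 1/4] is the
   heat kernel, and [theta] decays logarithmically once t >> exp l. *)
Definition ansatz (r t : R) : R := C + (p1 * ln t + (p2 * ln (r + t) +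
  (p3 * ln (r + t - tau) + (p4 * (r * t^-1) + p5 * ln (theta t))))).
Definition ansatz_t (r t : R) : R := p1 * t^-1 + (p2 * (r + t)^-1 +
  (p3 * (r + t - tau)^-1 + (p4 * (r * - t^-1 ^+ 2) +
   p5 * ((theta t)^-1 * (c * t^-1))))).
Definition ansatz_r (r t : R) : R :=
  p2 * (r + t)^-1 + (p3 * (r + t - tau)^-1 + p4 * t^-1).
Definition ansatz_rr (r t : R) : R :=
  p2 * (- (r + t)^-1 ^+ 2) + p3 * (- (r + t - tau)^-1 ^+ 2).

(** An absent term is switched off by [tau = 0] or [c = 0]; its condition then repeats [0 < r + t]
    or reads [0 < 1]. *)
Definition ansatz_dom (r t : R) := [/\ 0 < t, 0 < r + t, tau < r + t & 0 < theta t].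

Lemma is_derive_theta (t : R) : 0 < t -> is_derive t (1 : R) theta (c * t^-1).
Proof.
move=> t0; have dl := is_derive_ln_comp t0 (is_derive_id t (1 : R)).
apply: (is_derive_eq (is_derive_add_comp (is_derive_const 1 t)
  (is_derive_cmul_comp c (is_derive_add_comp dl (is_derive_const (- l) t))))).
by rewrite add0r addr0 mulr1.
Qed.

Lemma is_derive_ansatz_t (r t : R) : ansatz_dom r t ->
  is_derive t (1 : R) (ansatz r) (ansatz_t r t).
Proof.
move=> [t0 rt0 rtau th0].
have drt := is_derive_translate r t.
have drtau := is_derive_add_comp drt (is_derive_const (- tau) t).
have rtau0 : 0 < r + t - tau by rewrite subr_gt0.
have d1 := is_derive_cmul_comp p1 (@is_derive_ln_comp R (fun x => x) t _ t0 (is_derive_id t (1 : R))).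
have d2 := is_derive_cmul_comp p2 (@is_derive_ln_comp R (fun x => r + x) t _ rt0 drt).
have d3 := is_derive_cmul_comp p3 (@is_derive_ln_comp R (fun x => r + x - tau) t _ rtau0 drtau).
have d4 := is_derive_cmul_comp p4 (is_derive_cmul_comp r
  (@is_derive_inv_comp R (fun x => x) t _ (lt0r_neq0 t0) (is_derive_id t (1 : R)))).
have d5 := is_derive_cmul_comp p5 (@is_derive_ln_comp R theta t _ th0 (is_derive_theta t0)).
apply: (is_derive_eq (is_derive_add_comp (is_derive_const C t) (is_derive_add_comp d1
  (is_derive_add_comp d2 (is_derive_add_comp d3 (is_derive_add_comp d4 d5)))))).
by rewrite /ansatz_t add0r addr0 !mulr1.
Qed.

Lemma is_derive_ansatz_r (r t : R) : ansatz_dom r t ->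
  is_derive r (1 : R) (fun r => ansatz r t) (ansatz_r r t).
Proof.
move=> [t0 rt0 rtau th0].
have drt := is_derive_add_comp (is_derive_id r (1 : R)) (is_derive_const t r).
have drtau := is_derive_add_comp drt (is_derive_const (- tau) r).
have rtau0 : 0 < r + t - tau by rewrite subr_gt0.
have d2 := is_derive_cmul_comp p2 (@is_derive_ln_comp R (fun x => x + t) r _ rt0 drt).
have d3 := is_derive_cmul_comp p3 (@is_derive_ln_comp R (fun x => x + t - tau) r _ rtau0 drtau).
have d4 := is_derive_cmul_comp p4
  (is_derive_mul_comp (is_derive_id r (1 : R)) (is_derive_const t^-1 r)).
apply: (is_derive_eq (is_derive_add_comp (is_derive_const C r) (is_derive_add_comp
  (is_derive_const (p1 * ln t) r)
  (is_derive_add_comp d2 (is_derive_add_comp d3 (is_derive_add_comp d4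
  (is_derive_const (p5 * ln (theta t)) r))))))).
by rewrite /ansatz_r !add0r !addr0 mulr0 add0r !mulr1.
Qed.

Lemma is_derive_ansatz_rr (r t : R) : ansatz_dom r t ->
  is_derive r (1 : R) (fun r => ansatz_r r t) (ansatz_rr r t).
Proof.
move=> [t0 rt0 rtau th0].
have drt := is_derive_add_comp (is_derive_id r (1 : R)) (is_derive_const t r).
have drtau := is_derive_add_comp drt (is_derive_const (- tau) r).
have rtau0 : r + t - tau != 0 by rewrite gt_eqF// subr_gt0.
have d2 := is_derive_cmul_comp p2 (@is_derive_inv_comp R (fun x => x + t) r _ (lt0r_neq0 rt0) drt).
have d3 := is_derive_cmul_comp p3 (@is_derive_inv_comp R (fun x => x + t - tau) r _ rtau0 drtau).
apply: (is_derive_eq (is_derive_add_comp d2 (is_derive_add_comp d3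
  (is_derive_const (p4 * t^-1) r)))).
by rewrite /ansatz_rr !addr0 !mulr1.
Qed.

Variables (N : nat) (a : 'rV[R]_N).
Notation spacetime := ('rV[R]_N * R)%type.

Lemma radial_theta_continuous (y : spacetime) : 0 < y.2 ->
  {for y, continuous (fun y : spacetime => theta y.2)}.
Proof.
move=> t0; apply: cvgD; first exact: cvg_cst.
apply: cvgM; first exact: cvg_cst.
apply: cvgB; last exact: cvg_cst.
apply: (@continuous_comp _ _ _ (crd None) (@ln R)); first exact: crd_continuous.
exact: continuous_ln.
Qed.

Lemma ansatz_continuous (y : spacetime) : ansatz_dom (sqdist a y) y.2 -> [/\
  {for y, continuous (radial a ansatz)}, {for y, continuous (radial a ansatz_t)},
  {for y, continuous (radial a ansatz_r)} & {for y, continuous (radial a ansatz_rr)}].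
Proof.
move=> [t0 rt0 rtau th0].
have ct : {for y, continuous (fun y : spacetime => y.2)} by exact: (@crd_continuous R N None).
have cr : {for y, continuous (fun y : spacetime => sqdist a y)} by exact: sqdist_continuous.
have crt : {for y, continuous (fun y : spacetime => sqdist a y + y.2)}.
  by apply: cvgD; [exact: cr|exact: ct].
have crtau : {for y, continuous (fun y : spacetime => sqdist a y + y.2 - tau)}.
  by apply: cvgB; [exact: crt|exact: cvg_cst].
have cth := radial_theta_continuous t0.
have tau0 : 0 < sqdist a y + y.2 - tau by rewrite subr_gt0.
have clnc (f : spacetime -> R) : {for y, continuous f} -> 0 < f y ->
    {for y, continuous (fun y => ln (f y))}.
  by move=> cf f0; apply: (@continuous_comp _ _ _ f (@ln R)) => //; exact: continuous_ln.
have cinv (f : spacetime -> R) : {for y, continuous f} -> 0 < f y ->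
    {for y, continuous (fun y => (f y)^-1)}.
  by move=> cf f0; apply: cvgV => //; rewrite gt_eqF.
have csq (f : spacetime -> R) : {for y, continuous f} ->
    {for y, continuous (fun y => (f y) ^+ 2)}.
  move=> cf; rewrite (_ : (fun y => _) = (fun y => f y * f y)); first exact: (cvgM cf cf).
  by apply/funext => x; rewrite expr2.
have cmul (k : R) (f : spacetime -> R) : {for y, continuous f} ->
    {for y, continuous (fun y => k * f y)}.
  by move=> cf; apply: cvgM cf; exact: cvg_cst.
have copp (f : spacetime -> R) : {for y, continuous f} ->
    {for y, continuous (fun y => - f y)}.
  by move=> cf; exact: cvgN cf.
have cadd (f g : spacetime -> R) : {for y, continuous f} -> {for y, continuous g} ->
    {for y, continuous (fun y => f y + g y)}.
  by move=> cf cg; exact: cvgD cf cg.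
have cmulf (f g : spacetime -> R) : {for y, continuous f} -> {for y, continuous g} ->
    {for y, continuous (fun y => f y * g y)}.
  by move=> cf cg; exact: cvgM cf cg.
have ccst (k : R) : {for y, continuous (fun _ : spacetime => k)}.
  by exact: cvg_cst.
have iv1 := cinv _ ct t0; have iv2 := cinv _ crt rt0; have iv3 := cinv _ crtau tau0.
have iv4 := cinv _ cth th0.
have ln1 := clnc _ ct t0; have ln2 := clnc _ crt rt0; have ln3 := clnc _ crtau tau0.
have ln4 := clnc _ cth th0.
split.
- exact: (cadd _ _ (ccst C) (cadd _ _ (cmul p1 _ ln1) (cadd _ _ (cmul p2 _ ln2)
    (cadd _ _ (cmul p3 _ ln3) (cadd _ _ (cmul p4 _ (cmulf _ _ cr iv1)) (cmul p5 _ ln4)))))).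
- exact: (cadd _ _ (cmul p1 _ iv1) (cadd _ _ (cmul p2 _ iv2) (cadd _ _ (cmul p3 _ iv3)
    (cadd _ _ (cmul p4 _ (cmulf _ _ cr (copp _ (csq _ iv1))))
      (cmul p5 _ (cmulf _ _ iv4 (cmul c _ iv1))))))).
- exact: (cadd _ _ (cmul p2 _ iv2) (cadd _ _ (cmul p3 _ iv3) (cmul p4 _ iv1))).
- exact: (cadd _ _ (cmul p2 _ (copp _ (csq _ iv2))) (cmul p3 _ (copp _ (csq _ iv3)))).
Qed.

Definition ansatz_exponent := @heat_exponent R N ansatz_t ansatz_r ansatz_rr.

Lemma ansatz_C12 (y : spacetime) : ansatz_dom (sqdist a y) y.2 ->
  C12_at (fun y => expR (radial a ansatz y)) (exp_t a ansatz ansatz_t)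
    (exp_xx a ansatz ansatz_r ansatz_rr) y /\
  {for y, continuous (fun y => exp_t a ansatz ansatz_t y - \sum_i exp_xx a ansatz ansatz_r ansatz_rr i y)}.
Proof.
move=> dom; have [c1 c2 c3 c4] := ansatz_continuous dom; have [t0 rt0 rtau th0] := dom.
split.
  apply: C12_exp => //; [exact: is_derive_ansatz_t| |exact: is_derive_ansatz_rr].
  have cid : {for sqdist a y, continuous (fun r : R => r + y.2)}.
    by apply: cvgD; [exact: cvg_id|exact: cvg_cst].
  have h1 := cvgr_gt _ cid _ rt0; have h2 := cvgr_gt _ cid _ rtau.
  near=> r; apply: is_derive_ansatz_r; split => //; near: r; [exact: h1|exact: h2].
rewrite (_ : (fun y => _ - _) = (fun y => expR (radial a ansatz y) * radial a ansatz_exponent y));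
  last by apply/funext => x; exact: exp_operator.
apply: cvgM.
  by apply: (@continuous_comp _ _ _ (radial a ansatz) (@expR R)); [exact: c1|exact: continuous_expR].
rewrite /ansatz_exponent /heat_exponent /radial.
have cr : {for y, continuous (fun y : spacetime => sqdist a y)} by exact: sqdist_continuous.
apply: cvgB; last by apply: cvgM; [exact: cvg_cst|exact: c3].
apply: cvgB; first exact: c2.
apply: cvgM; first by apply: cvgM; [exact: cvg_cst|exact: cr].
apply: cvgD; last exact: c4.
rewrite expr2; under [X in X @ _]eq_fun do rewrite expr2.
exact: (cvgM c3 c3).
Unshelve. all: by end_near. Qed.

End Ansatz.

(** * Supersolution inequalities for the two barriers *)

Section BarrierInequalities.
Context {R : realType}.
Variables (N : nat) (hN : (0 < N)%N) (alpha q : R).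
Hypotheses (halpha : -1 < alpha) (hq : q_crit alpha N <= q).

Let n : R := N%:R.
Let n0 : 0 < n. Proof. by rewrite ltr0n. Qed.

(** The scaling form of criticality: $t^\alpha (t^{-N/2})^{q-1} \ge 1/t$ for $t \le 1$. *)
Lemma q_crit_mass : 1 + alpha <= n / 2 * (q - 1).
Proof.
move: hq; rewrite /q_crit -lerBrDl ler_pdivrMr// -/n; lra.
Qed.

Lemma q_gt1 : 1 < q.
Proof.
apply: lt_le_trans hq; rewrite /q_crit ltrDl divr_gt0 ?ltr0n// mulr_gt0//.
move: halpha; lra.
Qed.

(* Any [kexp > 0] with [0 <= alpha + kexp (q - 1)] would do; the powers
   [t^kexp (r + t)^(- mexp)] scale like the heat kernel. *)
Definition kexp : R := 1 + `|alpha| / (q - 1).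
Definition mexp : R := n / 2 + kexp.

Lemma kexp_gt0 : 0 < kexp.
Proof. by rewrite /kexp ltr_pwDl// divr_ge0// subr_ge0 ltW// q_gt1. Qed.

Lemma mexp_gt0 : 0 < mexp.
Proof. by rewrite /mexp addr_gt0 ?divr_gt0 ?kexp_gt0. Qed.

(** For [w] proportional to $t^k$, the power of $t$ in $t^\alpha w^{q-1}$ is nonnegative, so a lower
    bound on $t$ bounds the absorption from below. *)
Lemma kexp_alpha : 0 <= alpha + kexp * (q - 1).
Proof.
have q1 : 0 < q - 1 by rewrite subr_gt0 q_gt1.
rewrite /kexp mulrDl mul1r divfK ?gt_eqF//.
have := ler_norm (- alpha); rewrite normrN; lra.
Qed.

Notation k := kexp.
Notation m := mexp.

(* [-2 m ln (rho - tau)] makes the barrier blow up on the paraboloid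
   [rho = tau], where [rho = r + t]. *)
Definition blowup Lam tau := ansatz Lam k m (- (2 * m)) 0 0 tau 0 0.

(** The factor $t^k$ contributes $k/t$. The unfavourable terms are controlled by
    $\rho/(\rho-\tau)^2$, because $r \le \rho$ and $1/\rho \le 1/(\rho-\tau) \le
    \rho/(\rho-\tau)^2$. *)
Lemma blowup_exponent tau r t : 0 < tau -> 0 <= r -> 0 < t -> tau < r + t ->
  k / t - (10 * m + 16 * m ^+ 2) * ((r + t) / (r + t - tau) ^+ 2) <=
  @ansatz_exponent R k m (- (2 * m)) 0 0 tau 0 0 N r t.
Proof.
move=> tau0 r0 t0 rtau; have m0 := mexp_gt0.
have rh0 : 0 < r + t by rewrite ltr_wpDl.
have s0 : 0 < r + t - tau by rewrite subr_gt0.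
rewrite /ansatz_exponent /heat_exponent /ansatz_t /ansatz_r /ansatz_rr -exprVn.
rewrite !mul0r !addr0 -/n.
set X := (r + t)^-1; set Y := (r + t - tau)^-1.
have X0 : 0 <= X by rewrite invr_ge0 ltW.
have Y0 : 0 < Y by rewrite invr_gt0.
have XY : X <= Y by rewrite lef_pV2 ?posrE//; lra.
have sY : (r + t - tau) * Y = 1 by rewrite mulfV// gt_eqF.
have YY : Y <= (r + t) * Y ^+ 2.
  have : (r + t - tau) * Y * Y <= (r + t) * Y * Y.
    by rewrite !ler_wpM2r ?(ltW Y0)//; lra.
  by rewrite sY mul1r -mulrA -expr2.
have h1 : 0 <= - (2 * n * (m * X + - (2 * m) * Y)).
  have : 0 <= 2 * n * m * (2 * Y - X).
    rewrite mulr_ge0//; last lra.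
    by rewrite !mulr_ge0// ltW.
  lra.
have h2 : 4 * r * ((m * X + - (2 * m) * Y) ^+ 2 +
    (m * - X ^+ 2 + - (2 * m) * - Y ^+ 2)) <=
    (8 * m + 16 * m ^+ 2) * ((r + t) * Y ^+ 2).
  have a1 : (m * X + - (2 * m) * Y) ^+ 2 <= 4 * m ^+ 2 * Y ^+ 2.
    have -> : (m * X + - (2 * m) * Y) ^+ 2 = m ^+ 2 * (2 * Y - X) ^+ 2 by ring.
    have -> : 4 * m ^+ 2 * Y ^+ 2 = m ^+ 2 * (2 * Y) ^+ 2 by ring.
    rewrite ler_wpM2l ?sqr_ge0// lerXn2r ?nnegrE; lra.
  have a2 : m * - X ^+ 2 + - (2 * m) * - Y ^+ 2 <= 2 * m * Y ^+ 2.
    have : 0 <= m * X ^+ 2 by rewrite mulr_ge0 ?sqr_ge0// ltW.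
    lra.
  have a3 : 4 * r * ((m * X + - (2 * m) * Y) ^+ 2 +
      (m * - X ^+ 2 + - (2 * m) * - Y ^+ 2)) <=
      4 * r * ((4 * m ^+ 2 + 2 * m) * Y ^+ 2).
    rewrite ler_wpM2l ?mulr_ge0//; lra.
  apply: (le_trans a3).
  have : 0 <= 4 * t * ((4 * m ^+ 2 + 2 * m) * Y ^+ 2).
    have c0 : 0 <= 4 * m ^+ 2 + 2 * m by rewrite addr_ge0 ?mulr_ge0 ?sqr_ge0// ltW.
    by rewrite (mulr_ge0 (mulr_ge0 _ (ltW t0)) (mulr_ge0 c0 (sqr_ge0 _))).
  lra.
have h3 : 0 <= m * X by rewrite mulr_ge0// ltW.
have h4 : m * Y <= m * ((r + t) * Y ^+ 2) by rewrite ler_wpM2l// ltW.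
lra.
Qed.

(** Let $P=\rho/(\rho-\tau)^2$, which is at least 1 as $\rho\le 1$. If $CP \le k/t$, the term $k/t$
    suffices. Otherwise $t > (k/C)P^{-1}$; the barrier being $t^kP^m$ up to a constant, the
    absorption rate is at least a constant times $P^{m(q-1)-\alpha-k(q-1)}$, and this exponent is at
    least 1 by criticality. *)
Lemma blowup_super : exists Lam, forall tau r t,
  0 < tau -> 0 <= r -> 0 < t -> tau < r + t -> r + t <= 1 ->
  0 <= @ansatz_exponent R k m (- (2 * m)) 0 0 tau 0 0 N r t +
    expR (alpha * ln t + (q - 1) * blowup Lam tau r t).
Proof.
have q1 : 0 < q - 1 by rewrite subr_gt0 q_gt1.
have m0 := mexp_gt0; have k0 := kexp_gt0; have ka := kexp_alpha.
pose C := 10 * m + 16 * m ^+ 2.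
have C0 : 0 < C by rewrite addr_gt0 ?mulr_gt0// exprn_gt0.
pose kap := alpha + k * (q - 1).
(* With this value the constant in front of the power of $P$ is exactly [C]. *)
pose Lam := (ln C - kap * ln (k / C)) / (q - 1).
exists Lam => tau r t tau0 r0 t0 rtau rt1.
have := blowup_exponent tau0 r0 t0 rtau.
set E := ansatz_exponent _ _ _ _ _ _ _ _ _ _ _; rewrite -/C => hE.
have s0 : 0 < r + t - tau by rewrite subr_gt0.
have rh0 : 0 < r + t by rewrite ltr_wpDl.
set s := r + t - tau in hE s0 *; set rh := r + t in hE rh0 rt1 *.
have srh : s <= rh by rewrite /s -/rh; lra.
pose lP := 2 * ln s - ln rh.
have PE : expR (- lP) = rh / s ^+ 2.
  rewrite /lP opprB expRD lnK ?posrE// expRN.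
  by rewrite -[2 * _]/(2%:R * _) expRM_natl lnK ?posrE.
have lnsrh : ln s <= ln rh by rewrite ler_ln ?posrE.
have lnrh : ln rh <= 0 by rewrite -(ln1 R) ler_ln ?posrE.
have [h|h] := lerP (C * (rh / s ^+ 2)) (k / t).
  by rewrite addr_ge0 ?expR_ge0//; apply: le_trans hE; rewrite subr_ge0.
suff hs : C * (rh / s ^+ 2) <= expR (alpha * ln t + (q - 1) * blowup Lam tau r t).
  have k1 := divr_ge0 (ltW k0) (ltW t0).
  by have := lerD hE hs; rewrite subrK; exact: le_trans k1.
have lt : ln (k / C) + lP <= ln t.
  have : ln (k / t) <= ln (C * (rh / s ^+ 2)).
    rewrite ler_ln ?posrE ?divr_gt0//; first exact: ltW.
    by rewrite mulr_gt0// divr_gt0// exprn_gt0.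
  rewrite -PE !lnM ?posrE ?expR_gt0 ?invr_gt0// !lnV ?posrE// expRK; lra.
rewrite -PE -[C in X in X <= _](lnK (x := C)) ?posrE// -expRD ler_expR.
rewrite /blowup /ansatz mul0r mul0r !addr0 -/s -/rh.
have E1 : (q - 1) * Lam = ln C - kap * ln (k / C).
  by rewrite /Lam mulrC divfK// gt_eqF.
have kl : kap * (ln (k / C) + lP) <= kap * ln t by rewrite ler_wpM2l.
have mass := q_crit_mass.
have lP0 : lP <= 0 by rewrite /lP; lra.
have e1 : 0 <= (kap - m * (q - 1) + 1) * lP.
  by rewrite mulr_le0//; rewrite /kap /mexp; lra.
rewrite -subr_ge0.
have -> : alpha * ln t + (q - 1) * (Lam + (k * ln t + (m * ln rh + - (2 * m) * ln s)))
    - (ln C - lP) = kap * ln t + (q - 1) * Lam - m * (q - 1) * lP - ln C + lP.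
  by rewrite /kap /lP; ring.
rewrite E1; lra.
Qed.


Definition pexp : R := (q - 1)^-1.
Notation p := pexp.

Lemma pexp_gt0 : 0 < p.
Proof. by rewrite invr_gt0 subr_gt0 q_gt1. Qed.

(** The heat kernel solves the heat equation, so only the derivative of [theta] remains. *)
Lemma decay_exponent1 c l r t : 0 < t ->
  @ansatz_exponent R (- (n / 2)) 0 0 (- 4^-1) (- p) 0 c l N r t =
  - (p * (c * (t^-1 * (theta c l t)^-1))).
Proof.
move=> t0; rewrite /ansatz_exponent /heat_exponent /ansatz_t /ansatz_r /ansatz_rr -/n.
move: (t^-1) ((theta c l t)^-1) => X Z.
have -> : (2 : R)^-1 = 2 * 4^-1 by field.
have E : 1 - 4 * (4 : R)^-1 = 0 by rewrite mulfV ?subrr.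
transitivity (- (p * (c * (X * Z))) + 4^-1 * r * X ^+ 2 * (1 - 4 * 4^-1)).
  by move: (4^-1) => v; ring.
by rewrite E mulr0 addr0.
Qed.

(** Apart from the cost of [theta], every negative term carries the factor [t / (r + t)]; far
    outside the parabola, and for small [c], the positive [k] wins. *)
Lemma decay_exponent2 c l r t : 0 < c -> 0 <= r -> 0 < t -> 1 <= theta c l t ->
  k - (m + 4 * (m ^+ 2 + m)) * (t / (r + t)) - (p + 1) * c <=
  t * @ansatz_exponent R k (- m) 0 0 (- (p + 1)) 0 c l N r t.
Proof.
move=> c0 r0 t0 th1; have m0 := mexp_gt0; have p0 := pexp_gt0.
have rt0 : 0 < r + t by rewrite ltr_wpDl.
rewrite /ansatz_exponent /heat_exponent /ansatz_t /ansatz_r /ansatz_rr -/n.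
set Z := (r + t)^-1; set W := (theta c l t)^-1.
have W1 : W <= 1 by rewrite invf_le1// (lt_le_trans ltr01).
have Z0 : 0 < Z by rewrite invr_gt0.
have rZ : r * Z <= 1 by rewrite ler_pdivrMr// mul1r lerDl ltW.
have tX : t * t^-1 = 1 by rewrite mulfV// gt_eqF.
have -> : t * (k / t + (- m * Z + (0 * (r + t - 0)^-1 + (0 * (r * - t^-1 ^+ 2) +
      - (p + 1) * (W * (c / t))))) -
    4 * r * ((- m * Z + (0 * (r + t - 0)^-1 + 0 / t)) ^+ 2 +
     (- m * - Z ^+ 2 + 0 * - (r + t - 0)^-1 ^+ 2)) -
    2 * n * (- m * Z + (0 * (r + t - 0)^-1 + 0 / t))) =
  (t * t^-1) * k - m * (t * Z) - (p + 1) * (W * c * (t * t^-1))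
    - 4 * (m ^+ 2 + m) * (r * Z) * (t * Z) + 2 * n * m * (t * Z) by ring.
rewrite tX mul1r mulr1.
have tZ0 : 0 <= t * Z by rewrite mulr_ge0// ltW.
have h1 : (p + 1) * (W * c) <= (p + 1) * c.
  by rewrite ler_wpM2l ?addr_ge0 ?(ltW p0)// ler_piMl// ltW.
have m2 : 0 <= 4 * (m ^+ 2 + m).
  by rewrite mulr_ge0// addr_ge0 ?sqr_ge0// ltW.
have h2 : 4 * (m ^+ 2 + m) * (r * Z) * (t * Z) <= 4 * (m ^+ 2 + m) * (t * Z).
  by rewrite ler_wpM2r// ler_piMr.
have h3 : 0 <= 2 * n * m * (t * Z) by rewrite !mulr_ge0// ltW.
lra.
Qed.

(** [ln x <= x - 1] at [x = (1 + Y) / (4 * m)], scaled to have slope 1/4, the rate at which the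
    logarithm of the heat kernel decreases in [Y = r / t]. *)
Lemma ln1D_le (Y : R) : 0 <= Y -> m * ln (1 + Y) <= Y / 4 + (m * ln (4 * m) + 4^-1).
Proof.
move=> Y0; have m0 := mexp_gt0; have m4 : 0 < 4 * m by rewrite mulr_gt0.
have x0 : 0 < (1 + Y) / (4 * m) by rewrite divr_gt0// ltr_wpDr.
have E : 1 + Y = (4 * m) * ((1 + Y) / (4 * m)) by rewrite mulrC divfK// gt_eqF.
have h : ln ((1 + Y) / (4 * m)) <= (1 + Y) / (4 * m) - 1.
  have := @le_ln1Dx R ((1 + Y) / (4 * m) - 1).
  by rewrite addrCA subrr addr0; apply; lra.
have mh : m * ln ((1 + Y) / (4 * m)) <= m * ((1 + Y) / (4 * m) - 1) by rewrite ler_wpM2l// ltW.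
have e : m * ((1 + Y) / (4 * m) - 1) = (1 + Y) / 4 - m by field; rewrite gt_eqF.
rewrite {1}E lnM ?posrE// mulrDr; move: mh; rewrite e; lra.
Qed.

(** Here [Y] stands for [r / t]. For large [Y] the middle term is positive and covers [p * c],
    because the ratio of the tail to the Gaussian is bounded below. For bounded [Y] it may be
    negative, but the last term, the absorption, is as large as desired with [a]. The choice of [c]
    comes after that of [a], so there is no circularity. *)
Lemma decay_bracket b C : 0 < C -> exists a c, [/\ 0 < c & forall Y, 0 <= Y ->
  0 <= - (p * c) + expR (b - a - m * ln (1 + Y) + Y / 4) *
        (k - C / (1 + Y) - (p + 1) * c) + expR ((q - 1) * (a - Y / 4))].
Proof.
move=> C0; have m0 := mexp_gt0; have p0 := pexp_gt0; have k0 := kexp_gt0.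
have q1 : 0 < q - 1 by rewrite subr_gt0 q_gt1.
pose c1 := m * ln (4 * m) + 4^-1.
pose y0 := 2 * C / k.
(* [A] bounds the negative terms for [Y <= y0], and [a] is taken so large that the absorption is at
   least [A] there. *)
pose A := expR (y0 / 4) * (C + k) + k.
have A0 : 0 < A by rewrite addr_gt0// mulr_gt0 ?expR_gt0// addr_gt0.
pose a := Num.max b (y0 / 4 + ln A / (q - 1)).
have ba : b <= a by rewrite le_max lexx.
have aA : y0 / 4 + ln A / (q - 1) <= a by rewrite le_max lexx orbT.
(* The minimum secures that the bracket keeps [k / 4] when [C / (1 + Y) <= k / 2], and that the tail
   then covers [p * c]. *)
pose c := k / 4 * Num.min 1 (expR (b - a - c1)) / (p + 1).
have p10 : 0 < p + 1 by rewrite addr_gt0.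
have pc : (p + 1) * c = k / 4 * Num.min 1 (expR (b - a - c1)).
  by rewrite mulrC divfK// gt_eqF.
have c0 : 0 < c by rewrite !divr_gt0// mulr_gt0 ?divr_gt0// lt_min ltr01 expR_gt0.
have pc1 : (p + 1) * c <= k / 4.
  by rewrite pc ler_piMr ?divr_ge0 ?(ltW k0)// ge_min lexx.
have pc2 : (p + 1) * c <= k / 4 * expR (b - a - c1).
  by rewrite pc ler_wpM2l ?divr_ge0 ?(ltW k0)// ge_min lexx orbT.
exists a, c; split=> // Y Y0.
have Y1 : 0 < 1 + Y by rewrite ltr_pwDl.
have lY0 : 0 <= m * ln (1 + Y) by rewrite mulr_ge0 ?(ltW m0)// ln_ge0// lerDl.
set G := expR (b - a - _ + _); set B := expR ((q - 1) * _).
have [h|h] := lerP (C / (1 + Y)) (k / 2).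
  have GE : expR (b - a - c1) <= G.
    by rewrite ler_expR; have := ln1D_le Y0; rewrite -/c1; lra.
  have : k / 4 * expR (b - a - c1) <= G * (k - C / (1 + Y) - (p + 1) * c).
    by rewrite mulrC ler_pM ?expR_ge0 ?divr_ge0 ?(ltW k0)//; lra.
  have : 0 < B by exact: expR_gt0.
  lra.
have Yy : Y <= y0.
  have : 1 + Y <= y0.
    move: h; rewrite ltr_pdivlMr// => h.
    rewrite /y0 ler_pdivlMr//; lra.
  lra.
have GE : G <= expR (y0 / 4) by rewrite ler_expR; lra.
have CY : C / (1 + Y) <= C by rewrite ler_pdivrMr// ler_peMr ?(ltW C0)// lerDl.
have GF : - (expR (y0 / 4) * (C + k)) <= G * (k - C / (1 + Y) - (p + 1) * c).
  rewrite -mulrN (@le_trans _ _ (G * - (C + k)))//.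
    by rewrite !mulrN lerN2 ler_wpM2r// addr_ge0// ltW.
  by rewrite ler_wpM2l ?expR_ge0//; lra.
have AB : A <= B.
  rewrite -(lnK (x := A)) ?posrE// ler_expR.
  have : (q - 1) * (ln A / (q - 1)) <= (q - 1) * (a - Y / 4).
    by rewrite ler_wpM2l ?(ltW q1)//; lra.
  by rewrite [X in X <= _]mulrC divfK ?gt_eqF.
move: AB; rewrite /A; lra.
Qed.

(* [decay1] is the heat kernel times [theta^(- p)]. The decay of
   [theta] costs a negative term, paid by the absorption where [|x - a|^2 <= C t]
   and by the polynomial tail [decay2] farther out. *)
Definition decay1 a c l := ansatz a (- (n / 2)) 0 0 (- 4^-1) (- p) 0 c l.
Definition decay2 b c l := ansatz b k (- m) 0 0 (- (p + 1)) 0 c l.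

(** After multiplication by [t] the terms share the factor [E0], a Gaussian times $\theta^{-p-1}$:
    the derivative of $\theta^{-p}$ yields it, the tail is given it, and $\theta^{-pq}$ equals it in
    the absorption. The constants do not depend on [l], the logarithm of the starting time. *)
Lemma decay_super b : exists a c, 0 < c /\ forall l r t,
  0 <= r -> 0 < t -> t <= 1 -> l <= ln t ->
  0 <= expR (decay1 a c l r t) *
         @ansatz_exponent R (- (n / 2)) 0 0 (- 4^-1) (- p) 0 c l N r t +
       expR (decay2 b c l r t) *
         @ansatz_exponent R k (- m) 0 0 (- (p + 1)) 0 c l N r t +
       expR (alpha * ln t + q * decay1 a c l r t).
Proof.
have m0 := mexp_gt0; have p0 := pexp_gt0; have k0 := kexp_gt0.
have q1 : 0 < q - 1 by rewrite subr_gt0 q_gt1.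
pose C := m + 4 * (m ^+ 2 + m).
have C0 : 0 < C by rewrite addr_gt0// mulr_gt0// addr_gt0// exprn_gt0.
have [a [c [c0 hac]]] := decay_bracket b C0.
exists a, c; split=> // l r t r0 t0 t1 lt.
have th1 : 1 <= theta c l t.
  by rewrite /theta lerDl mulr_ge0 ?subr_ge0// ltW.
have rt0 : 0 < r + t by rewrite ltr_wpDl.
pose Y := r / t; have Y0 : 0 <= Y by rewrite divr_ge0// ltW.
have Y1 : 0 < 1 + Y by rewrite ltr_pwDl.
have rtE : r + t = t * (1 + Y) by rewrite mulrDr mulr1 mulrC divfK ?gt_eqF// addrC.
have lnrt : ln (r + t) = ln t + ln (1 + Y) by rewrite rtE lnM ?posrE.
have th0 : 0 < theta c l t by exact: lt_le_trans th1.
pose h := ln (theta c l t).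
have h0 : 0 <= h by rewrite ln_ge0.
have lnt0 : ln t <= 0 by rewrite -(ln1 R) ler_ln ?posrE.
pose E0 := expR (a - (p + 1) * h - n / 2 * ln t - Y / 4).
pose G := expR (b - a - m * ln (1 + Y) + Y / 4).
pose B := expR ((q - 1) * (a - Y / 4)).
have e1 : expR (decay1 a c l r t) * (theta c l t)^-1 = E0.
  rewrite -[(theta c l t)^-1](lnK (x := _^-1)) ?posrE ?invr_gt0// lnV ?posrE// -/h -expRD.
  by congr expR; rewrite /decay1 /ansatz -/h -/Y; ring.
have e2 : expR (decay2 b c l r t) = E0 * G.
  rewrite /E0 /G -expRD; congr expR.
  rewrite /decay2 /ansatz -/h lnrt /mexp; lra.
have e3 : E0 * B <= t * expR (alpha * ln t + q * decay1 a c l r t).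
  rewrite -[in X in _ <= X * _](lnK (x := t)) ?posrE// /E0 /B -!expRD ler_expR.
  have d1E : decay1 a c l r t = a - p * h - n / 2 * ln t - Y / 4.
    by rewrite /decay1 /ansatz -/h -/Y; ring.
  have pq : p * (q - 1) = 1 by rewrite mulVf// gt_eqF.
  have mass := q_crit_mass.
  (* Criticality and [t <= 1] make both factors nonpositive. *)
  have a1 : 0 <= (1 + alpha - n / 2 * (q - 1)) * ln t.
    by rewrite mulr_le0//; lra.
  have a2 : ln t + (alpha * ln t + q * (a - p * h - n / 2 * ln t - Y / 4)) =
     (a - (p + 1) * h - n / 2 * ln t - Y / 4) + (q - 1) * (a - Y / 4)
     + (1 + alpha - n / 2 * (q - 1)) * ln t + (1 - p * (q - 1)) * h by ring.
  rewrite d1E a2 pq subrr mul0r addr0; lra.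
have := decay_exponent2 c0 r0 t0 th1; rewrite -/C.
set X2 := ansatz_exponent _ _ _ _ _ _ _ _ _ _ _ => hX2.
rewrite decay_exponent1// -(pmulr_rge0 _ t0).
have tr : t / (r + t) = (1 + Y)^-1 by rewrite rtE invfM mulrA mulfV ?mul1r// gt_eqF.
rewrite tr in hX2.
have G0 : 0 < E0 * G by rewrite mulr_gt0 ?expR_gt0.
have f2 := ler_wpM2l (ltW G0) hX2.
have f0 : 0 <= E0 * (- (p * c) + G * (k - C / (1 + Y) - (p + 1) * c) + B).
  by rewrite mulr_ge0 ?expR_ge0//; exact: hac.
rewrite e2.
have tX : t * t^-1 = 1 by rewrite mulfV// gt_eqF.
have -> : t * (expR (decay1 a c l r t) * - (p * (c * (t^-1 / theta c l t))) +
   E0 * G * X2 + expR (alpha * ln t + q * decay1 a c l r t)) =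
   - (p * c) * (t * t^-1) * (expR (decay1 a c l r t) * (theta c l t)^-1) +
   E0 * G * (t * X2) + t * expR (alpha * ln t + q * decay1 a c l r t) by ring.
rewrite tX e1; lra.
Qed.

End BarrierInequalities.

(** * Comparison near the singularity *)

Section Reflection.
Context {R : realType}.

(* No integrability is needed: when both parts are infinite the integral
   is [fine -oo = 0] for [f] and for [- f]. *)
Lemma RintegralN_uncond d (T : measurableType d) (mu : {measure set T -> \bar R})
    (f : T -> R) :
  \int[mu]_x (- f x) = - \int[mu]_x f x.
Proof.
rewrite /Rintegral integralE [in RHS]integralE.
have -> : ((fun x => (- f x)%:E)^\+ = (fun x => (f x)%:E)^\-)%E.
  by rewrite -funeposN; congr (_^\+)%E; apply/funext.
have -> : ((fun x => (- f x)%:E)^\- = (fun x => (f x)%:E)^\+)%E.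
  by rewrite -funenegN; congr (_^\-)%E; apply/funext.
have P0 : (0 <= \int[mu]_x ((fun x => (f x)%:E)^\+ x))%E by exact: integral_ge0.
have N0 : (0 <= \int[mu]_x ((fun x => (f x)%:E)^\- x))%E by exact: integral_ge0.
case: (integral mu _ _) P0 => [x||] //; case: (integral mu _ _) N0 => [y||] //= _ _;
  by rewrite ?oppr0 ?opprB.
Qed.

Lemma space_integralN n (f : 'rV[R]_n -> R) :
  space_integral (fun x => - f x) = - space_integral f.
Proof.
elim: n f => [|n IH] f //=.
by rewrite -RintegralN_uncond; apply: eq_Rintegral => s _; rewrite -IH.
Qed.

Lemma spacetime_integralN N (F : 'rV[R]_N * R -> R) :
  spacetime_integral (fun z => - F z) = - spacetime_integral F.
Proof.
rewrite /spacetime_integral -RintegralN_uncond.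
by apply: eq_Rintegral => s _; rewrite -space_integralN.
Qed.

Lemma weak_heatN N (Omega : set 'rV[R]_N) T (U F : 'rV[R]_N * R -> R) :
  weak_heat Omega T U F ->
  weak_heat Omega T (fun z => - U z) (fun z => - F z).
Proof.
move=> h phi /h; set G := fun _ => _ => hG.
rewrite [LHS](_ : _ = spacetime_integral (fun z => - G z)).
  by rewrite spacetime_integralN hG oppr0.
by congr spacetime_integral; apply/funext => z; rewrite /G; ring.
Qed.

End Reflection.

Section Nonlinearity.
Context {R : realType} {N : nat}.
Notation spacetime := ('rV[R]_N * R)%type.
Variables (alpha q : R).

Definition absorption (U : spacetime -> R) z := z.2 `^ alpha * `|U z| `^ (q - 1) * U z.

Lemma absorptionN U z : absorption (fun z => - U z) z = - absorption U z.
Proof. by rewrite /absorption normrN mulrN. Qed.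

Hypothesis q1 : 1 < q.

Lemma power_continuous : continuous (fun s : R => `|s| `^ (q - 1) * s).
Proof.
move=> s; have [->|s0] := eqVneq s 0.
  apply/cvgrPdist_lt => e e0.
  have hn : \forall x \near (0 : R), `|x| < Num.min e 1.
    by apply: (@nbhs0_lt R R); rewrite lt_min e0 ltr01.
  near=> x; rewrite mulr0 sub0r normrN normrM ger0_norm ?powR_ge0//.
  have : `|x| < Num.min e 1 by near: x; exact: hn.
  rewrite lt_min => /andP[xe x1].
  apply: le_lt_trans xe; rewrite ler_piMl//.
  apply: (@le_trans _ _ (1 `^ (q - 1))); last by rewrite powR1.
  by rewrite ge0_ler_powR// ?nnegrE// ?subr_ge0 ltW.
apply: cvgM; last exact: cvg_id.
have e0 : 0 < `|s| by rewrite normr_gt0.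
have c1 : {for s, continuous (fun x : R => expR ((q - 1) * ln `|x|))}.
  apply: (@continuous_comp _ _ _ (fun x : R => (q - 1) * ln `|x|) (@expR R));
    last exact: continuous_expR.
  apply: cvgM; first exact: cvg_cst.
  apply: (@continuous_comp _ _ _ (fun x : R => `|x|) (@ln R)); first exact: norm_continuous.
  exact: continuous_ln.
have E (x : R) : x != 0 -> `|x| `^ (q - 1) = expR ((q - 1) * ln `|x|).
  by move=> x0; rewrite /powR normr_eq0 (negbTE x0).
rewrite E//; apply: cvg_trans c1; apply: near_eq_cvg; near=> x.
rewrite E//; near: x; exact: (@open_neq R 0 s).
Unshelve. all: by end_near. Qed.

Lemma absorption_continuous (U : spacetime -> R) (z : spacetime) : {for z, continuous U} -> 0 < z.2 ->
  {for z, continuous (absorption U)}.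
Proof.
move=> cU z0; rewrite (_ : absorption U =
    (fun z => z.2 `^ alpha * (`|U z| `^ (q - 1) * U z))); last first.
  by apply/funext => y; rewrite /absorption mulrA.
apply: cvgM.
  apply: (@continuous_comp _ _ _ (crd None) (fun s => s `^ alpha)); first exact: crd_continuous.
  apply: differentiable_continuous; apply/derivable1_diffP.
  by apply: derivable_powR; rewrite in_itv/= andbT.
exact: (@continuous_comp _ _ _ U (fun s : R => `|s| `^ (q - 1) * s) _ cU (@power_continuous _)).
Qed.

(** Strictness is gained here, so the explicit barriers themselves only satisfy a non-strict
    inequality. *)
Lemma absorption_gt (U : spacetime -> R) (z : spacetime) (L : R) : 0 < z.2 -> expR L < U z ->
  expR (alpha * ln z.2 + q * L) < absorption U z.
Proof.
move=> z0 LU; have U0 : 0 < U z by exact: lt_trans (expR_gt0 _) LU.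
rewrite /absorption /powR gt_eqF// normr_eq0 [in X in _ < _ * X * _]gt_eqF// gtr0_norm//.
rewrite -[X in _ < _ * X](lnK (x := U z)) ?posrE// -!expRD ltr_expR.
rewrite -addrA ltrD2l -[X in _ < _ + X]mul1r -mulrDl subrK ltr_pM2l ?(lt_trans ltr01)//.
by rewrite -ltr_expR lnK ?posrE.
Qed.

End Nonlinearity.

(** * Compact regions around the singular point *)

Section Regions.
Context {R : realType} {N : nat}.
Notation spacetime := ('rV[R]_N * R)%type.
Variables (a : 'rV[R]_N).

(** One family serves for the comparison regions, with [rlo = 0], and for the lateral boundary, with
    [rlo = R2]. *)
Definition region (R2 rlo lo hi tau : R) : set spacetime := [set y |
  [/\ sqdist a y <= R2, rlo <= sqdist a y, lo <= y.2, y.2 <= hi &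
      tau <= sqdist a y + y.2]].

Lemma compact_region R2 rlo lo hi tau : R2 <= 1 -> 0 <= lo -> hi <= 1 ->
  compact (region R2 rlo lo hi tau).
Proof.
move=> R21 lo0 hi1.
apply: (subclosed_compact _ (@compact_box R N 1 (a, 0))); last first.
  move=> y [h1 _ h2 h3 _] [i|] /=.
    have := le_trans (le_trans (sqdist_coord a y i) h1) R21.
    by move=> h; rewrite -(@ler_pXn2r R 2%N)// ?nnegrE// expr1n real_normK ?num_real.
  by rewrite subr0 ger0_norm (le_trans lo0, le_trans h3).
have cs : continuous (sqdist a : spacetime -> R) := @sqdist_continuous R N a.
have ct : continuous (fun y : spacetime => y.2) := @crd_continuous R N None.
have cst : continuous (fun y : spacetime => sqdist a y + y.2).
  by move=> y; apply: cvgD; [exact: cs|exact: ct].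
have -> : region R2 rlo lo hi tau =
    (sqdist a @^-1` [set s | s <= R2]) `&` ((sqdist a @^-1` [set s | rlo <= s]) `&`
    (((fun y => y.2) @^-1` [set s | lo <= s]) `&` (((fun y => y.2) @^-1` [set s | s <= hi]) `&`
     ((fun y => sqdist a y + y.2) @^-1` [set s | tau <= s])))).
  by apply/seteqP; split=> y; [move=> [? ? ? ? ?]|move=> [? [? [? [? ?]]]]].
by do !apply: closedI; apply: preimage_closed;
  [move=> y _; exact: cs|exact: closed_le|move=> y _; exact: cs|exact: closed_ge
  |move=> y _; exact: ct|exact: closed_ge|move=> y _; exact: ct|exact: closed_le
  |move=> y _; exact: cst|exact: closed_ge].
Qed.

(** The minimum over [K] of [Num.max (eps - U y) y.2] is positive, and half of it is a suitable
    [t1]. *)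
Lemma small_time (K : set spacetime) (U : spacetime -> R) eps : compact K ->
  {within K, continuous U} -> (forall y, K y -> 0 <= y.2) ->
  (forall y, K y -> y.2 = 0 -> U y < eps) ->
  exists2 t1, 0 < t1 & forall y, K y -> y.2 <= t1 -> U y < eps.
Proof.
move=> cK cU K0 U0; have [[y0 Ky0]|nK] := pselect (K !=set0); last first.
  by exists 1 => // y Ky; case: nK; exists y.
have ct : {within K, continuous (fun y : spacetime => y.2)}.
  by apply: continuous_subspaceT; exact: (@crd_continuous R N None).
have cM : {within K, continuous (fun y => Num.max (eps - U y) y.2)}.
  move=> y; apply: (@continuous_max R (subspace K)); last exact: ct.
  by apply: cvgB; [exact: cvg_cst|exact: cU].
have [c] := compact_EVT_min (ex_intro _ y0 Ky0) cK cM.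
rewrite inE => Kc hc; set mu := Num.max _ _ in hc.
have mu0 : 0 < mu.
  rewrite lt_max; have := K0 c Kc; rewrite le_eqVlt => /orP[/eqP/esym/(U0 c Kc)|->].
    by rewrite subr_gt0 => ->.
  by rewrite orbT.
exists (mu / 2); first by rewrite divr_gt0.
move=> y Ky yt; have := hc y; rewrite inE => /(_ Ky); rewrite le_max => /orP[|h].
  by have := mu0; lra.
by have := mu0; lra.
Qed.

End Regions.

(** * Upper bound for a solution near the singular point *)

Section OneSidedBound.
Context {R : realType} {N : nat}.
Notation spacetime := ('rV[R]_N * R)%type.
Variables (hN : (0 < N)%N) (alpha q : R).
Hypotheses (halpha : -1 < alpha) (hq : q_crit alpha N <= q).
Variables (Omega : set 'rV[R]_N) (T : R) (a : 'rV[R]_N) (U : spacetime -> R).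
Hypothesis wU : weak_heat Omega T U (absorption alpha q U).
Hypothesis cU : {within (Omega `*` `[0, T]) `\ (a, 0), continuous U}.
Hypothesis U0 : forall x, Omega x -> x != a -> U (x, 0) = 0.
Variables (R2 T1 T2 eps : R).
Hypotheses (R21 : R2 <= 2^-1) (T12 : T1 < T2) (T2T : T2 <= T)
  (T21 : T2 <= 2^-1) (eps0 : 0 < eps).
Hypothesis RO : forall y : spacetime, sqdist a y <= R2 -> Omega y.1.
Hypothesis lateral : forall y : spacetime, sqdist a y = R2 ->
  0 <= y.2 -> y.2 <= T1 -> U y < eps.

Let q1 : 1 < q := q_gt1 hN halpha hq.
Let R2le1 : R2 <= 1. Proof. by move: R21; lra. Qed.
Let T1le1 : T1 <= 1. Proof. by move: T12 T21; lra. Qed.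
Let T1T : T1 <= T. Proof. by move: T12 T2T; lra. Qed.

Lemma sqdist_eq0 y : sqdist a y = 0 -> y.1 = a.
Proof.
move=> /eqP; rewrite psumr_eq0 => [/allP h|i _]; last exact: sqr_ge0.
apply/rowP => i; apply/eqP; rewrite -subr_eq0 -sqrf_eq0.
by apply: h; rewrite mem_index_enum.
Qed.

Lemma sqdist_center (t : R) : sqdist a (a, t) = 0.
Proof. by apply: big1 => i _ /=; rewrite subrr expr0n. Qed.

Lemma domain_mem (y : spacetime) : sqdist a y <= R2 -> 0 <= y.2 -> y.2 <= T ->
  0 < sqdist a y + y.2 -> ((Omega `*` `[0, T]) `\ (a, 0)) y.
Proof.
move=> h1 h2 h3 h4; split.
  by split; [exact: RO|rewrite /= in_itv/= h2].
by move=> ya; move: h4; rewrite ya sqdist_center/= addr0 ltxx.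
Qed.

Lemma region_domain lo hi tau : 0 <= lo -> hi <= T -> 0 < tau ->
  region a R2 0 lo hi tau `<=` (Omega `*` `[0, T]) `\ (a, 0).
Proof.
move=> lo0 hiT tau0 y [h1 _ h2 h3 h4]; apply: domain_mem => //.
- exact: le_trans h2.
- exact: le_trans hiT.
- exact: lt_le_trans h4.
Qed.

(** Reaches up to [T2], beyond the final time [T1] of the comparison, so that a point at time [T1]
    has a full neighbourhood in it. *)
Definition inner lo tau : set spacetime := [set y |
  [/\ sqdist a y < R2, lo < y.2, y.2 < T2 & tau < sqdist a y + y.2]].

Lemma nbhs_inner lo tau (y : spacetime) : inner lo tau y -> nbhs y (inner lo tau).
Proof.
move=> [h1 h2 h3 h4].
have cs : {for y, continuous (sqdist a : spacetime -> R)} by exact: sqdist_continuous.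
have ct : {for y, continuous (fun y : spacetime => y.2)} by exact: (@crd_continuous R N None).
have cst : {for y, continuous (fun y : spacetime => sqdist a y + y.2)}.
  by apply: cvgD; [exact: cs|exact: ct].
have n1 := cvgr_lt _ cs _ h1; have n2 := cvgr_gt _ ct _ h2.
have n3 := cvgr_lt _ ct _ h3; have n4 := cvgr_gt _ cst _ h4.
near=> y'; split; near: y'; [exact: n1|exact: n2|exact: n3|exact: n4].
Unshelve. all: by end_near. Qed.

Lemma inner_regular lo tau (y : spacetime) : 0 <= lo -> 0 <= tau -> inner lo tau y ->
  [/\ cylinder Omega T y, {for y, continuous U} &
      {for y, continuous (absorption alpha q U)}].
Proof.
move=> lo0 tau0 Oy; have [h1 h2 h3 h4] := Oy.
have y0 : 0 < y.2 by exact: le_lt_trans h2.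
have sub : inner lo tau `<=` (Omega `*` `[0, T]) `\ (a, 0).
  move=> z [z1 z2 z3 z4]; apply: domain_mem.
  - exact: ltW.
  - by rewrite (le_trans lo0)// ltW.
  - by rewrite (le_trans _ T2T)// ltW.
  - exact: le_lt_trans z4.
have cUy : {for y, continuous U}.
  have /subspace_continuousP/(_ y (sub y Oy)) h := cU.
  apply/cvgrPdist_lt => e e0; have /cvgrPdist_lt/(_ e e0)/nbhs_ballP[r /= r0 hr] := h.
  have nb := nbhsx_ballx y _ r0; have nO := nbhs_inner Oy.
  near=> z; apply: hr; first by near: z; exact: nb.
  by apply: sub; near: z; exact: nO.
split => //.
  split; first exact/RO/ltW.
  by rewrite /= in_itv/= y0 (lt_le_trans h3).
exact: absorption_continuous.
Unshelve. all: by end_near. Qed.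

Lemma region_comparison lo tau (w wt : spacetime -> R) (wxx : 'I_N -> spacetime -> R) :
  0 <= lo -> 0 < tau ->
  {within region a R2 0 lo T1 tau, continuous w} ->
  (forall z, region a R2 0 lo T1 tau z -> w z < U z ->
    [/\ sqdist a z != R2, z.2 != lo & sqdist a z + z.2 != tau]) ->
  (forall z, inner lo tau z -> C12_at w wt wxx z /\
     {for z, continuous (fun y => wt y - \sum_i wxx i y)}) ->
  (forall z, inner lo tau z -> w z < U z ->
     0 < wt z - \sum_i wxx i z + absorption alpha q U z) ->
  forall z, region a R2 0 lo T1 tau z -> U z <= w z.
Proof.
move=> lo0 tau0 cw bd reg op.
apply: (@comparison R N Omega T T1 U (absorption alpha q U) w wt wxx _ (inner lo tau)) => //.
- by exact: compact_region.
- apply: continuous_subspaceW cU; exact: region_domain.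
- move=> z Sz; have [z1 _ z2 z3 z4] := Sz; split=> // /(bd z Sz)[b1 b2 b3].
  split; first by rewrite lt_neqAle b1.
  + by rewrite lt_neqAle eq_sym b2.
  + exact: le_lt_trans T12.
  + by rewrite lt_neqAle eq_sym b3.
- move=> z Oz; have [cyl c1 c2] := inner_regular lo0 (ltW tau0) Oz; split=> //.
    exact: nbhs_inner.
  move=> zT; have [z1 z2 z3 z4] := Oz.
  by split => //; [exact: ltW|exact: sqdist_ge0|exact: ltW|exact: ltW].
Qed.

Let k := kexp alpha q.
Let m := mexp N alpha q.

(** For fixed [tau] the region avoids the singularity and [U] is bounded on it by some [B]. This [B]
    depends on [tau], but it only decides how close to the paraboloid the comparison is made, so
    [Lam] is uniform. *)
Lemma blowup_bound : exists Lam, forall tau (y : spacetime), 0 < tau ->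
  sqdist a y <= R2 -> 0 < y.2 -> y.2 <= T1 -> tau < sqdist a y + y.2 ->
  U y <= eps + expR (blowup N alpha q Lam tau (sqdist a y) y.2).
Proof.
have [Lam hLam] := blowup_super hN halpha hq; exists Lam => tau y tau0 yR y0 yT ytau.
have m0 : 0 < m := mexp_gt0 hN halpha hq.
have k0 : 0 < k := kexp_gt0 hN halpha hq.
have cK : compact (region a R2 0 0 T1 tau) by exact: compact_region.
have cUK : {within region a R2 0 0 T1 tau, continuous U}.
  by apply: continuous_subspaceW cU; exact: region_domain.
(* The barrier contains $t^k$, which vanishes at time 0; the comparison therefore starts at a
   positive [t1] up to which [U < eps]. *)
have [t1 t10 ht1] : exists2 t1, 0 < t1 &
    forall y, region a R2 0 0 T1 tau y -> y.2 <= t1 -> U y < eps.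
  apply: small_time => //; first by move=> z [].
  move=> z [z1 _ _ _ z4] z2; rewrite (_ : z = (z.1, 0)); last first.
    by case: (z) z2 => ? ? /= ->.
  rewrite U0//; first exact: RO.
  by apply/eqP => za; move: z4; rewrite z2 addr0 /sqdist za big1 ?leNgt ?tau0// => i _;
    rewrite subrr expr0n.
have Ky : region a R2 0 0 T1 tau y.
  by split => //; [exact: sqdist_ge0|exact: ltW|exact: ltW].
have [yt1|yt1] := lerP y.2 t1.
  by rewrite (le_trans (ltW (ht1 y Ky yt1)))// lerDl expR_ge0.
have [z0 Kz0 hB] := compact_EVT_max (ex_intro _ y Ky) cK cUK.
pose B := `|U z0| + 1; have B0 : 0 < B by rewrite ltr_wpDl.
have UB z : region a R2 0 0 T1 tau z -> U z <= B.
  move=> Kz; rewrite (le_trans (hB z _)) ?inE// (le_trans (ler_norm _))//.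
  by rewrite lerDl.
(* Any [eta <= eta0] makes the barrier at least [B] where [r + t = tau + eta] and [t >= t1]. *)
pose eta0 := expR ((Lam + k * ln t1 + m * ln tau - ln B) / (2 * m)).
pose eta := Num.min (sqdist a y + y.2 - tau) eta0.
have etagt : 0 < eta by rewrite lt_min subr_gt0 ytau expR_gt0.
have eta1 : eta <= sqdist a y + y.2 - tau by rewrite ge_min lexx.
have eta2 : eta <= eta0 by rewrite ge_min lexx orbT.
pose tau1 := tau + eta.
have tau10 : 0 < tau1 by rewrite addr_gt0.
pose L := blowup N alpha q Lam tau.
have dom z : inner t1 tau1 z -> ansatz_dom tau 0 0 (sqdist a z) z.2.
  move=> [z1 z2 z3 z4]; split.
  - exact: lt_trans z2.
  - exact: lt_trans z4.
  - by rewrite (lt_trans _ z4)// ltrDl.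
  - by rewrite /theta mul0r addr0.
have domS z : region a R2 0 t1 T1 tau1 z -> ansatz_dom tau 0 0 (sqdist a z) z.2.
  move=> [z1 _ z2 z3 z4]; split.
  - exact: lt_le_trans z2.
  - exact: lt_le_trans z4.
  - by rewrite (lt_le_trans _ z4)// ltrDl.
  - by rewrite /theta mul0r addr0.
have Sy : region a R2 0 t1 T1 tau1 y.
  split => //; [exact: sqdist_ge0|exact: ltW|rewrite /tau1; lra].
apply: (@region_comparison t1 tau1 (fun y => eps + expR (radial a L y))
  (fun y => 0 + exp_t a L (ansatz_t k m (- (2 * m)) 0 0 tau 0 0) y)
  (fun i y => 0 + exp_xx a L (ansatz_r m (- (2 * m)) 0 tau)
     (ansatz_rr m (- (2 * m)) tau) i y) (ltW t10) tau10 _ _ _ _ y Sy).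
- rewrite continuous_subspace_in => z; rewrite inE => Sz.
  apply: continuous_subspaceT_for => //; apply: cvgD; first exact: cvg_cst.
  have [[cz _ _] _] := ansatz_C12 Lam k m (- (2 * m)) 0 0 (domS z Sz).
  exact: cz.
- move=> z Sz wz; have [z1 _ z2 z3 z4] := Sz.
  have Kz : region a R2 0 0 T1 tau z.
    split => //; [exact: sqdist_ge0|lra|move: z4; rewrite /tau1; lra].
  have wE : 0 < expR (radial a L z) by exact: expR_gt0.
  split; apply/eqP => E.
  + have := lateral E (le_trans (ltW t10) z2) z3; move: wz wE; lra.
  + have := ht1 z Kz; rewrite E lexx => /(_ isT); move: wz wE; lra.
  + suff : B <= expR (radial a L z) by have := UB z Kz; move: wz eps0; lra.
    rewrite -(lnK (x := B)) ?posrE// ler_expR /radial /L /blowup /ansatz.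
    rewrite !mul0r !addr0 E /tau1 addrAC subrr add0r -/k -/m.
    have l1 : k * ln t1 <= k * ln z.2.
      by rewrite ler_wpM2l ?(ltW k0)// ler_ln ?posrE// (lt_le_trans t10).
    have l2 : m * ln tau <= m * ln (tau + eta).
      by rewrite ler_wpM2l ?(ltW m0)// ler_ln ?posrE ?addr_gt0// lerDl ltW.
    have l3 : 2 * m * ln eta <= Lam + k * ln t1 + m * ln tau - ln B.
      rewrite mulrC -ler_pdivlMr ?mulr_gt0// -[leRHS]expRK.
      by rewrite ler_ln ?posrE ?expR_gt0.
    lra.
- move=> z Oz; have [c1 c2] := ansatz_C12 Lam k m (- (2 * m)) 0 0 (dom z Oz); split.
    by apply: C12_add c1; exact: C12_cst.
  rewrite (_ : (fun y => _ - _) = (fun y => exp_t a L (ansatz_t k m (- (2 * m)) 0 0 tau 0 0) y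
    - \sum_i exp_xx a L (ansatz_r m (- (2 * m)) 0 tau) (ansatz_rr m (- (2 * m)) tau) i y)).
    exact: c2.
  by apply/funext => x; rewrite add0r; congr (_ - _); apply: eq_bigr => i _; rewrite add0r.
- move=> z Oz wz; have [z1 z2 z3 z4] := Oz.
  have zt0 : 0 < z.2 by exact: lt_trans z2.
  have := absorption_gt alpha q1 zt0 (lt_le_trans _ (lexx (U z))).
  move=> /(_ (radial a L z))/(_ (lt_trans _ wz)); rewrite ltrDr => /(_ eps0) Fz.
  rewrite add0r; under eq_bigr do rewrite add0r.
  rewrite exp_operator.
  have rt1 : sqdist a z + z.2 <= 1 by move: R21 T21; lra.
  have ztau : tau < sqdist a z + z.2 by rewrite (lt_trans _ z4)// ltrDl.
  have := hLam tau _ _ tau0 (sqdist_ge0 a z) zt0 ztau rt1.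
  rewrite -(pmulr_rge0 _ (expR_gt0 (radial a L z))) mulrDr -expRD.
  move=> h; apply: le_lt_trans h _; rewrite ltrD2l.
  move: Fz; congr (expR _ < _).
  by rewrite /radial -/L; ring.
Qed.

(** Choosing [tau] as half of [r + t] at each point turns $(\rho-\tau)^{-2m}$ into
    $2^{2m}\rho^{-2m}$. *)
Lemma self_similar_bound : exists b, forall (y : spacetime),
  sqdist a y <= R2 -> 0 < y.2 -> y.2 <= T1 ->
  U y <= eps + expR (b + k * ln y.2 - m * ln (sqdist a y + y.2)).
Proof.
have [Lam h] := blowup_bound; exists (Lam + 2 * m * ln 2) => y yR y0 yT.
have rho0 : 0 < sqdist a y + y.2 by rewrite ltr_wpDl// sqdist_ge0.
have tau0 : 0 < (sqdist a y + y.2) / 2 by rewrite divr_gt0.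
have tau1 : (sqdist a y + y.2) / 2 < sqdist a y + y.2 by lra.
apply: le_trans (h _ y tau0 yR y0 yT tau1) _; rewrite lerD2l ler_expR.
rewrite /blowup /ansatz !mul0r !addr0 -/k -/m.
rewrite (_ : sqdist a y + y.2 - (sqdist a y + y.2) / 2 = (sqdist a y + y.2) / 2); last by field.
by rewrite lnM ?posrE ?invr_gt0// lnV ?posrE//; lra.
Qed.

Let p := pexp q.

Lemma decay_bound : exists A b c, 0 < c /\ forall tau (y : spacetime), 0 < tau ->
  sqdist a y <= R2 -> tau <= y.2 -> y.2 <= T1 ->
  U y <= eps + (expR (decay1 N q A c (ln tau) (sqdist a y) y.2) +
                expR (decay2 N alpha q b c (ln tau) (sqdist a y) y.2)).
Proof.
have [b hb] := self_similar_bound.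
have [A [c [c0 hAc]]] := decay_super hN halpha hq b.
exists A, b, c; split=> // tau y tau0 yR ytau yT.
pose L1 := decay1 N q A c (ln tau); pose L2 := decay2 N alpha q b c (ln tau).
pose n : R := N%:R.
have t20 : 0 < tau / 2 by rewrite divr_gt0.
have th1 t : tau <= t -> 1 <= theta c (ln tau) t.
  move=> h; rewrite /theta lerDl mulr_ge0 ?(ltW c0)// subr_ge0.
  by rewrite ler_ln ?posrE// (lt_le_trans tau0).
have dom (z : spacetime) : tau <= z.2 -> ansatz_dom 0 c (ln tau) (sqdist a z) z.2.
  move=> tz; have z0 : 0 < z.2 by exact: lt_le_trans tz.
  have r0 : 0 < sqdist a z + z.2 by rewrite ltr_wpDl// sqdist_ge0.
  by split=> //; apply: lt_le_trans (th1 _ tz).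
(* With [tau / 2], the condition on [r + t] holds strictly whenever [t >= tau], so the paraboloid
   contributes no boundary. *)
have Sy : region a R2 0 tau T1 (tau / 2) y.
  split => //; first exact: sqdist_ge0.
  by have := sqdist_ge0 a y; lra.
pose wt1 := exp_t a L1 (ansatz_t (- (n / 2)) 0 0 (- 4^-1) (- p) 0 c (ln tau)).
pose wt2 := exp_t a L2 (ansatz_t k (- m) 0 0 (- (p + 1)) 0 c (ln tau)).
pose wx1 := exp_xx a L1 (ansatz_r 0 0 (- 4^-1) 0) (ansatz_rr 0 0 0).
pose wx2 := exp_xx a L2 (ansatz_r (- m) 0 0 0) (ansatz_rr (- m) 0 0).
have opE z : (0 + (wt1 z + wt2 z)) - \sum_i (0 + (wx1 i z + wx2 i z)) =
    (wt1 z - \sum_i wx1 i z) + (wt2 z - \sum_i wx2 i z).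
  under eq_bigr do rewrite add0r.
  by rewrite big_split/= add0r; ring.
have C12z (z : spacetime) : tau <= z.2 ->
    [/\ C12_at (fun y => expR (radial a L1 y)) wt1 wx1 z,
        C12_at (fun y => expR (radial a L2 y)) wt2 wx2 z,
        {for z, continuous (fun y => wt1 y - \sum_i wx1 i y)} &
        {for z, continuous (fun y => wt2 y - \sum_i wx2 i y)}].
  move=> tz.
  have [d1 e1] := ansatz_C12 A (- (n / 2)) 0 0 (- 4^-1) (- p) (dom z tz).
  by have [d2 e2] := ansatz_C12 b k (- m) 0 0 (- (p + 1)) (dom z tz).
apply: (@region_comparison tau (tau / 2)
  (fun y => eps + (expR (radial a L1 y) + expR (radial a L2 y)))
  (fun y => 0 + (wt1 y + wt2 y)) (fun i y => 0 + (wx1 i y + wx2 i y))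
  (ltW tau0) t20 _ _ _ _ y Sy).
- rewrite continuous_subspace_in => z; rewrite inE => Sz; have [_ _ tz _ _] := Sz.
  have [[d1 _ _] [d2 _ _] _ _] := C12z z tz.
  apply: continuous_subspaceT_for => //; apply: cvgD; first exact: cvg_cst.
  by apply: cvgD; [exact: d1|exact: d2].
- move=> z [z1 _ z2 z3 z4] wz.
  have z0 : 0 < z.2 by exact: lt_le_trans z2.
  have p1 : 0 < expR (radial a L1 z) by exact: expR_gt0.
  have p2 : 0 < expR (radial a L2 z) by exact: expR_gt0.
  split; apply/eqP => E.
  + have := lateral E (ltW z0) z3; move: wz; lra.
  (* At [t = tau], [theta] is 1 and the tail alone is the self-similar bound. *)
  + have := hb z z1 z0 z3.
    have -> : b + k * ln z.2 - m * ln (sqdist a z + z.2) = radial a L2 z.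
      rewrite /radial /L2 /decay2 /ansatz /theta E subrr mulr0 addr0 ln1 -/k -/m; ring.
    by move: wz; lra.
  + by have := sqdist_ge0 a z; lra.
- move=> z [z1 z2 z3 z4]; have [d1 d2 e1 e2] := C12z z (ltW z2); split.
    by apply: C12_add; [exact: C12_cst|exact: C12_add].
  rewrite (_ : (fun y => _ - _) =
      (fun y => (wt1 y - \sum_i wx1 i y) + (wt2 y - \sum_i wx2 i y))); last first.
    by apply/funext => x; exact: opE.
  exact: cvgD e1 e2.
- move=> z [z1 z2 z3 z4] wz; rewrite opE.
  have z0 : 0 < z.2 by exact: lt_trans z2.
  have zL : expR (radial a L1 z) < U z.
    by apply: lt_trans wz; rewrite addrCA ltrDl addr_gt0// expR_gt0.
  have Fz := absorption_gt alpha q1 z0 zL.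
  rewrite /wt1 /wx1 /wt2 /wx2 !exp_operator.
  have zt1 : z.2 <= 1 by move: T21; lra.
  have ltz : ln tau <= ln z.2 by rewrite ler_ln ?posrE// ltW.
  apply: le_lt_trans (hAc (ln tau) _ _ (sqdist_ge0 a z) z0 zt1 ltz) _.
  by rewrite ltrD2l.
Qed.

(** At a fixed point both barriers are at most a constant times $\theta^{-p}$, and $\theta$ tends to
    infinity as $\tau$ tends to 0. *)
Lemma one_sided_bound (y : spacetime) : sqdist a y <= R2 -> 0 < y.2 -> y.2 <= T1 ->
  U y <= eps.
Proof.
move=> yR y0 yT; have [A [b [c [c0 h]]]] := decay_bound.
have p0 : 0 < p := pexp_gt0 hN halpha hq.
apply/ler_addgt0Pr => eta eta0.
pose K1 := expR (A - N%:R / 2 * ln y.2 - 4^-1 * (sqdist a y / y.2)).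
pose K2 := expR (b + k * ln y.2 - m * ln (sqdist a y + y.2)).
have K0 : 0 < K1 + K2 by rewrite addr_gt0 ?expR_gt0.
(* [X] is a value of [ln theta] that brings the barriers below [eta]; [M] and [tau] solve for it. *)
pose X := Num.max 0 (ln ((K1 + K2) / eta) / p).
have X0 : 0 <= X by rewrite le_max lexx.
have X1 : ln ((K1 + K2) / eta) / p <= X by rewrite le_max lexx orbT.
pose M := (expR X - 1) / c.
have M0 : 0 <= M by rewrite divr_ge0 ?(ltW c0)// subr_ge0 -expR0 ler_expR.
pose tau := expR (ln y.2 - M).
have tauy : tau <= y.2.
  by rewrite -[leRHS](lnK (x := y.2)) ?posrE// ler_expR lerBlDr lerDl.
have lnth : ln (theta c (ln tau) y.2) = X.
  rewrite /theta /tau expRK opprB addrCA subrr addr0 /M mulrC divfK ?gt_eqF//.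
  by rewrite addrCA subrr addr0 expRK.
apply: le_trans (h tau y (expR_gt0 _) yR tauy yT) _; rewrite lerD2l.
have e1 : expR (decay1 N q A c (ln tau) (sqdist a y) y.2) = K1 * expR (- (p * X)).
  rewrite -expRD; congr expR; rewrite /decay1 /ansatz lnth -/p; ring.
have e2 : expR (decay2 N alpha q b c (ln tau) (sqdist a y) y.2) <= K2 * expR (- (p * X)).
  rewrite -expRD ler_expR /decay2 /ansatz lnth -/p -/k -/m; lra.
rewrite e1; apply: (@le_trans _ _ ((K1 + K2) * expR (- (p * X)))).
  by rewrite mulrDl lerD2l.
rewrite expRN ler_pdivrMr ?expR_gt0// -ler_pdivrMl// mulrC.
rewrite -[leLHS](lnK (x := _ / _)) ?posrE ?divr_gt0// ler_expR.
by rewrite -ler_pdivrMl// mulrC.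
Qed.

End OneSidedBound.

(** Supplies the lateral condition of the comparison: on the sphere of squared radius [R2] the
    initial values are 0, so compactness gives [U < eps] for a short time. *)
Lemma small_one_sided_bound {R : realType} (N : nat) (hN : (0 < N)%N)
    (alpha q : R) (halpha : -1 < alpha) (hq : q_crit alpha N <= q)
    (Omega : set 'rV[R]_N) (T : R) (a : 'rV[R]_N) (U : 'rV[R]_N * R -> R)
    (R2 T2 eps : R) :
  weak_heat Omega T U (absorption alpha q U) ->
  {within (Omega `*` `[0, T]) `\ (a, 0), continuous U} ->
  (forall x, Omega x -> x != a -> U (x, 0) = 0) ->
  0 < R2 -> R2 <= 2^-1 -> 0 < T2 -> T2 <= T -> T2 <= 2^-1 -> 0 < eps ->
  (forall y : 'rV[R]_N * R, sqdist a y <= R2 -> Omega y.1) ->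
  exists2 T1, 0 < T1 & forall y : 'rV[R]_N * R,
    sqdist a y <= R2 -> 0 < y.2 -> y.2 <= T1 -> U y <= eps.
Proof.
move=> wU cU U0 R20 R21 T20 T2T T21 eps0 RO.
pose K := region a R2 R2 0 T2 R2.
have cK : compact K by apply: compact_region => //; lra.
have KA : K `<=` (Omega `*` `[0, T]) `\ (a, 0).
  move=> y [y1 y2 y3 y4 y5]; split.
    by split; [exact: RO|rewrite /= in_itv/= y3 (le_trans y4)].
  by move=> ya; move: y2; rewrite ya sqdist_center leNgt R20.
have [t1 t10 ht1] : exists2 t1, 0 < t1 & forall y, K y -> y.2 <= t1 -> U y < eps.
  apply: small_time => //; first exact: continuous_subspaceW cU.
    by move=> y [].
  move=> [x t] [y1 y2 _ _ _] /= t0; rewrite t0 in y1 y2 *.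
  rewrite U0//; first exact: (RO (x, 0)).
  by apply/eqP => xa; move: y2; rewrite xa sqdist_center leNgt R20.
pose T1 := Num.min t1 (T2 / 2).
have T10 : 0 < T1 by rewrite lt_min t10 divr_gt0.
have T1t : T1 <= t1 by rewrite ge_min lexx.
have T1T2 : T1 <= T2 / 2 by rewrite ge_min lexx orbT.
have T12 : T1 < T2 by lra.
exists T1 => // y yR y0 yT.
apply: (one_sided_bound hN halpha hq wU cU U0 R21 T12 T2T T21 eps0 RO _ yR y0 yT).
move=> z zR z0 zT; apply: ht1; last exact: le_trans T1t.
by split => //; rewrite ?zR//; lra.
Qed.

Lemma sqdist_ball {R : realType} (N : nat) (a : 'rV[R]_N) (e : R) (y : 'rV[R]_N * R) :
  0 < e -> sqdist a y <= (e / 2) ^+ 2 -> ball a e y.1.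
Proof.
move=> e0 ye; split=> // i j; rewrite ord1 /ball /= distrC.
have := le_trans (sqdist_coord a y j) ye.
rewrite -real_normK ?num_real// ler_pXn2r ?nnegrE ?divr_ge0 ?(ltW e0)//.
by move=> /le_lt_trans; apply; rewrite ltr_pdivrMr// ltr_pMr// ltr1n.
Qed.

(** * Removability of the singularity *)

Unset Implicit Arguments.
Set Strict Implicit.

Theorem theoremC (R : realType) (N : nat) (hN : (0 < N)%N)
    (Omega : set 'rV[R]_N) (hopen : open Omega) (hconn : connected Omega)
    (a : 'rV[R]_N) (ha : Omega a) (T : R) (hT : 0 < T)
    (alpha : R) (halpha : -1 < alpha) (q : R) (hq : q_crit alpha N <= q)
    (u : 'rV[R]_N * R -> R)
    (hC1 : C1_on (cylinder Omega T) u)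
    (hC0 : {within (Omega `*` `[0, T]) `\ (a, 0), continuous u})
    (hsol : distributional_solution Omega T alpha q u)
    (hinit : forall x, Omega x -> x != a -> u (x, 0) = 0) :
  exists v : 'rV[R]_N * R -> R,
    {within Omega `*` `[0, T], continuous v} /\
    forall z, ((Omega `*` `[0, T]) `\ (a, 0)) z -> v z = u z.
Proof.
have q1 : 1 < q := q_gt1 hN halpha hq.
have wu : weak_heat Omega T u (absorption alpha q u) by [].
have wNu : weak_heat Omega T (fun z => - u z) (absorption alpha q (fun z => - u z)).
  rewrite (_ : absorption _ _ _ = (fun z => - absorption alpha q u z)).
    exact: weak_heatN.
  by apply/funext => z; rewrite absorptionN.
have cNu : {within (Omega `*` `[0, T]) `\ (a, 0), continuous (fun z => - u z)}.
  by move=> y; apply: cvgN; exact: hC0.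
have Nu0 x : Omega x -> x != a -> - u (x, 0) = 0.
  by move=> h1 h2; rewrite hinit// oppr0.
have [e e0 he] : exists2 e : R, 0 < e & ball a e `<=` Omega.
  by have /nbhs_ballP[e e0 he] := open_nbhs_nbhs (conj hopen ha); exists e.
pose R2 := Num.min ((e / 2) ^+ 2) 2^-1.
have R20 : 0 < R2 by rewrite lt_min exprn_gt0 ?divr_gt0// invr_gt0 ltr0n.
have R2e : R2 <= (e / 2) ^+ 2 by rewrite ge_min lexx.
have R21 : R2 <= 2^-1 by rewrite ge_min lexx orbT.
have RO (y : 'rV[R]_N * R) : sqdist a y <= R2 -> Omega y.1.
  by move=> h; apply/he/sqdist_ball => //; exact: le_trans R2e.
pose T2 := Num.min T 2^-1.
have T20 : 0 < T2 by rewrite lt_min hT invr_gt0 ltr0n.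
have T2T : T2 <= T by rewrite ge_min lexx.
have T21 : T2 <= 2^-1 by rewrite ge_min lexx orbT.
(* The bounds for [u] and [- u] squeeze the limit at [(a, 0)] to 0. *)
pose v z := if z == (a, 0) then 0 else u z.
exists v; split; last by move=> z [_ /eqP za]; rewrite /v (negbTE za).
suff key (z : 'rV[R]_N * R) (eps : R) : (Omega `*` `[0, T]) z -> 0 < eps ->
    \forall y \near z, (Omega `*` `[0, T]) y -> `|v z - v y| < eps.
  apply/subspace_continuousP => z Az; apply/cvgrPdist_lt => eps eps0.
  exact: (key z eps Az eps0).
move=> Az eps0.
have [za|za] := eqVneq z (a, 0).
  have e2 : 0 < eps / 2 by rewrite divr_gt0.
  have [s s0 hs] := small_one_sided_bound hN halpha hq wu hC0 hinit R20 R21 T20 T2T T21 e2 RO.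
  have [t t0 ht] := small_one_sided_bound hN halpha hq wNu cNu Nu0 R20 R21 T20 T2T T21 e2 RO.
  have cs : {for z, continuous (sqdist a : 'rV[R]_N * R -> R)} by exact: sqdist_continuous.
  have ct : {for z, continuous (fun y : 'rV[R]_N * R => y.2)} by exact: (@crd_continuous R N None).
  have n1 := cvgr_lt _ cs R2 _; have n2 := cvgr_lt _ ct s _; have n3 := cvgr_lt _ ct t _.
  rewrite za sqdist_center /= in n1 n2 n3.
  rewrite za /v eqxx; near=> y => Ay.
  have yR : sqdist a y < R2 by near: y; exact: n1.
  have ys : y.2 < s by near: y; exact: n2.
  have yt : y.2 < t by near: y; exact: n3.
  rewrite sub0r normrN; case: eqP => [_|ya]; first by rewrite normr0.
  have [yO] := Ay; rewrite /= in_itv/= => /andP[y0 yT].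
  (* The one-sided bounds concern positive times; at time 0 the initial condition takes over. *)
  move: y0; rewrite le_eqVlt => /orP[/eqP y0|y0].
    have -> : u y = 0; last by rewrite normr0.
    rewrite (_ : y = (y.1, 0)); last by case: (y) y0 => ? ? /= <-.
    rewrite hinit//; apply/eqP => yxa; apply: ya.
    by case: (y) yxa y0 => ? ? /= -> <-.
  have h1 := hs y (ltW yR) y0 (ltW ys); have h2 := ht y (ltW yR) y0 (ltW yt).
  rewrite ltr_norml; apply/andP; split; lra.
have Az' : ((Omega `*` `[0, T]) `\ (a, 0)) z by split => //; exact/eqP.
have /subspace_continuousP/(_ z Az')/cvgrPdist_lt/(_ eps eps0) h := hC0.
have /nbhs_ballP[r /= r0 hr] := h.
(* This function vanishes only at [(a, 0)], so its positivity near [z] keeps [v] equal to [u]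
   there. *)
have cg : {for z, continuous (fun y : 'rV[R]_N * R => sqdist a y + `|y.2|)}.
  apply: cvgD; first exact: sqdist_continuous.
  apply: (@continuous_comp _ _ _ (crd None) (fun s : R => `|s|)); first exact: crd_continuous.
  exact: norm_continuous.
have gz : 0 < sqdist a z + `|z.2|.
  rewrite lt_neqAle addr_ge0 ?sqdist_ge0// andbT eq_sym paddr_eq0 ?sqdist_ge0//.
  apply/negP => /andP[/eqP/sqdist_eq0 h1]; rewrite normr_eq0 => /eqP h2.
  by move/eqP: za; apply; case: (z) h1 h2 => ? ? /= -> ->.
have ng := cvgr_gt _ cg _ gz.
have nb := nbhsx_ballx (z : 'rV[R]_N * R) _ r0.
rewrite /v (negbTE za); near=> y => Ay.
have gy : 0 < sqdist a y + `|y.2| by near: y; exact: ng.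
have yr : ball z r y by near: y; exact: nb.
have ya : y <> (a, 0) by move=> E; move: gy; rewrite E sqdist_center/= normr0 addr0 ltxx.
by case: eqP => // _; exact: hr.
Unshelve. all: by end_near.
Qed.
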